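(* Let $\mathcal T_n$ be a conditioned Galton--Watson tree defined by an offspring distribution $\xi$ with $\mathbb E\xi=1$ and $0<\operatorname{Var}\xi<\infty$. If $\operatorname{Re}\alpha<0$, then, as $n\to\infty$, $$\frac{X_n(\alpha)-n\mu(\alpha)}{\sqrt n}\xrightarrow{d}\hat X(\alpha).$$ Moreover, this holds in the space $\mathcal H(H_-)$, where $H_-:=\{\alpha\in\mathbb C:\operatorname{Re}\alpha<0\}$.
   Context: The offspring distribution is the distribution of a non-negative integer-valued random variable $\xi$. The Galton--Watson tree $\mathcal T$ with offspring distribution $\xi$ is the random rooted ordered tree in which each node has a number of children that is an independent copy of $\xi$ (it is a.s. finite here). $|T|$ denotes the number of nodes of a tree $T$. The conditioned Galton--Watson tree $\mathcal T_n$ is $\mathcal T$ conditioned on $|\mathcal T|=n$; only $n$ with $\mathbb P(|\mathcal T|=n)>0$ are considered, and $n\to\infty$ through such $n$. For a rooted tree $T$ and a node $v\in T$, $T_v$ is the subtree consisting of $v$ and all its descendants. For $\alpha\in\mathbb C$, $X_n(\alpha):=\sum_{v\in\mathcal T_n}|\mathcal T_{n,v}|^\alpha$ (where $\mathcal T_{n,v}=(\mathcal T_n)_v$). For $\operatorname{Re}\alpha<\frac12$, $\mu(\alpha):=\mathbb E|\mathcal T|^\alpha=\sum_{n\ge1}n^\alpha\,\mathbb P(|\mathcal T|=n)$. For an open $D\subseteq\mathbb C$, $\mathcal H(D)$ is the space of analytic functions on $D$ with the topology of uniform convergence on compact sets; convergence ''in $\mathcal H(D)$'' means convergence in distribution of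 random elements of $\mathcal H(D)$. The limit $\hat X=(\hat X(\alpha))_{\alpha\in H_-}$ (whose distribution depends on $\xi$) is the random analytic function on $H_-$, with each $\hat X(\alpha)$ a centered complex normal random variable (i.e. $(\operatorname{Re}\hat X(\alpha),\operatorname{Im}\hat X(\alpha))$ is two-dimensional normal), unique in distribution, such that $n^{-1/2}\bigl(X_n(\alpha)-\mathbb EX_n(\alpha)\bigr)\xrightarrow{d}\hat X(\alpha)$ in $\mathcal H(H_-)$. *)

(* Defs.v *)
From HB Require Import structures.
From mathcomp Require Import all_boot all_order all_algebra.
From mathcomp Require Import complex finmap.
From mathcomp Require Import all_classical all_reals all_analysis.

Set Implicit Arguments.
Unset Strict Implicit.
Unset Printing Implicit Defensive.

Import Order.TTheory GRing.Theory Num.Theory numFieldNormedType.Exports.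

Local Open Scope classical_set_scope.
Local Open Scope ring_scope.

Definition mutually_independent d d' (T : measurableType d)
    (E : measurableType d') (R : realType) (P : probability T R) (I : choiceType)
    (X : I -> {mfun T >-> E}) : Prop :=
  forall (s : seq I) (A : I -> set E), uniq s -> (forall i, measurable (A i)) ->
    P (\bigcap_(i in [set` s]) (X i @^-1` A i)) =
    (\prod_(i <- s) P (X i @^-1` A i))%E.

Definition borel_measurable d (T : measurableType d) (S : topologicalType)
    (X : T -> S) : Prop :=
  forall B : set S, <<s open >> B -> measurable (X @^-1` B).

(* Only the probability varies with [n], the sample space [T] is fixed. *)
Definition cvg_in_dist d d' (T : measurableType d) (T' : measurableType d')
    (R : realType) (S : topologicalType) (F : set_system nat)
    (P : nat -> probability T R) (X : nat -> T -> S)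
    (Q : probability T' R) (Y : T' -> S) : Prop :=
  [/\ \forall n \near F, borel_measurable (X n), borel_measurable Y &
      forall f : S -> R, continuous f -> (exists M, forall s, `|f s| <= M) ->
        ('E_(P n)[(f \o X n)%R])%E @[n --> F] --> ('E_Q[(f \o Y)%R])%E].

(* [s = 0], the point mass at 0, is allowed ([normal_prob 0 0] is not it). *)
Definition centered_normal d (T : measurableType d) (R : realType)
    (Q : probability T R) (Z : T -> R) : Prop :=
  exists2 s : R, 0 <= s & forall B : set R, measurable B ->
    Q (Z @^-1` B) = if s == 0 then \d_(0 : R) B else normal_prob 0 s B.

(* (Re Z, Im Z) is two-dimensional normal, possibly degenerate. *)
Definition centered_complex_normal d (T : measurableType d) (R : realType)
    (Q : probability T R) (Z : T -> R[i]) : Prop :=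
  forall a b : R, centered_normal Q
    (fun w => a * complex.Re (Z w) + b * complex.Im (Z w)).

Definition analytic_on (R : realType) (D : set R[i]^o) :
    set {family compact, D -> R[i]^o} :=
  [set f | exists2 g : R[i]^o -> R[i]^o,
             forall z, D z -> derivable g z 1 & forall z : D, f z = g (set_val z)].
Arguments analytic_on {R} D.

(* Meant for open [D], where differentiability of [g] at the points of [D]
   only depends on [f]. The topology is the one induced by
   [{family compact, D -> R[i]^o}]: uniform convergence on compact sets. *)
Definition hol (R : realType) (D : set R[i]^o) := set_type (analytic_on D).

HB.instance Definition _ (R : realType) (D : set R[i]^o) :=
  Topological.on (hol D).

Definition hol_eval (R : realType) (D : set R[i]^o) (f : hol D) (z : D) :
  R[i]^o := (set_val f : {family compact, D -> R[i]^o}) z.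

(* That the functions [X n ^~ w] are analytic on [D] is part of the claim. *)
Definition cvg_in_hol d d' (T : measurableType d) (T' : measurableType d')
    (R : realType) (D : set R[i]^o) (F : set_system nat)
    (P : nat -> probability T R) (X : nat -> R[i] -> T -> R[i])
    (Q : probability T' R) (Y : T' -> hol D) : Prop :=
  exists2 Z : nat -> T -> hol D,
    \forall n \near F, forall w (z : D), hol_eval (Z n w) z = X n (set_val z) w &
    cvg_in_dist F P Z Q Y.

Definition Hminus (R : realType) : set R[i]^o := [set z | complex.Re z < 0].
Arguments Hminus R : clear implicits.

(* [n] to the complex power [a], for [0 < n] *)
Definition npowc (R : realType) (n : nat) (a : R[i]) : R[i] :=
  (expR (complex.Re a * ln n%:R))%:C%C *
  Complex (cos (complex.Im a * ln n%:R)) (sin (complex.Im a * ln n%:R)).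

(* Rooted ordered trees in the Ulam-Harris encoding: the root is [[::]] and the
   children of [u] are [rcons u k], [k < c u], if [u] has [c u] children. *)
Definition tree_nodes (c : seq nat -> nat) : set (seq nat) :=
  [set u | forall i, (i < size u)%N -> (nth 0%N u i < c (take i u))%N].

Definition subtree (t : {fset seq nat}) (v : seq nat) : {fset seq nat} :=
  [fset u in t | prefix v u]%fset.

Definition tree_sum (R : realType) (a : R[i]) (t : {fset seq nat}) : R[i] :=
  \sum_(v <- t) npowc #|` subtree t v|%fset a.

Definition cexpectation d (T : measurableType d) (R : realType)
    (P : probability T R) (f : T -> R[i]) : R[i] :=
  Complex (fine 'E_P[(fun w => complex.Re (f w))%R]%E)
          (fine 'E_P[(fun w => complex.Im (f w))%R]%E).

Section galton_watson.
Context d (T : measurableType d) (xis : seq nat -> {mfun T >-> nat}).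

(* [xis u] is the number of children of [u] if [u] is a node. The value is the
   empty set on the event that the tree is infinite. *)
Definition gw_tree (w : T) : {fset seq nat} :=
  fset_set (tree_nodes (fun u => xis u w)).

Definition gw_size (w : T) : nat := #|` gw_tree w|%fset.

Lemma measurable_tree_nodes u :
  measurable [set w | tree_nodes (fun v => xis v w) u].
Proof.
rewrite [X in measurable X](_ : _ = \bigcap_i
  [set w | (i < size u)%N -> (nth 0%N u i < xis (take i u) w)%N]); last first.
  by apply/seteqP; split => w /= h i; [move=> _; exact: h|exact: h].
apply: bigcapT_measurable => i.
have [iu|iu] := boolP (i < size u)%N; last first.
  rewrite [X in measurable X](_ : _ = setT); first exact: measurableT.
  by apply/seteqP; split.
rewrite [X in measurable X](_ : _ =
   xis (take i u) @^-1` [set k | (nth 0%N u i < k)%N]); last first.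
  by apply/seteqP; split => w /= h //; apply: h.
by rewrite -[X in measurable X]setTI; apply: measurable_funPT.
Qed.

Lemma measurable_gw_tree (A : set {fset seq nat}) : measurable (gw_tree @^-1` A).
Proof.
pose N w := tree_nodes (fun v => xis v w).
pose E (t : {fset seq nat}) := [set w | N w = [set` t]].
have mE t : measurable (E t).
  rewrite (_ : E t = ~` \bigcup_u [set w | ~ (N w u <-> u \in t)]); last first.
    apply/seteqP; split => w /= Nwt.
      by move=> [u _] /=; rewrite Nwt; apply.
    by apply/seteqP; split => u /= h; apply: contrapT => nh; apply: Nwt;
      exists u => //= -[h1 h2]; apply: nh; auto.
  apply: measurableC; apply: countable_bigcupT_measurable; [exact: countableP|] => u.
  have [ut|ut] := boolP (u \in t).
    rewrite (_ : mkset _ = ~` [set w | N w u]).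
      by apply: measurableC; exact: measurable_tree_nodes.
    apply/seteqP; split => w /=; first by move=> h Nu; apply: h.
    by move=> nN [_ /(_ isT)].
  rewrite (_ : mkset _ = [set w | N w u]); first exact: measurable_tree_nodes.
  apply/seteqP; split => w /=; last by move=> Nu [/(_ Nu)].
  by move=> h; apply: contrapT => nN; apply: h; split.
have mU (B : set {fset seq nat}) : measurable (\bigcup_(t in B) E t).
  rewrite bigcup_mkcond; apply: countable_bigcupT_measurable; [exact: countableP|] => t.
  by case: ifP => // _; exact: measurable0.
rewrite (_ : gw_tree @^-1` A = (\bigcup_(t in A) E t) `|`
    (if fset0 \in A then ~` \bigcup_t E t else set0)).
  apply: measurableU => //.
  by case: ifP => // _; apply: measurableC.
apply/seteqP; split => w /=; rewrite /gw_tree -/(N w).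
  have [fN|nfN] := pselect (finite_set (N w)); move=> AN.
    by left; exists (fset_set (N w)) => //; rewrite /E /= fset_setK.
  right; move: AN; rewrite /fset_set; case: pselect => // _.
  move=> A0; rewrite mem_set // => -[t _ Nt].
  by apply: nfN; rewrite Nt; exact: finite_fset.
move=> [[t At ->]|]; first by rewrite set_fsetK.
case: ifPn => // /set_mem A0 nN.
rewrite /fset_set; case: pselect => // fN; exfalso; apply: nN.
by exists (fset_set (N w)) => //; rewrite /E /= fset_setK.
Qed.

Lemma measurable_gw_size n : measurable (gw_size @^-1` [set n]).
Proof. exact: (measurable_gw_tree [set t | #|` t|%fset = n]). Qed.

Context (R : realType) (P : probability T R).

(* P( . | |T| = n) if P(|T| = n) > 0, and the junk value [P] otherwise *)
Definition gw_cond (n : nat) : probability T R :=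
  mnormalize (mrestr P (measurable_gw_size n)) P.

Definition gw_infty : set_system nat :=
  within [set n | (0 < P (gw_size @^-1` [set n]))%E] \oo.

Definition gw_mu (a : R[i]) : R[i] :=
  cexpectation P (fun w => npowc (gw_size w) a).

(* It is the law [gw_cond n], not [gw_X], that depends on [n]. *)
Definition gw_X (a : R[i]) (w : T) : R[i] := tree_sum a (gw_tree w).

Definition iid_copies d0 (T0 : measurableType d0) (P0 : probability T0 R)
    (xi : {mfun T0 >-> nat}) : Prop :=
  mutually_independent P xis /\
  forall u A, distribution P (xis u) A = distribution P0 xi A.

Definition is_Xhat d' (T' : measurableType d') (Q : probability T' R)
    (Xhat : T' -> hol (Hminus R)) : Prop :=
  (forall z : Hminus R, centered_complex_normal Q (fun w => hol_eval (Xhat w) z))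
  /\ cvg_in_hol gw_infty gw_cond
       (fun n a w => (gw_X a w - cexpectation (gw_cond n) (gw_X a))
                     / (Num.sqrt n%:R)%:C%C) Q Xhat.

End galton_watson.

(* Main.v *)
From HB Require Import structures.
From mathcomp Require Import all_boot all_order all_algebra.
From mathcomp Require Import complex finmap cyclic separable cyclotomic.
From mathcomp Require Import zify ring lra.
From mathcomp Require Import all_classical all_reals all_analysis measurable_realfun.
Require Import Defs.

(** The definition of [Xhat] says that [n^(-1/2) (X_n(a) - E X_n(a))] converges to
    it in distribution, as a random holomorphic function. So the theorem is about
    the deterministic centring: it amounts to
      [E X_n(a) = n mu(a) + o(sqrt n)], uniformly for [Re a <= a0 < 0],
    followed by a Slutsky argument in the space of holomorphic functions.

    Let [p] be the offspring law, [q k] the probability that the tree has [k]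
    nodes, and [A m] the probability that [m] independent offspring numbers add up
    to [m]. Following the depth-first exploration of the tree, the mean number of
    nodes with [k] descendants on the event [|T| = n] is [q k * A (n - k)]
    ([pr_marked]), so that
      [E X_n(a) = (sum over k <= n of k^a * q k * A (n - k)) / q n].
    The first passage decomposition of the walk is the case [a = 0] of the same
    sum, [n * q n = sum over k <= n of q k * A (n - k)]. As [A] varies slowly,
    [A (n - k)] may be replaced by [n * q n], and what remains is
    [n * sum of k^a * q k], that is [n * mu(a)] up to a tail. The total error is
    [o(sqrt n)] for [Re a < 0] because the weight [k^a] tends to [0], while [q n]
    is of order [n^(-3/2)] and the tail of [q] of order [n^(-1/2)]
    ([conditioned_mean]).

    That [A] varies slowly is a local limit theorem ([local_limit_estimates]):
    upper and lower bounds of order [n^(-1/2)], increments [O(n^(-3/2))] along the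
    span of the law, and [n * q n - A (n - 1) = o(1 / n)]. The last estimate needs
    one more order than a Taylor expansion with two moments offers; it is gained
    by using that the characteristic function of the centred walk is real to
    second order ([phi_fun_conj], [return_step]). Characteristic functions are
    those of truncated laws, and integrals over the circle are averages over roots
    of unity.

    The correction [(E X_n(a) - n mu(a)) / sqrt n] is holomorphic on the half plane
    since [mu] is ([derivable_moment]), and tends to [0] uniformly on compact sets.
    Adding it does not change the limit in distribution ([slutsky]), which gives
    the convergence in the space of holomorphic functions; evaluation at a point
    is continuous, which gives the convergence for each exponent. *)

Set Implicit Arguments.
Unset Strict Implicit.
Unset Printing Implicit Defensive.

Import Order.TTheory GRing.Theory Num.Theory numFieldNormedType.Exports.

Local Open Scope classical_set_scope.

(** * Depth-first exploration of a tree *)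

Section exploration.
Variable c : seq nat -> nat.
Implicit Types (u v : seq nat) (L s : seq (seq nat)).

Definition children v : seq (seq nat) := [seq rcons v i | i <- iota 0 (c v)].

(** The nodes waiting to be visited form a stack [L], and the stack has to be
    empty after exactly [n] visits. Unlike the node set itself, this reads only
    finitely many offspring numbers, one at a time. *)
Fixpoint explores n L : bool :=
  match n, L with
  | 0, [::] => true
  | n'.+1, v :: L' => explores n' (children v ++ L')
  | _, _ => false
  end.

Fixpoint dfs n L : seq (seq nat) :=
  match n, L with
  | n'.+1, v :: L' => v :: dfs n' (children v ++ L')
  | _, _ => [::]
  end.

Definition descendant v u : Prop :=
  prefix v u /\ forall i, (size v <= i < size u)%N -> (nth 0 u i < c (take i u))%N.

Definition incomparable u v := ~~ prefix u v && ~~ prefix v u.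
Definition antichain L := pairwise incomparable L.

Lemma children_prefix v x : x \in children v -> exists2 i, x = rcons v i & (i < c v)%N.
Proof. by move=> /mapP[j]; rewrite mem_iota add0n => jc ->; exists j. Qed.

Lemma prefix_rconsr v i u : prefix (rcons v i) u -> prefix v u.
Proof. by apply: prefix_trans; rewrite -cats1 prefix_prefix. Qed.

Lemma prefix_comparable u v x : prefix u x -> prefix v x -> prefix u v || prefix v u.
Proof.
move=> /prefixP[a ->] /prefixP[b E].
have [uv|vu] := leqP (size u) (size v).
  apply/orP; left; apply/prefixP; exists (drop (size u) v).
  have := congr1 (take (size v)) E; rewrite [RHS]take_size_cat // take_cat ltnNge uv /= => <-.
  by rewrite drop_size_cat.
apply/orP; right; apply/prefixP; exists (drop (size v) u).
have := congr1 (take (size v)) E; rewrite [RHS]take_size_cat // take_cat vu => H.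
by rewrite -{1}(cat_take_drop (size v) u) H.
Qed.

Lemma rcons_incomparable v i j : i != j -> incomparable (rcons v i) (rcons v j).
Proof.
move=> ij; apply/andP; split; apply/negP => /prefixP[x E].
  have := congr1 (take (size v).+1) E.
  rewrite -(size_rcons v j) take_size size_rcons -(size_rcons v i) take_size_cat //.
  by move=> /rcons_inj[H]; rewrite H eqxx in ij.
have := congr1 (take (size v).+1) E.
rewrite -(size_rcons v i) take_size size_rcons -(size_rcons v j) take_size_cat //.
by move=> /rcons_inj[H]; rewrite H eqxx in ij.
Qed.

Lemma antichain_children v L : antichain (v :: L) -> antichain (children v ++ L).
Proof.
rewrite /antichain /= pairwise_cat => /andP[/allP vL ->]; rewrite andbT.
apply/andP; split.
  apply/allrelP => x y /children_prefix[i -> _] yL.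
  have /andP[nvy nyv] := vL y yL; apply/andP; split.
    by apply: contra nvy; exact: prefix_rconsr.
  apply/negP => yv; move: (prefix_comparable (prefix_rconsr (prefix_refl (rcons v i))) yv).
  by rewrite (negbTE nvy) (negbTE nyv).
rewrite /children pairwise_map; have := iota_uniq 0 (c v).
by rewrite uniq_pairwise; apply: sub_pairwise => i j ij; exact: rcons_incomparable.
Qed.

Lemma descendant_refl v : descendant v v.
Proof. by split; [exact: prefix_refl|move=> i; rewrite leqNgt andNb]. Qed.

Lemma descendant_unfold v u :
  descendant v u <-> u = v \/ exists2 x, x \in children v & descendant x u.
Proof.
split=> [[/prefixP[x E] H]|[->|[x /children_prefix[i -> ic] [pv H]]]]; last 2 first.
- exact: descendant_refl.
- split; first exact: prefix_rconsr pv.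
  move=> j /andP[vj ju]; case: (ltngtP (size v) j) vj => // [vj _|<- _].
    by apply: H; rewrite size_rcons vj.
  move/prefixP: pv => [y ->]; rewrite cat_rcons nth_cat ltnn subnn /=.
  by rewrite take_size_cat.
case: x E => [|i x] E; first by left; rewrite E cats0.
right; exists (rcons v i).
  apply/mapP; exists i => //; rewrite mem_iota add0n.
  have := H (size v); rewrite E size_cat /= leqnn -addSnnS ltn_addr // => /(_ isT).
  by rewrite nth_cat ltnn subnn take_size_cat.
split; first by rewrite E -cat_rcons prefix_prefix.
by move=> j /andP[vj ju]; apply: H; rewrite ju andbT; rewrite size_rcons in vj; exact: ltnW.
Qed.

Definition forest_nodes L u : Prop := exists2 v, v \in L & descendant v u.

Lemma forest_nodes_unfold v L u :
  forest_nodes (v :: L) u <-> u = v \/ forest_nodes (children v ++ L) u.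
Proof.
split.
  move=> [x]; rewrite inE => /orP[/eqP ->|xL] xu.
    have [->|[y yv yu]] := (descendant_unfold v u).1 xu; first by left.
    by right; exists y => //; rewrite mem_cat yv.
  by right; exists x => //; rewrite mem_cat xL orbT.
move=> [->|[x]]; first by exists v; rewrite ?mem_head //; exact: descendant_refl.
rewrite mem_cat => /orP[xv|xL] xu.
  by exists v; rewrite ?mem_head //; apply/descendant_unfold; right; exists x.
by exists x => //; rewrite inE xL orbT.
Qed.

Lemma antichain_head v L : antichain (v :: L) -> ~ forest_nodes (children v ++ L) v.
Proof.
move=> /= /andP[/allP vL _] [x]; rewrite mem_cat => /orP[xc|xL] [pv _].
  move: xc => /children_prefix[i E _]; move: pv; rewrite E => /size_prefix.
  by rewrite size_rcons ltnn.
by have /andP[_] := vL x xL; rewrite pv.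
Qed.

(** Subtrees rooted at an antichain are disjoint, so no node is visited twice. *)
Lemma exploresP n L : antichain L -> explores n L ->
  [/\ uniq (dfs n L), size (dfs n L) = n &
      forall u, u \in dfs n L <-> forest_nodes L u].
Proof.
elim: n L => [|n IH] [|v L] //= aL eL.
  by split => // u; split => // -[].
have [un sn mn] := IH _ (antichain_children aL) eL.
split; last 2 first.
- by rewrite sn.
- move=> u; rewrite inE; split.
    move=> /orP[/eqP ->|/mn]; first by apply/forest_nodes_unfold; left.
    by move=> H; apply/forest_nodes_unfold; right.
  by move=> /forest_nodes_unfold[->|/mn ->]; rewrite ?eqxx ?orbT.
rewrite /= un andbT; apply/negP => /mn; exact: antichain_head aL.
Qed.

(** Removing the head of the stack from the enumeration [s] enumerates the rest
    of the forest, because the head occurs nowhere else in it. *)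
Lemma explores_complete n L s : antichain L -> uniq s -> size s = n ->
  (forall u, u \in s <-> forest_nodes L u) -> explores n L.
Proof.
elim: n L s => [|n IH] [|v L] s aL us ss sP //.
- have : v \in s by apply/sP; apply/forest_nodes_unfold; left.
  by move/size0nil: ss => ->.
- case: s us ss sP => // x s _ _ sP; have : x \in x :: s by rewrite mem_head.
  by move=> /sP[].
have vs : v \in s by apply/sP; apply/forest_nodes_unfold; left.
apply: (IH _ (rem v s)); first exact: antichain_children.
- exact: rem_uniq.
- by rewrite size_rem // ss.
move=> u; rewrite mem_rem_uniq // !inE; split.
  by move=> /andP[uv /sP /forest_nodes_unfold[E|//]]; rewrite E eqxx in uv.
move=> H; apply/andP; split.
  by apply/eqP => uv; rewrite uv in H; exact: antichain_head aL H.
by apply/sP/forest_nodes_unfold; right.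
Qed.

Lemma explores_size n L : explores n L -> (size L <= n)%N.
Proof.
elim: n L => [|n IH] [|v L] //= /IH; rewrite size_cat ltnS.
exact: leq_trans (leq_addl _ _).
Qed.

(** Last in, first out: the trees of [L1] are exhausted before [L2] is touched. *)
Lemma explores_cat k L1 m L2 : explores k L1 -> explores (k + m) (L1 ++ L2) = explores m L2.
Proof. by elim: k L1 => [|k IH] [|v L1] //= /IH <-; rewrite catA. Qed.

Lemma explores_catP k L1 n L2 : explores k L1 ->
  explores n (L1 ++ L2) = (k <= n)%N && explores (n - k) L2.
Proof.
move=> eL; have [kn|nk] := leqP k n.
  by rewrite -{1}(subnKC kn) explores_cat.
apply/negbTE/negP; elim: n k L1 eL nk => [|n IH] [|k] [|v L1] //= eL nk.
by rewrite catA; apply: IH eL nk.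
Qed.

Lemma antichain1 v : antichain [:: v].
Proof. by []. Qed.

Lemma tree_nodes_descendant u : tree_nodes c u <-> descendant [::] u.
Proof.
split=> [H|[_ H] i iu]; last by apply: H.
by split; [rewrite prefix0s|move=> i /andP[_]; exact: H].
Qed.

Lemma tree_nodes_forest u : tree_nodes c u <-> forest_nodes [:: [::]] u.
Proof.
rewrite tree_nodes_descendant; split=> [H|[v]]; first by exists [::]; rewrite ?mem_head.
by rewrite inE => /eqP ->.
Qed.

Local Notation tree := (fset_set (tree_nodes c)).

Lemma tree_mem n : explores n [:: [::]] -> forall u, (u \in tree) = (u \in dfs n [:: [::]]).
Proof.
move=> /(exploresP (antichain1 _))[_ _ H].
have E : tree_nodes c = [set` dfs n [:: [::]]].
  by apply/seteqP; split => u /=; rewrite (H u) tree_nodes_forest.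
move=> u; rewrite in_fset_set E ?inE ?mem_setE //; exact: finite_seq.
Qed.

(** The empty set also stands for an infinite tree, whence [0 < n]. *)
Lemma card_tree n : (0 < n)%N -> (#|` tree|%fset == n) = explores n [:: [::]].
Proof.
move=> n0; apply/eqP/idP => [tn|en].
  have ft : finite_set (tree_nodes c).
    apply: contrapT => nf; move: tn n0; rewrite /fset_set; case: pselect => // _.
    by rewrite cardfs0 => <-.
  apply: (@explores_complete n _ (tree : seq _)) => //; first exact: fset_uniq.
  move=> u; rewrite -tree_nodes_forest in_fset_set //; split => [/set_mem//|].
  exact: mem_set.
have [ud sd _] := exploresP (antichain1 _) en.
rewrite -[RHS]sd -(undup_id ud) -card_fseq; congr (#|` _|%fset).
by apply/fsetP => u; rewrite (tree_mem en) in_fset.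
Qed.

Lemma card_subtree n v k : explores n [:: [::]] -> v \in dfs n [:: [::]] ->
  (#|` subtree tree v|%fset == k) = explores k [:: v].
Proof.
move=> en vn; have tm := tree_mem en.
have [ud sd dP] := exploresP (antichain1 _) en.
have sP u : (u \in subtree tree v) <-> forest_nodes [:: v] u.
  rewrite !inE /= tm; have vd := (tree_nodes_forest v).2 ((dP v).1 vn).
  split=> [/andP[/dP /tree_nodes_forest ut vu]|[x]].
    exists v; rewrite ?mem_head //; split => // i /andP[_]; exact: ut.
  rewrite inE => /eqP -> [vu H]; rewrite vu andbT; apply/dP/tree_nodes_forest => i iu.
  have [vi|iv] := leqP (size v) i; first by apply: H; rewrite vi.
  move/prefixP: vu => [y E]; rewrite E nth_cat iv takel_cat ?(ltnW iv) //.
  exact: vd.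
apply/eqP/idP => [tk|ek].
  by apply: (@explores_complete k _ (subtree tree v : seq _)) => //; exact: fset_uniq.
have [us ss ssP] := exploresP (antichain1 _) ek.
rewrite -[RHS]ss -(undup_id us) -card_fseq; congr (#|` _|%fset).
by apply/fsetP => u; rewrite [RHS]in_fset; apply/idP/idP => [/sP/ssP|/ssP/sP].
Qed.

Lemma card_subtree_gt0 n v : explores n [:: [::]] -> v \in dfs n [:: [::]] ->
  (0 < #|` subtree tree v|%fset <= n)%N.
Proof.
move=> en vn; apply/andP; split.
  rewrite cardfs_gt0; apply/fset0Pn; exists v.
  by rewrite !inE /= (tree_mem en) vn prefix_refl.
have n0 : (0 < n)%N by case: (n) en.
have /eqP <- : #|` tree|%fset == n by rewrite card_tree.
by apply/fsubset_leq_card/fsubsetP => u; rewrite !inE => /andP[].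
Qed.

(** A subtree of a tree with [n] nodes has at most [n] of them, so the functional
    is a combination of finitely many events about the exploration. *)
Lemma sum_tree (M : nmodType) n (F : nat -> M) : explores n [:: [::]] ->
  (\sum_(v <- tree) F #|` subtree tree v|%fset = 
   \sum_(i < n) \sum_(k < n.+1) 
     if explores k [:: nth [::] (dfs n [:: [::]]) i] then F k else 0)%R.
Proof.
move=> en; have [ud sd dP] := exploresP (antichain1 _) en.
have -> : (\sum_(v <- tree) F #|` subtree tree v|%fset =
    \sum_(v <- dfs n [:: [::]]) F #|` subtree tree v|%fset)%R.
  apply: perm_big; apply: uniq_perm; [exact: fset_uniq|by []|exact: tree_mem].
rewrite (big_nth [::]) sd big_mkord; apply: eq_bigr => i _.
have vn : nth [::] (dfs n [:: [::]]) i \in dfs n [:: [::]] by rewrite mem_nth // sd.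
set v := nth _ _ _ in vn *.
have /andP[_ kn] := card_subtree_gt0 en vn; rewrite -ltnS in kn.
have cs k := card_subtree k en vn; rewrite -/v in cs.
rewrite (bigD1 (Ordinal kn)) //= -cs eqxx big1 ?GRing.addr0 // => k nk.
by rewrite -cs ifN // eq_sym.
Qed.

End exploration.

Local Open Scope ring_scope.

(** * Convolution powers, forests and marked nodes *)

Section convolution_powers.
Variables (R : realFieldType) (p : nat -> R).

(** For a probability law [p], the law of the sum of [n] independent copies. *)
Fixpoint conv_pow (n j : nat) : R :=
  if n is n'.+1 then \sum_(i < j.+1) p i * conv_pow n' (j - i)%N else (j == 0%N)%:R.

(** The truncation keeps the generating function polynomial, and does not affect
    the coefficients of index at most [N] of its powers. *)
Definition trunc_gf N : {poly R} := \poly_(i < N.+1) p i.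

Arguments conv_pow : simpl never.

Lemma conv_powS n j :
  conv_pow n.+1 j = \sum_(i < j.+1) p i * conv_pow n (j - i)%N.
Proof. by []. Qed.

Lemma coef_trunc_gf_exp N n j : (j <= N)%N -> (trunc_gf N ^+ n)`_j = conv_pow n j.
Proof.
elim: n j => [|n IH] j jN /=; first by rewrite expr0 coef1.
rewrite exprS coefM; apply: eq_bigr => i _.
have ij : (i <= j)%N by rewrite -ltnS.
rewrite IH; last exact: leq_trans (leq_subr _ _) jN.
by rewrite coef_poly ltnS (leq_trans ij).
Qed.

Lemma conv_pow_ge0 n j : (forall i, 0 <= p i) -> 0 <= conv_pow n j.
Proof.
move=> p0; elim: n j => [|n IH] j /=; first exact: ler0n.
by apply: sumr_ge0 => i _; rewrite mulr_ge0.
Qed.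

(** Given that [n.+1] exchangeable summands add up to [j], each of them has mean
    [j / n.+1]. The proof differentiates a power of the generating function. *)
Lemma sum_size_biased n j :
  n.+1%:R * \sum_(i < j.+1) i%:R * (p i * conv_pow n (j - i)%N) =
  j%:R * conv_pow n.+1 j.
Proof.
case: j => [|j]; first by rewrite big_ord1 !mul0r mulr0.
have := congr1 (fun q : {poly R} => q`_j) (deriv_exp (trunc_gf j.+1) n.+1).
rewrite coef_deriv coef_trunc_gf_exp // coefMn coefM => E.
rewrite [RHS]mulr_natl E.
rewrite -[RHS]mulr_natl big_ord_recl mul0r add0r.
congr (_ * _); apply: eq_bigr => i _.
rewrite coef_trunc_gf_exp; last by lia.
by rewrite coef_deriv coef_poly ltnS ltn_ord lift0 subSS -[p _ *+ _]mulr_natl mulrA.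
Qed.

(** The probability that a Galton-Watson forest with [r] roots has [n] nodes,
    computed along the exploration: the first root is replaced by its children. *)
Fixpoint forest_wt (n r : nat) : R :=
  if n is n'.+1 then
    if r is r'.+1 then \sum_(j < n) p j * forest_wt n' (r' + j)%N else 0
  else (r == 0%N)%:R.

Lemma forest_wt_ge0 n r : (forall i, 0 <= p i) -> 0 <= forest_wt n r.
Proof.
move=> p0; elim: n r => [|n IH] r; first exact: ler0n.
case: r => //= r; by apply: sumr_ge0 => i _; rewrite mulr_ge0.
Qed.

Lemma forest_wt_gt n r : (n < r)%N -> forest_wt n r = 0.
Proof.
elim: n r => [|n IH] [|r] //= nr; apply: big1 => j _.
by rewrite IH ?mulr0 // (leq_trans _ (leq_addr _ _)).
Qed.

Lemma sum_ord_cut n m (F : nat -> R) : (m <= n)%N ->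
  (forall i, (m <= i < n)%N -> F i = 0) ->
  \sum_(i < n) F i = \sum_(i < m) F i.
Proof.
move=> mn F0; rewrite -!(big_mkord xpredT F) (big_cat_nat _ mn) //=.
by rewrite [X in _ + X]big_nat_cond [X in _ + X]big1 ?addr0 // => i; rewrite andbT => /F0.
Qed.

(** The Otter-Dwass formula. Revealing the offspring number of the first root
    gives a sum over [j] that [sum_size_biased] evaluates. *)
Lemma forest_wtE n r : (r <= n)%N ->
  n%:R * forest_wt n r = r%:R * conv_pow n (n - r)%N.
Proof.
elim: n r => [|n IH] [|r] // rn; first by rewrite /= mulr0 mul0r.
rewrite /= subSS; rewrite ltnS in rn.
case: n => [|n] in IH rn *.
  by move: rn; rewrite leqn0 => /eqP ->; rewrite conv_powS !big_ord1 mul1r.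
set N := (n.+1 - r)%N; have NN : N = (n.+1 - r)%N by [].
have n1 : n.+1%:R != 0 :> R by rewrite pnatr_eq0.
have n2 : n.+2%:R != 0 :> R by rewrite pnatr_eq0.
apply: (mulfI n1); rewrite (@sum_ord_cut _ N.+1 (fun j => p j * forest_wt n.+1 (r + j)%N)%R); first last.
- move=> i /andP[Ni _]; rewrite forest_wt_gt ?mulr0 //.
  by lia.
- by lia.
have -> : \sum_(i < N.+1) p i * forest_wt n.+1 (r + i)%N =
  (r%:R * conv_pow n.+2 N + N%:R * conv_pow n.+2 N / n.+2%:R) / n.+1%:R.
  apply: (mulfI n1); rewrite [RHS]mulrCA divff // mulr1.
  rewrite -sum_size_biased [n.+2%:R * _]mulrC mulfK // mulr_sumr conv_powS mulr_sumr -big_split.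
  apply: eq_bigr => i _; have iN : (i <= N)%N by rewrite -ltnS.
  rewrite mulrCA IH; last by lia.
  have -> : (n.+1 - (r + i) = N - i)%N by lia.
  by rewrite natrD /=; ring.
have NE : N%:R = n.+1%:R - r%:R :> R by rewrite /N natrB.
rewrite NE.
have -> : n.+2%:R = n.+1%:R + 1 :> R by rewrite -natr1.
have n3 : n.+1%:R + 1 != 0 :> R by rewrite natr1 pnatr_eq0.
rewrite -(natr1 r).
by field; rewrite !nat1r natr1 !pnatr_eq0.
Qed.

(** The walk with steps [j - 1] goes from [r] to [0] in [n] steps with
    probability [conv_pow n (n - r)]. Such a path splits at its first visit of
    [0], the time when a forest with [r] roots is exhausted. *)
Lemma first_passage n r : (r <= n)%N ->
  conv_pow n (n - r)%N = \sum_(k < n.+1) forest_wt k r * conv_pow (n - k)%N (n - k)%N.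
Proof.
elim: n r => [|n IH] r rn.
  by move: rn; rewrite leqn0 => /eqP ->; rewrite big_ord1 /= mulr1.
rewrite big_ord_recl; case: r rn => [|r] rn.
  rewrite /= mul1r big1 ?addr0 ?subn0 // => i _; by rewrite mul0r.
rewrite mul0r add0r subSS; rewrite ltnS in rn; set N := (n - r)%N; have NN : N = (n - r)%N by [].
under eq_bigr => i _ do rewrite /= /bump /= add1n subSS.
transitivity (\sum_(k < n.+1) \sum_(j < N.+1)
    p j * (forest_wt k (r + j)%N * conv_pow (n - k)%N (n - k)%N)).
  rewrite exchange_big /=; apply: eq_bigr => j _.
  have jN : (j <= N)%N by rewrite -ltnS.
  rewrite -mulr_sumr -IH; last by lia.
  by congr (_ * conv_pow _ _); lia.
apply: eq_bigr => k _; rewrite big_distrl /=.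
have kn : (k <= n)%N by rewrite -ltnS.
have [kN|Nk] := leqP k N.
  rewrite (@sum_ord_cut N.+1 k.+1 (fun j => p j * (forest_wt k (r + j)%N * _))%R) //.
    by apply: eq_bigr => j _; rewrite mulrA.
  move=> j /andP[kj _]; rewrite forest_wt_gt ?mul0r ?mulr0 //; lia.
rewrite (@sum_ord_cut k.+1 N.+1 (fun j => p j * forest_wt k (r + j)%N * _)%R) //; last 2 first.
- by rewrite ltnS ltnW.
- move=> j /andP[kj _]; rewrite forest_wt_gt ?mul0r ?mulr0 ?mul0r //.
  by lia.
by apply: eq_bigr => j _; rewrite mulrA.
Qed.

(** The mean number of nodes with exactly [k] descendants (the node itself
    included) on the event that the forest has [n] nodes: such a node is either
    the first root or met later in the exploration. *)
Fixpoint marked_wt (k n r : nat) : R :=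
  if n is n'.+1 then
    if r is r'.+1 then
      (if (k <= n)%N then forest_wt k 1%N * forest_wt (n - k)%N r' else 0) +
      \sum_(j < n) p j * marked_wt k n' (r' + j)%N
    else 0
  else 0.

(** Cutting out the marked subtree leaves, by the cycle lemma, a free walk of
    [n - k] steps. The induction rests on [sum_size_biased], like that of
    [forest_wtE]. *)
Lemma marked_wtE k n r : (0 < k)%N ->
  marked_wt k n r.+1 = if (r + k <= n)%N
    then r.+1%:R * (forest_wt k 1%N * conv_pow (n - k)%N (n - k - r)%N) else 0.
Proof.
move=> k0; elim: n r => [|n IH] r; first by rewrite leqNgt addn_gt0 k0 orbT.
have step j : marked_wt k n (r + j)%N = if (r + j + k <= n.+1)%N then
    (r + j)%:R * (forest_wt k 1%N * conv_pow (n - k)%N (n.+1 - k - (r + j))%N) else 0.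
  case E : (r + j)%N => [|s].
    by rewrite mul0r; case: n {IH} => [|n] /=; case: ifP.
  rewrite IH addSn ltnS; case: ifP => // H; congr (_ * (_ * conv_pow _ _)).
  by lia.
rewrite [LHS]/=; under eq_bigr do rewrite step.
have [kn|kn] := leqP k n.+1; last first.
  rewrite add0r big1 => [|j _]; last by rewrite leqNgt ifN ?mulr0 //; lia.
  by rewrite leqNgt ifN //; lia.
have [rkn|rkn] := leqP (r + k) n.+1; last first.
  rewrite (@forest_wt_gt (n.+1 - k)%N); last by lia.
  rewrite mulr0 add0r big1 // => j _; rewrite leqNgt ifN ?mulr0 //; lia.
move: kn; rewrite leq_eqVlt => /orP[/eqP kn|kn].
  have -> : r = 0%N by lia.
  rewrite big_ord_recl !addn0 mul0r kn leqnn subnn mulr0 add0r.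
  rewrite mul1r [forest_wt 0 0]/= big1 ?addr0 // => j _.
  by rewrite lift0 leqNgt ifN ?mulr0 //; lia.
set m := (n - k)%N; have mm : m = (n - k)%N by [].
have mE : (n.+1 - k = m.+1)%N by lia.
rewrite mE; set N := (m.+1 - r)%N; have NN : N = (m.+1 - r)%N by [].
rewrite (@sum_ord_cut n.+1 N.+1 (fun i => p i * (if (r + i + k <= n.+1)%N
     then (r + i)%:R * (forest_wt k 1%N * conv_pow m (m.+1 - (r + i))%N)
     else 0))) //; last 2 first.
- by lia.
- move=> i /andP[iN _]; rewrite leqNgt ifN ?mulr0 //; lia.
have m1 : m.+1%:R != 0 :> R by rewrite pnatr_eq0.
have fE : forest_wt m.+1 r = r%:R * conv_pow m.+1 N / m.+1%:R.
  by rewrite /N -forest_wtE; [rewrite mulrAC mulfV ?mul1r | lia].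
have -> : \sum_(i < N.+1) p i * (if (r + i + k <= n.+1)%N then
    (r + i)%:R * (forest_wt k 1%N * conv_pow m (m.+1 - (r + i))%N) else 0) =
  forest_wt k 1%N * (r%:R * conv_pow m.+1 N + N%:R * conv_pow m.+1 N / m.+1%:R).
  rewrite -sum_size_biased [m.+1%:R * _]mulrC mulfK // conv_powS mulr_sumr -big_split.
  rewrite mulr_sumr; apply: eq_bigr => i _; have iN : (i <= N)%N by rewrite -ltnS.
  rewrite ifT; last by lia.
  have -> : (m.+1 - (r + i) = N - i)%N by lia.
  by rewrite natrD /=; ring.
rewrite fE (_ : N%:R = m.+1%:R - r%:R); last by rewrite /N natrB //; lia.
by rewrite -(natr1 r); field; rewrite nat1r pnatr_eq0.
Qed.

End convolution_powers.

(** * Complex moduli and discrete Fourier averages *)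

Section complex_modulus.
Variable R : rcfType.
Local Notation C := (R[i]).
Implicit Types z u w : C.

(** The norm of [R[i]] takes its values in [R[i]]; this is the same number as an
    element of [R]. *)
Definition cabs (z : C) : R := complex.Re `|z|.

Lemma cabsE z : (cabs z)%:C%C = `|z|.
Proof. by rewrite /cabs RRe_real // normr_real. Qed.

Lemma cabs_ge0 z : 0 <= cabs z.
Proof. by rewrite -ler0c cabsE. Qed.
Hint Resolve cabs_ge0 : core.

Lemma cabsM z w : cabs (z * w) = cabs z * cabs w.
Proof. by apply: (@complexI R); rewrite rmorphM /= !cabsE normrM. Qed.

Lemma cabsX z n : cabs (z ^+ n) = cabs z ^+ n.
Proof. by apply: (@complexI R); rewrite rmorphXn /= !cabsE normrX. Qed.

Lemma cabsD z w : cabs (z + w) <= cabs z + cabs w.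
Proof. by rewrite -lecR rmorphD /= !cabsE ler_normD. Qed.

Lemma cabsN z : cabs (- z) = cabs z.
Proof. by rewrite /cabs normrN. Qed.

Lemma cabsB z w : cabs (z - w) <= cabs z + cabs w.
Proof. by rewrite -(cabsN w) cabsD. Qed.

Lemma cabsC z w : cabs (z - w) = cabs (w - z).
Proof. by rewrite -cabsN opprB. Qed.

Lemma cabs_real (x : R) : cabs x%:C%C = `|x|.
Proof.
by apply: (@complexI R); rewrite cabsE normc_def /= expr0n addr0 sqrtr_sqr.
Qed.

Lemma realcD (x y : R) : (x + y)%:C%C = x%:C%C + y%:C%C :> C.
Proof. exact: rmorphD. Qed.
Lemma realcB (x y : R) : (x - y)%:C%C = x%:C%C - y%:C%C :> C.
Proof. exact: rmorphB. Qed.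
Lemma realcM (x y : R) : (x * y)%:C%C = x%:C%C * y%:C%C :> C.
Proof. exact: rmorphM. Qed.
Lemma realcX (x : R) n : (x ^+ n)%:C%C = x%:C%C ^+ n :> C.
Proof. exact: rmorphXn. Qed.

Lemma realcV (x : R) : (x^-1)%:C%C = (x%:C%C)^-1 :> C.
Proof. exact: fmorphV. Qed.
Lemma realc_nat n : (n%:R : R)%:C%C = n%:R :> C.
Proof. exact: rmorph_nat. Qed.

Lemma cabs0 : cabs 0 = 0. Proof. by rewrite /cabs normr0. Qed.
Lemma cabs1 : cabs 1 = 1. Proof. by rewrite /cabs normr1. Qed.

Lemma cabs_conj z : cabs (z^*)%C = cabs z.
Proof. by rewrite /cabs normcJ. Qed.

Lemma cabs_nat n : cabs n%:R = n%:R.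
Proof. by rewrite -(rmorph_nat (real_complex R)) cabs_real ger0_norm. Qed.

Lemma cabs_sqr z : (cabs z ^+ 2)%:C%C = z * z^*%C.
Proof. by rewrite rmorphXn /= cabsE sqr_normc. Qed.

Lemma cabs_sum I r (P : pred I) (F : I -> C) :
  cabs (\sum_(i <- r | P i) F i) <= \sum_(i <- r | P i) cabs (F i).
Proof.
apply: (big_ind2 (fun z x => cabs z <= x)); first by rewrite cabs0.
- by move=> z x w y zx wy; rewrite (le_trans (cabsD _ _)) ?lerD.
- by [].
Qed.

Lemma cabs_Re z : `|complex.Re z| <= cabs z.
Proof. by rewrite -lecR cabsE normc_ge_Re. Qed.

Lemma cabs_sqrE z : cabs z ^+ 2 = complex.Re z ^+ 2 + complex.Im z ^+ 2.
Proof.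
by have := congr1 (@complex.Re R) (cabs_sqr z); case: z => x y /= ->; rewrite mulrN opprK !expr2.
Qed.

Lemma cabs_Im z : `|complex.Im z| <= cabs z.
Proof. by rewrite -ler_sqr ?nnegrE // real_normK ?num_real // cabs_sqrE lerDr sqr_ge0. Qed.

Lemma cabs_le_Re_Im z : cabs z <= `|complex.Re z| + `|complex.Im z|.
Proof.
have x0 := normr_ge0 (complex.Re z); have y0 := normr_ge0 (complex.Im z).
rewrite -ler_sqr ?nnegrE ?addr_ge0 // cabs_sqrE -(real_normK (num_real (complex.Re z))).
rewrite -(real_normK (num_real (complex.Im z))) sqrrD.
have := mulr_ge0 x0 y0; rewrite mulr2n; lra.
Qed.

Lemma cabsV z : cabs z^-1 = (cabs z)^-1.
Proof. by apply: (@complexI R); rewrite realcV !cabsE normfV. Qed.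

Lemma Re_gt0 z : 0 < z -> 0 < complex.Re z.
Proof. by rewrite ltcE => /andP[]. Qed.

Lemma ltc_cabs z u : 0 < u -> (`|z| < u) = (cabs z < complex.Re u).
Proof.
rewrite ltcE => /andP[/eqP ui _]; rewrite -cabsE ltcE /=.
by move: ui => /= ->; rewrite eqxx.
Qed.

Lemma lec_cabs z u : 0 < u -> (`|z| <= u) = (cabs z <= complex.Re u).
Proof.
rewrite ltcE => /andP[/eqP ui _]; rewrite -cabsE lecE /=.
by move: ui => /= ->; rewrite eqxx.
Qed.

Lemma unit_pow_sub1 z k : cabs z <= 1 -> cabs (z ^+ k - 1) <= k%:R * cabs (z - 1).
Proof.
move=> z1; rewrite subrX1 cabsM mulrC ler_wpM2r //.
apply: (le_trans (cabs_sum _ _ _)); rewrite -[k in k%:R]card_ord -sum1_card.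
rewrite natr_sum ler_sum // => i _; rewrite cabsX exprn_ile1 //.
Qed.

Lemma bin2_S k : ('C(k.+1, 2) = 'C(k, 2) + k)%N.
Proof. by rewrite binS bin1. Qed.

(** Summed against a law, the binomial constant stays below the second moment. *)
Lemma unit_pow_taylor2 z k : cabs z <= 1 ->
  cabs (z ^+ k - 1 - k%:R * (z - 1)) <= 'C(k, 2)%:R * cabs (z - 1) ^+ 2.
Proof.
move=> z1; elim: k => [|k IH]; first by rewrite expr0 subrr mul0r subr0 cabs0 mul0r.
have -> : z ^+ k.+1 - 1 - k.+1%:R * (z - 1) =
  (z ^+ k - 1 - k%:R * (z - 1)) + (z - 1) * (z ^+ k - 1).
  by rewrite exprS -natr1; ring.
apply: (le_trans (cabsD _ _)); rewrite bin2_S natrD [leRHS]mulrDl lerD // cabsM expr2 mulrCA.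
by rewrite ler_wpM2l // unit_pow_sub1.
Qed.

Lemma unit_pow_taylor3 z k : cabs z <= 1 ->
  cabs (z ^+ k - 1 - k%:R * (z - 1) - 'C(k, 2)%:R * (z - 1) ^+ 2) <=
  'C(k, 3)%:R * cabs (z - 1) ^+ 3.
Proof.
move=> z1; elim: k => [|k IH].
  by rewrite !bin0n expr0 subrr !mul0r !subr0 cabs0.
have -> : z ^+ k.+1 - 1 - k.+1%:R * (z - 1) - 'C(k.+1, 2)%:R * (z - 1) ^+ 2 =
  (z ^+ k - 1 - k%:R * (z - 1) - 'C(k, 2)%:R * (z - 1) ^+ 2) +
  (z - 1) * (z ^+ k - 1 - k%:R * (z - 1)).
  by rewrite exprS bin2_S natrD -natr1; ring.
apply: (le_trans (cabsD _ _)); rewrite binS natrD [leRHS]mulrDl lerD // cabsM exprS mulrCA.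
by rewrite ler_wpM2l // unit_pow_taylor2.
Qed.

Lemma unit_conj z : cabs z = 1 -> z * z^*%C = 1.
Proof. by move=> z1; rewrite -cabs_sqr z1 expr1n. Qed.

End complex_modulus.
#[global] Hint Resolve cabs_ge0 : core.

Section root_average.
Variable R : rcfType.
Local Notation C := (R[i]).

Lemma complex_prim_root M : (0 < M)%N -> exists z : C, M.-primitive_root z.
Proof.
move=> M0; pose p : {poly C} := 'X^M - 1.
have [r Dp] := closed_field_poly_normal p.
move: Dp; rewrite (monicP _) ?monicXnsubC // scale1r => Dp.
have rM : all M.-unity_root r by apply/allP=> z; rewrite -root_prod_XsubC -Dp.
have sr : size r = M by apply: succn_inj; rewrite -(size_prod_XsubC r id) -Dp size_XnsubC.
have ur : uniq r by rewrite -separable_prod_XsubC -Dp separable_Xn_sub_1 // pnatr_eq0 -lt0n.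
have sMr : (M <= size r)%N by rewrite sr.
by have /hasP[z _ zP] := has_prim_root M0 rM ur sMr; exists z.
Qed.

Lemma prim_root_cabs M (z : C) : (0 < M)%N -> M.-primitive_root z -> cabs z = 1.
Proof.
move=> M0 zP; apply/eqP; rewrite -(@pexpr_eq1 _ _ M) ?cabs_ge0 //.
by rewrite -cabsX prim_expr_order // cabs1.
Qed.

(** For a primitive [M]-th root of unity [z], a discrete substitute for the
    integral over the unit circle, exact on trigonometric polynomials of degree
    less than [M]. *)
Definition root_avg M (z : C) (F : C -> C) : C :=
  M%:R^-1 * \sum_(l < M) F (z ^+ l).

Definition root_ravg M (z : C) (F : C -> R) : R :=
  M%:R^-1 * \sum_(l < M) F (z ^+ l).

Lemma cabs_root_avg M z F (G : C -> R) : cabs z = 1 ->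
  (forall w, cabs w = 1 -> cabs (F w) <= G w) ->
  cabs (root_avg M z F) <= root_ravg M z G.
Proof.
move=> z1 FG; rewrite /root_avg cabsM /root_ravg -(rmorph_nat (real_complex R)) -fmorphV /=.
rewrite cabs_real ger0_norm ?invr_ge0 // ler_wpM2l ?invr_ge0 //.
apply: (le_trans (cabs_sum _ _ _)); apply: ler_sum => i _; apply: FG.
by rewrite cabsX z1 expr1n.
Qed.

Lemma root_ravg_le M z (F G : C -> R) : cabs z = 1 ->
  (forall w, cabs w = 1 -> F w <= G w) -> root_ravg M z F <= root_ravg M z G.
Proof.
move=> z1 FG; rewrite /root_ravg ler_wpM2l ?invr_ge0 //; apply: ler_sum => i _.
by apply: FG; rewrite cabsX z1 expr1n.
Qed.

Lemma root_avgD M z F G :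
  root_avg M z (fun w => F w + G w) = root_avg M z F + root_avg M z G.
Proof. by rewrite /root_avg big_split /= mulrDr. Qed.

Lemma root_avgB M z F G :
  root_avg M z (fun w => F w - G w) = root_avg M z F - root_avg M z G.
Proof. by rewrite /root_avg sumrB mulrBr. Qed.

Lemma root_ravgD M z F G :
  root_ravg M z (fun w => F w + G w) = root_ravg M z F + root_ravg M z G.
Proof. by rewrite /root_ravg big_split /= mulrDr. Qed.

Lemma root_ravgZ M z a F :
  root_ravg M z (fun w => a * F w) = a * root_ravg M z F.
Proof. by rewrite /root_ravg -mulr_sumr mulrCA. Qed.

Lemma root_avgZ M z a F :
  root_avg M z (fun w => a * F w) = a * root_avg M z F.
Proof. by rewrite /root_avg -mulr_sumr mulrCA. Qed.

Lemma eq_root_avg M z F G : cabs z = 1 ->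
  (forall w, cabs w = 1 -> F w = G w) -> root_avg M z F = root_avg M z G.
Proof.
move=> z1 FG; rewrite /root_avg; congr (_ * _); apply: eq_bigr => i _.
by apply: FG; rewrite cabsX z1 expr1n.
Qed.

Lemma root_avg_conj M z F : 
  root_avg M z (fun w => (F w)^*%C) = (root_avg M z F)^*%C.
Proof.
rewrite /root_avg rmorphM rmorph_sum /=; congr (_ * _).
by rewrite conjc_inv conjc_nat.
Qed.

Lemma root_avg_expr M z k j : (0 < M)%N -> M.-primitive_root z ->
  (k < M)%N -> (j < M)%N ->
  root_avg M z (fun w => w ^+ k * (w^*)%C ^+ j) = (k == j)%:R.
Proof.
move=> M0 zP kM jM; have z1 := prim_root_cabs M0 zP.
have MN0 : M%:R != 0 :> C by rewrite pnatr_eq0 -lt0n.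
pose y := z ^+ k * (z^*)%C ^+ j.
have yE : root_avg M z (fun w => w ^+ k * (w^*)%C ^+ j) = M%:R^-1 * \sum_(l < M) y ^+ l.
  rewrite /root_avg; congr (_ * _); apply: eq_bigr => l _.
  by rewrite /y exprMn rmorphXn -!exprM mulnC (mulnC j).
have zz : z * (z^*)%C = 1 by exact: unit_conj.
have yj : y * z ^+ j = z ^+ k.
  by rewrite /y -mulrA -exprMn (mulrC (z^*)%C) zz expr1n mulr1.
have zn0 : z ^+ j != 0 by rewrite expf_neq0 // (prim_root_eq0 zP) -lt0n.
rewrite yE; have [kj|kj] := eqVneq k j.
  have -> : y = 1 by apply: (mulIf zn0); rewrite yj kj mul1r.
  under eq_bigr do rewrite expr1n.
  by rewrite sumr_const card_ord mulVf.
have zM : (z^*)%C ^+ M = 1.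
  by rewrite -[LHS]mul1r -{1}(prim_expr_order zP) -exprMn zz expr1n.
have yM : y ^+ M = 1.
  by rewrite exprMn -!exprM mulnC (mulnC j) !exprM zM (prim_expr_order zP) !expr1n mulr1.
have : (y - 1) * \sum_(l < M) y ^+ l = 0 by rewrite -subrX1 yM subrr.
move/eqP; rewrite mulf_eq0 subr_eq0 => /orP[/eqP y1|/eqP ->]; last by rewrite mulr0.
move: yj; rewrite y1 mul1r => /eqP; rewrite (eq_prim_root_expr zP).
by rewrite !modn_small // eq_sym (negbTE kj).
Qed.

(** Orthogonality of the characters of the cyclic group of order [M]. *)
Lemma root_avg_coef M z (P : {poly R}) j : (0 < M)%N -> M.-primitive_root z ->
  (size P <= M)%N -> (j < M)%N ->
  root_avg M z (fun w => (map_poly (real_complex R) P).[w] * (w^*)%C ^+ j) = (P`_j)%:C%C.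
Proof.
move=> M0 zP sP jM; have z1 := prim_root_cabs M0 zP.
transitivity (root_avg M z (fun w => \sum_(k < M) (P`_k)%:C%C * (w ^+ k * (w^*)%C ^+ j))).
  apply: eq_root_avg => // w _.
  rewrite (horner_coef_wide _ (n := M)); last by rewrite size_map_poly.
  by rewrite mulr_suml; apply: eq_bigr => k _; rewrite coef_map mulrA.
rewrite /root_avg exchange_big /= mulr_sumr.
transitivity (\sum_(k < M) (P`_k)%:C%C * (val k == j)%:R : C).
  apply: eq_bigr => k _; rewrite -(root_avg_expr M0 zP (ltn_ord k) jM) /root_avg.
  by rewrite -mulr_sumr mulrCA.
rewrite (bigD1 (Ordinal jM)) //= eqxx mulr1 big1 ?addr0 // => i /negbTE ij.
by rewrite [_ == j](_ : _ = false) ?mulr0 // -ij -val_eqE.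
Qed.

End root_average.

(** * Critical laws and the loss of modulus of their characteristic functions *)

Definition mass (R : pzRingType) (p : nat -> R) N : R := \sum_(k < N.+1) p k.
Definition mean (R : pzRingType) (p : nat -> R) N : R := \sum_(k < N.+1) k%:R * p k.
Definition mom2 (R : pzRingType) (p : nat -> R) N : R :=
  \sum_(k < N.+1) k%:R ^+ 2 * p k.

(** All sums are truncated, so that the analysis below only handles polynomials;
    the price is an error that vanishes with the truncation. *)
Record critical_law (R : rcfType) (p : nat -> R) (V : R) : Prop := CriticalLaw {
  law_ge0 : forall k, 0 <= p k;
  law_mass : forall N, mass p N <= 1;
  law_mean : forall N, mean p N <= 1;
  law_mom2 : forall N, mom2 p N <= V;
  law_mass_lim : forall e, 0 < e -> exists N0, forall N, (N0 <= N)%N -> 1 - e <= mass p N;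
  law_mean_lim : forall e, 0 < e -> exists N0, forall N, (N0 <= N)%N -> 1 - e <= mean p N;
  law_mom2_tail : forall e, 0 < e -> exists K, forall N,
    \sum_(K <= k < N) k%:R ^+ 2 * p k <= e;
  law_atom0 : 0 < p 0%N;
  law_atom : exists2 a, (0 < a)%N & 0 < p a }.

Section char_fun.
Variables (R : rcfType) (p : nat -> R) (V : R).
Hypothesis pP : critical_law p V.
Local Notation C := (R[i]).
Let p_ge0 := law_ge0 pP.
Hint Resolve p_ge0 : core.

Definition char_fun N (w : C) : C := \sum_(k < N.+1) (p k)%:C%C * w ^+ k.

Lemma char_funE N w :
  char_fun N w = (map_poly (real_complex R) (trunc_gf p N)).[w].
Proof.
rewrite (horner_coef_wide _ (n := N.+1)) ?size_map_poly ?size_poly //.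
by apply: eq_bigr => k _; rewrite coef_map coef_poly ltn_ord.
Qed.

Lemma cabs_char_fun_sub N (w : C) (F : nat -> C) : 
  cabs (\sum_(k < N.+1) (p k)%:C%C * F k) <= \sum_(k < N.+1) p k * cabs (F k).
Proof.
apply: (le_trans (cabs_sum _ _ _)); apply: ler_sum => k _.
by rewrite cabsM cabs_real ger0_norm.
Qed.

Lemma char_fun_le_mass N w : cabs w = 1 -> cabs (char_fun N w) <= mass p N.
Proof.
move=> w1; apply: (le_trans (cabs_char_fun_sub _ w _)); apply: ler_sum => k _.
by rewrite cabsX w1 expr1n mulr1.
Qed.

Lemma char_fun_le1 N w : cabs w = 1 -> cabs (char_fun N w) <= 1.
Proof. by move=> w1; apply: (le_trans (char_fun_le_mass _ w1)); exact: (law_mass pP). Qed.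

Lemma cabs_sub_sqr (z : C) : cabs z = 1 -> (cabs (z - 1) ^+ 2)%:C%C = 2 - z - (z^*)%C.
Proof.
move=> z1; rewrite cabs_sqr rmorphB rmorph1 mulrBl mulrBr unit_conj //; ring.
Qed.

(** The contributions of the atoms [0] and [a] point in different directions
    unless [w ^+ a = 1]; these two alone force a quadratic loss of modulus. *)
Lemma char_fun_atom a N w : (0 < a <= N)%N -> cabs w = 1 ->
  cabs (char_fun N w) <= 1 - p 0%N * p a / 2 * cabs (w ^+ a - 1) ^+ 2.
Proof.
move=> /andP[a0 aN] w1; set y := w ^+ a.
have y1 : cabs y = 1 by rewrite cabsX w1 expr1n.
have aN1 : (a < N.+1)%N by rewrite ltnS.
have a_neq : Ordinal aN1 != ord0 by rewrite -val_eqE /= -lt0n.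
pose S := p 0%N + p a; pose d := p 0%N * p a * cabs (y - 1) ^+ 2.
have split (T : nmodType) (F : nat -> T) : \sum_(k < N.+1) F k =
    F 0%N + (F a + \sum_(k < N.+1 | (k != ord0) && (k != Ordinal aN1)) F k).
  by rewrite (bigD1 ord0) //= (bigD1 (Ordinal aN1)).
have mS : \sum_(k < N.+1 | (k != ord0) && (k != Ordinal aN1)) p k <= 1 - S.
  by rewrite lerBrDl -addrA -split; exact: (law_mass pP N).
have S1 : S <= 1.
  by rewrite -subr_ge0 (le_trans _ mS) // sumr_ge0.
have t2 : cabs ((p 0%N)%:C%C + (p a)%:C%C * y) ^+ 2 = S ^+ 2 - d.
  have yy := unit_conj y1.
  apply: (@complexI R); rewrite cabs_sqr /S /d.
  move: (cabs_sub_sqr y1); move: (cabs (y - 1) ^+ 2) => X EX.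
  have -> : (((p 0%N)%:C%C + (p a)%:C%C * y)^*)%C = (p 0%N)%:C%C + (p a)%:C%C * (y^*)%C.
    by rewrite rmorphD rmorphM; congr (_ + _ * _); exact: conjc_real.
  rewrite realcB realcX realcD 2!realcM EX.
  transitivity ((p 0%N)%:C%C ^+ 2 + (p a)%:C%C ^+ 2 * (y * (y^*)%C) +
    (p 0%N)%:C%C * (p a)%:C%C * (y + (y^*)%C)); first by ring.
  by rewrite yy; ring.
set t := cabs (_ + _) in t2.
have t0 : 0 <= t by exact: cabs_ge0.
have p0 := p_ge0 0; have pa := p_ge0 a.
have cy : cabs (y - 1) <= 2 by rewrite (le_trans (cabsB _ _)) // y1 cabs1; lra.
have cy0 : 0 <= cabs (y - 1) := cabs_ge0 _.
have d0 : 0 <= d by rewrite !mulr_ge0 // sqr_ge0.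
have d4 : d <= 4 * (p 0%N * p a).
  rewrite /d mulrC ler_wpM2r ?mulr_ge0 //; nra.
have tle : t <= S - d / 2.
  have Sd : 0 <= S - d / 2 by rewrite /S in S1 *; nra.
  rewrite -(ler_pXn2r (n := 2)) ?nnegrE // t2; nra.
rewrite /char_fun (split C (fun k => (p k)%:C%C * w ^+ k)) expr0 mulr1 addrA.
apply: (le_trans (cabsD _ _)).
have : cabs (\sum_(k < N.+1 | (k != ord0) && (k != Ordinal aN1)) (p k)%:C%C * w ^+ k)
    <= 1 - S.
  apply: (le_trans (cabs_sum _ _ _)); apply: le_trans mS; apply: ler_sum => k _.
  by rewrite cabsM cabs_real ger0_norm // cabsX w1 expr1n mulr1.
rewrite -/y -/t => mle.
have -> : p 0%N * p a / 2 * cabs (y - 1) ^+ 2 = d / 2 by rewrite /d; field.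
lra.
Qed.

(** The controlled integers contain the positive atoms and are stable under
    subtraction, so the Euclidean algorithm leads to the span of the law. *)
Definition controlled (h : nat) : Prop := exists K N0, 0 <= K /\
  forall N, (N0 <= N)%N -> forall w : C, cabs w = 1 ->
    cabs (w ^+ h - 1) ^+ 2 <= K * (1 - cabs (char_fun N w)).

Lemma controlled_atom a : (0 < a)%N -> 0 < p a -> controlled a.
Proof.
move=> a0 pa; have p0 := law_atom0 pP.
exists (2 / (p 0%N * p a)), a; split; first by rewrite divr_ge0 // mulr_ge0 // ltW.
move=> N aN w w1; have := @char_fun_atom a N w; rewrite a0 aN => /(_ isT w1).
rewrite -ler_pdivrMl ?divr_gt0 ?mulr_gt0 // invf_div; lra.
Qed.

Lemma controlled_sub x y : (y <= x)%N -> controlled x -> controlled y ->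
  controlled (x - y).
Proof.
move=> yx [K1 [N1 [K10 H1]]] [K2 [N2 [K20 H2]]].
exists (2 * K1 + 2 * K2), (maxn N1 N2); split; first by lra.
move=> N; rewrite geq_max => /andP[N1N N2N] w w1.
have h1 := H1 N N1N w w1; have h2 := H2 N N2N w w1.
have E : cabs (w ^+ (x - y) - 1) = cabs (w ^+ x - w ^+ y).
  have -> : w ^+ x - w ^+ y = w ^+ y * (w ^+ (x - y) - 1).
    by rewrite mulrBr mulr1 -exprD subnKC.
  by rewrite cabsM cabsX w1 expr1n mul1r.
have T : cabs (w ^+ x - w ^+ y) <= cabs (w ^+ x - 1) + cabs (w ^+ y - 1).
  have -> : w ^+ x - w ^+ y = (w ^+ x - 1) - (w ^+ y - 1) by ring.
  exact: cabsB.
rewrite E; have A := cabs_ge0 (w ^+ x - w ^+ y).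
have B := cabs_ge0 (w ^+ x - 1); have D := cabs_ge0 (w ^+ y - 1).
have T2 : cabs (w ^+ x - w ^+ y) ^+ 2 <= (cabs (w ^+ x - 1) + cabs (w ^+ y - 1)) ^+ 2.
  by rewrite ler_pXn2r ?nnegrE // addr_ge0.
have := sqr_ge0 (cabs (w ^+ x - 1) - cabs (w ^+ y - 1)); lra.
Qed.

Lemma controlled_mod x y : (0 < y)%N -> controlled x -> controlled y -> 
  controlled (x %% y).
Proof.
move=> y0 + cy; elim/ltn_ind: x => x IH cx.
have [xy|yx] := ltnP x y; first by rewrite modn_small.
have -> : (x %% y = (x - y) %% y)%N by rewrite -{1}(subnK yx) modnDr.
by apply: IH; [lia|exact: controlled_sub].
Qed.

(** The least positive controlled integer divides every atom, because remainders
    are controlled. With [c <= 8^-1] the right-hand side is nonnegative, since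
    [cabs (w ^+ h - 1) <= 2]. *)
Lemma exists_span : exists h : nat, [/\ (0 < h)%N, forall a, 0 < p a -> (h %| a)%N &
  exists c N0, 0 < c /\ c <= 8^-1 /\ forall N, (N0 <= N)%N -> forall w : C, cabs w = 1 ->
    cabs (char_fun N w) <= 1 - c * cabs (w ^+ h - 1) ^+ 2].
Proof.
pose H h := `[< (0 < h)%N /\ controlled h >].
have exH : exists h, H h.
  have [a a0 pa] := law_atom pP; exists a; apply/asboolP; split => //.
  exact: controlled_atom.
have [h /asboolP[h0 ch] hmin] := ex_minnP exH.
exists h; split => //.
  move=> [|a] pa; first exact: dvdn0.
  apply/negPn/negP => nha.
  have r0 : (0 < a.+1 %% h)%N by rewrite lt0n.
  have : H (a.+1 %% h)%N.
    by apply/asboolP; split => //; apply: controlled_mod => //; exact: controlled_atom.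
  by move/hmin; rewrite leqNgt ltn_mod h0.
have [K [N0 [K0 HK]]] := ch.
exists (K + 8)^-1, N0; split; first by rewrite invr_gt0; lra.
split; first by rewrite lef_pV2 ?posrE; lra.
move=> N NN w w1; have h1 := HK N NN w w1.
have h2 : cabs (char_fun N w) <= 1 by apply: char_fun_le1.
have : cabs (w ^+ h - 1) ^+ 2 <= (K + 8) * (1 - cabs (char_fun N w)) by nra.
rewrite -ler_pdivrMl; lra.
Qed.

End char_fun.

(** * Taylor expansions of the characteristic function *)

Section char_taylor.
Variables (R : rcfType) (p : nat -> R) (V : R) (h : nat).
Hypotheses (pP : critical_law p V) (h0 : (0 < h)%N).
Hypothesis h_span : forall a, 0 < p a -> (h %| a)%N.
Local Notation C := (R[i]).
Let p_ge0 := law_ge0 pP.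
Hint Resolve p_ge0 : core.
Local Notation psi := (char_fun p).

(** The defect of mass and mean caused by truncating the law. Every estimate
    below holds up to a multiple of it, and it tends to [0]. *)
Definition law_deficit N : R := (1 - mass p N) + (1 - mean p N).
Local Notation delta := law_deficit.

Lemma law_deficit_ge0 N : 0 <= delta N.
Proof. by rewrite /law_deficit addr_ge0 // subr_ge0; [exact: law_mass pP N|exact: law_mean pP N]. Qed.

Lemma mass_ge0 N : 0 <= mass p N.
Proof. by apply: sumr_ge0. Qed.

Lemma mean_ge0 N : 0 <= mean p N.
Proof. by apply: sumr_ge0 => i _; rewrite mulr_ge0. Qed.

Lemma law_deficit_le2 N : delta N <= 2.
Proof. by have := mass_ge0 N; have := mean_ge0 N; rewrite /law_deficit; lra. Qed.

Lemma law_deficit_lim e : 0 < e -> exists N0, forall N, (N0 <= N)%N -> delta N <= e.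
Proof.
move=> e0; have e2 : 0 < e / 2 by lra.
have [N1 H1] := law_mass_lim pP e2; have [N2 H2] := law_mean_lim pP e2.
exists (maxn N1 N2) => N; rewrite geq_max => /andP[/H1 ? /H2 ?].
by rewrite /law_deficit; lra.
Qed.

Lemma law_pk0 k : ~~ (h %| k)%N -> p k = 0.
Proof.
move=> hk; apply/eqP; apply: contraNT hk => pk; apply: h_span.
by rewrite lt_def pk p_ge0.
Qed.

Section at_point.
Variables (N : nat) (w : C).
Hypothesis w1 : cabs w = 1.
Let v := w ^+ h.
Let x := v - 1.
Let v1 : cabs v = 1. Proof. by rewrite cabsX w1 expr1n. Qed.
Let x0 : 0 <= cabs x := cabs_ge0 _.
Let x2 : cabs x <= 2.
Proof. by rewrite (le_trans (cabsB _ _)) // v1 cabs1; lra. Qed.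
Let hC : h%:R != 0 :> C. Proof. by rewrite pnatr_eq0 -lt0n. Qed.
Let h1R : 1 <= h%:R :> R. Proof. by rewrite ler1n. Qed.

(** The atoms being multiples of [h], only [v = w ^+ h] matters. *)
Lemma char_fun_span : psi N w = \sum_(k < N.+1) (p k)%:C%C * v ^+ (k %/ h).
Proof.
apply: eq_bigr => k _; have [hk|hk] := boolP (h %| k)%N; last first.
  by rewrite law_pk0 // !mul0r.
by rewrite -exprM mulnC divnK.
Qed.

Lemma quo_le k : ((k %/ h)%N)%:R <= k%:R :> R.
Proof. by rewrite ler_nat leq_div. Qed.

Lemma mass_realc : \sum_(k < N.+1) (p k)%:C%C = (mass p N)%:C%C :> C.
Proof. by rewrite /mass (big_morph _ (@realcD R) (erefl _)). Qed.

Lemma mean_span : \sum_(k < N.+1) (p k)%:C%C * (k %/ h)%:R = (mean p N)%:C%C / h%:R :> C.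
Proof.
apply: (mulIf hC); rewrite divfK // mulr_suml (big_morph _ (@realcD R) (erefl _)).
apply: eq_bigr => k _; rewrite realcM.
have -> : (k%:R : R)%:C%C = k%:R :> C by rewrite -[RHS](rmorph_nat (real_complex R)).
have [hk|hk] := boolP (h %| k)%N; last by rewrite law_pk0 // !mul0r mulr0.
by rewrite -mulrA -natrM divnK // mulrC.
Qed.

Lemma char_fun_taylor1 : cabs (psi N w - 1) <= cabs x + delta N.
Proof.
have -> : psi N w - 1 = \sum_(k < N.+1) (p k)%:C%C * (v ^+ (k %/ h) - 1) - (1 - mass p N)%:C%C.
  under eq_bigr do rewrite mulrBr mulr1.
  by rewrite sumrB -char_fun_span mass_realc realcB; ring.
apply: (le_trans (cabsB _ _)); rewrite cabs_real ger0_norm; last first.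
  by rewrite subr_ge0; exact: law_mass pP N.
rewrite /law_deficit; have m1 := law_mean pP N.
suff : cabs (\sum_(k < N.+1) (p k)%:C%C * (v ^+ (k %/ h) - 1)) <= mean p N * cabs x.
  by have : mean p N * cabs x <= cabs x by [rewrite ler_piMl]; lra.
apply: (le_trans (cabs_char_fun_sub pP _ w (fun k => v ^+ (k %/ h) - 1))).
rewrite /mean mulr_suml; apply: ler_sum => k _.
rewrite (mulrC k%:R) -mulrA ler_wpM2l //.
by rewrite (le_trans (unit_pow_sub1 _ _)) ?v1 // ler_wpM2r ?quo_le.
Qed.

Lemma bin2_quo k : ('C(k %/ h, 2)%:R : R) <= k%:R ^+ 2.
Proof.
rewrite -natrX ler_nat (@leq_trans ((k %/ h) ^ 2)%N) //.
  rewrite bin2 (@leq_trans (k %/ h * (k %/ h).-1)%N) ?half_leq //; last first.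
    by rewrite expnS expn1 leq_mul2l leq_pred orbT.
  by rewrite -[leqRHS](half_bit_double _ false) add0n half_leq // -addnn leq_addr.
by rewrite leq_exp2r // leq_div.
Qed.

Lemma char_fun_taylor2 :
  cabs (psi N w - 1 - x / h%:R) <= V * cabs x ^+ 2 + 2 * delta N.
Proof.
have -> : psi N w - 1 - x / h%:R =
   \sum_(k < N.+1) (p k)%:C%C * (v ^+ (k %/ h) - 1 - (k %/ h)%:R * (v - 1))
   - ((1 - mass p N)%:C%C + (1 - mean p N)%:C%C * (x / h%:R)).
  under eq_bigr do rewrite mulrBr mulrA mulrBr mulr1.
  rewrite 2!sumrB -mulr_suml -char_fun_span mass_realc mean_span !realcB -/x.
  by rewrite [1%:C%C](_ : _ = 1 :> C) //; ring.
have mm := law_mass pP N; have mm1 := law_mean pP N.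
apply: (le_trans (cabsB _ _)); apply: lerD.
  apply: (le_trans (cabs_char_fun_sub pP _ w (fun k => v ^+ (k %/ h) - 1 - (k %/ h)%:R * (v - 1)))).
  apply: (@le_trans _ _ (mom2 p N * cabs x ^+ 2)); last first.
    by rewrite ler_wpM2r ?sqr_ge0 // (law_mom2 pP).
  rewrite /mom2 mulr_suml; apply: ler_sum => k _.
  rewrite (mulrC (_ ^+ 2)) -mulrA ler_wpM2l //.
  by rewrite (le_trans (unit_pow_taylor2 _ _)) ?v1 // ler_wpM2r ?sqr_ge0 ?bin2_quo.
apply: (le_trans (cabsD _ _)); rewrite cabsM !cabs_real !ger0_norm ?subr_ge0 //.
have : cabs (x / h%:R) <= 2.
  rewrite cabsM -(rmorph_nat (real_complex R)) -fmorphV cabs_real ger0_norm ?invr_ge0 //.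
  by rewrite ler_pdivrMr ?ltr0n // (le_trans x2) // ler_peMr.
have := cabs_ge0 (x / h%:R); rewrite /law_deficit; nra.
Qed.

End at_point.

Definition char_beta N : R := \sum_(k < N.+1) p k * 'C(k %/ h, 2)%:R.

Lemma bin3_quo k : ('C(k %/ h, 3)%:R : R) <= k%:R ^+ 3.
Proof.
rewrite -natrX ler_nat (@leq_trans ((k %/ h) ^ 3)%N) //; last by rewrite leq_exp2r // leq_div.
apply: (@leq_trans ((k %/ h) ^_ 3)); first by rewrite -bin_ffact leq_pmulr // fact_gt0.
rewrite !ffactnS ffactn0 muln1 !expnS expn0 muln1 leq_mul // leq_mul ?leq_pred //.
by rewrite (leq_trans (leq_pred _)) // leq_pred.
Qed.

(** A finite second moment only gives a second order remainder [o(x ^ 2)]: the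
    atoms beyond [K] are controlled by the tail of the second moment, and the
    finitely many others contribute [O(x ^ 3)]. *)
Lemma char_fun_taylor3 e : 0 < e -> exists2 K, 0 <= K & forall N w, cabs w = 1 ->
  cabs (psi N w - 1 - (w ^+ h - 1) / h%:R - (char_beta N)%:C%C * (w ^+ h - 1) ^+ 2)
  <= e * cabs (w ^+ h - 1) ^+ 2 + K * cabs (w ^+ h - 1) ^+ 3 + 2 * delta N.
Proof.
move=> e0; have [K HK] := law_mom2_tail pP e0.
have V0 : 0 <= V.
  apply: le_trans (law_mom2 pP 0); apply: sumr_ge0 => i _.
  by rewrite mulr_ge0 // sqr_ge0.
exists (K%:R * V); first by rewrite mulr_ge0.
move=> N w w1; set v := w ^+ h; set x := v - 1.
have v1 : cabs v = 1 by rewrite cabsX w1 expr1n.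
have x0 : 0 <= cabs x := cabs_ge0 _.
have x2 : cabs x <= 2 by rewrite (le_trans (cabsB _ _)) // v1 cabs1; lra.
have -> : psi N w - 1 - x / h%:R - (char_beta N)%:C%C * x ^+ 2 =
   \sum_(k < N.+1) (p k)%:C%C * (v ^+ (k %/ h) - 1 - (k %/ h)%:R * (v - 1)
      - 'C(k %/ h, 2)%:R * (v - 1) ^+ 2)
   - ((1 - mass p N)%:C%C + (1 - mean p N)%:C%C * (x / h%:R)).
  under eq_bigr do rewrite mulrBr mulrA mulrBr mulrA mulrBr mulr1.
  rewrite 3!sumrB -2!mulr_suml -char_fun_span // mass_realc mean_span // !realcB -/x.
  have -> : \sum_(k < N.+1) (p k)%:C%C * 'C(k %/ h, 2)%:R = (char_beta N)%:C%C :> C.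
    rewrite /char_beta (big_morph _ (@realcD R) (erefl _)); apply: eq_bigr => k _.
    by rewrite realcM -(rmorph_nat (real_complex R)).
  by rewrite [1%:C%C](_ : _ = 1 :> C) //; ring.
have mm := law_mass pP N; have mm1 := law_mean pP N.
apply: (le_trans (cabsB _ _)); apply: lerD; last first.
  apply: (le_trans (cabsD _ _)); rewrite cabsM !cabs_real !ger0_norm ?subr_ge0 //.
  have : cabs (x / h%:R) <= 2.
    rewrite cabsM -(rmorph_nat (real_complex R)) -fmorphV cabs_real ger0_norm ?invr_ge0 //.
    have h1R : 1 <= h%:R :> R by rewrite ler1n.
    by rewrite ler_pdivrMr ?ltr0n // (le_trans x2) // ler_peMr.
  have := cabs_ge0 (x / h%:R); rewrite /law_deficit; nra.
apply: (le_trans (cabs_char_fun_sub pP _ w (fun k => v ^+ (k %/ h) - 1 - (k %/ h)%:R * (v - 1)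
      - 'C(k %/ h, 2)%:R * (v - 1) ^+ 2))).
pose t3 k := k%:R ^+ 2 * p k * cabs x ^+ 2; pose t4 k := k%:R ^+ 2 * p k * (K%:R * cabs x ^+ 3).
(* second order bound for the atoms beyond [K], third order bound for the others *)
apply: (@le_trans _ _ (\sum_(k < N.+1) ((if (K <= k)%N then t3 k else 0) + t4 k))).
  apply: ler_sum => k _.
  have kp : 0 <= k%:R ^+ 2 * p k by rewrite mulr_ge0 ?sqr_ge0.
  have t40 : 0 <= t4 k by rewrite /t4 !mulr_ge0 ?exprn_ge0 ?sqr_ge0.
  case: ifPn => kK.
    apply: (@le_trans _ _ (t3 k)); last by rewrite lerDl.
    rewrite /t3 (mulrC (_ ^+ 2)) -mulrA ler_wpM2l //.
    apply: (le_trans (cabsB _ _)).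
    have T2 := @unit_pow_taylor2 R v (k %/ h).
    rewrite v1 in T2; have {}T2 := T2 (lexx 1).
    rewrite cabsM cabsX cabs_nat -/x in T2 *.
    apply: (@le_trans _ _ (('C(k %/ h, 2)%:R + 'C(k %/ h, 2)%:R) * cabs x ^+ 2)).
      by rewrite mulrDl lerD2r.
    rewrite ler_wpM2r ?sqr_ge0 // -natrD -natrX ler_nat.
    apply: (@leq_trans ((k %/ h) ^ 2)%N); last by rewrite leq_exp2r // leq_div.
    rewrite addnn bin2 -[leqRHS]mulnn; set j := (k %/ h)%N.
    apply: (@leq_trans (j * j.-1)%N); last by rewrite leq_mul2l leq_pred orbT.
    by rewrite -[leqRHS]odd_double_half leq_addl.
  rewrite add0r /t4 (mulrC (_ ^+ 2)) -mulrA ler_wpM2l //.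
  have T3 := @unit_pow_taylor3 R v (k %/ h).
  rewrite v1 in T3; apply: (le_trans (T3 (lexx 1))).
  rewrite mulrA ler_wpM2r ?exprn_ge0 // (le_trans (bin3_quo _)) // exprSr.
  by rewrite ler_wpM2l ?sqr_ge0 // ler_nat ltnW // ltnNge.
rewrite big_split /=; apply: lerD.
  rewrite -big_mkcond /= /t3 -mulr_suml ler_wpM2r ?sqr_ge0 //.
  by apply: le_trans (HK N.+1); rewrite big_geq_mkord.
rewrite /t4 -mulr_suml mulrA ler_wpM2r ?exprn_ge0 // mulrC ler_wpM2l //.
exact: (law_mom2 pP N).
Qed.

Lemma law_V_ge0 : 0 <= V.
Proof.
apply: le_trans (law_mom2 pP 0); apply: sumr_ge0 => i _.
by rewrite mulr_ge0 // sqr_ge0.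
Qed.

(** The characteristic function of [h] steps of the walk centred at their mean
    [h], which lies on the span; on the unit circle the conjugate of [w ^+ h] is
    its inverse. *)
Definition phi_fun N (w : C) : C := psi N w ^+ h * ((w ^+ h)^*)%C.

(** The first order term cancels because the law has mean one. *)
Lemma phi_fun_sub1 : exists2 K, 0 <= K & forall N w, cabs w = 1 ->
  cabs (phi_fun N w - 1) <= K * (cabs (w ^+ h - 1) ^+ 2 + delta N).
Proof.
have V0 := law_V_ge0.
set b := 'C(h, 2)%:R : R; have b0 : 0 <= b by [].
have h1R : 1 <= h%:R :> R by rewrite ler1n.
have hC : h%:R != 0 :> C by rewrite pnatr_eq0 -lt0n.
exists (4 * b + h%:R * (V + 2)); first by rewrite addr_ge0 ?mulr_ge0 ?addr_ge0.
move=> N w w1; set v := w ^+ h; set x := v - 1.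
have v1 : cabs v = 1 by rewrite cabsX w1 expr1n.
have x0 : 0 <= cabs x := cabs_ge0 _.
have d0 := law_deficit_ge0 N; have d2 := law_deficit_le2 N.
have -> : phi_fun N w - 1 = (psi N w ^+ h - v) * (v^*)%C.
  by rewrite /phi_fun -/v mulrBl unit_conj.
rewrite cabsM cabs_conj v1 mulr1.
have -> : psi N w ^+ h - v = (psi N w ^+ h - 1 - h%:R * (psi N w - 1)) +
   h%:R * (psi N w - 1 - x / h%:R).
  by rewrite /x; field.
apply: (le_trans (cabsD _ _)); rewrite cabsM cabs_nat.
have T2 := char_fun_taylor2 N w1; rewrite -/v -/x in T2.
have T1 := char_fun_taylor1 N w1; rewrite -/v -/x in T1.
have U2 := unit_pow_taylor2 h (char_fun_le1 pP N w1); rewrite -/b in U2.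
have P0 := cabs_ge0 (psi N w - 1).
have P2 : cabs (psi N w - 1) ^+ 2 <= 2 * cabs x ^+ 2 + 4 * delta N.
  have : cabs (psi N w - 1) ^+ 2 <= (cabs x + delta N) ^+ 2.
    by have s0 := addr_ge0 x0 d0; apply: lerXn2r; rewrite ?nnegrE.
  have := sqr_ge0 (cabs x - delta N); nra.
have B1 : b * cabs (psi N w - 1) ^+ 2 <= b * (4 * cabs x ^+ 2 + 4 * delta N).
  by rewrite ler_wpM2l //; have := sqr_ge0 (cabs x); lra.
have B2 : h%:R * cabs (psi N w - 1 - x / h%:R) <= h%:R * ((V + 2) * (cabs x ^+ 2 + delta N)).
  rewrite ler_wpM2l //; apply: (le_trans T2).
  have := mulr_ge0 V0 d0; have := sqr_ge0 (cabs x); lra.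
lra.
Qed.

(** With [v = w ^+ h] and [x = v - 1], the second order term is a real multiple
    of [x ^ 2 * v^* = - |x| ^ 2], hence real. The imaginary part is therefore
    [o(x ^ 2)] although no third moment is available. *)
Lemma phi_fun_conj : exists2 K0, 0 <= K0 & forall e, 0 < e -> exists2 K, 0 <= K &
  forall N w, cabs w = 1 ->
  cabs (phi_fun N w - (phi_fun N w)^*%C) <=
    e * cabs (w ^+ h - 1) ^+ 2 + K * cabs (w ^+ h - 1) ^+ 3 + K0 * delta N.
Proof.
have V0 := law_V_ge0.
set b := 'C(h, 2)%:R : R; have b0 : 0 <= b by [].
set b3 := 'C(h, 3)%:R : R; have b30 : 0 <= b3 by [].
have h1R : 1 <= h%:R :> R by rewrite ler1n.
have hC : h%:R != 0 :> C by rewrite pnatr_eq0 -lt0n.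
exists (2 * (2 * h%:R + b * (4 * V + 12) + 28 * b3)).
  by rewrite !(mulr_ge0, addr_ge0).
move=> e e0; have e'0 : 0 < e / (2 * h%:R) by rewrite divr_gt0 //; lra.
have [K K0 HK] := char_fun_taylor3 e'0.
exists (2 * (h%:R * K + 2 * V * b + b3)); first by rewrite !(mulr_ge0, addr_ge0).
move=> N w w1; have {}HK := HK N w w1; move: HK.
set v := w ^+ h; set x := v - 1 => HK.
have v1 : cabs v = 1 by rewrite cabsX w1 expr1n.
have x0 : 0 <= cabs x := cabs_ge0 _.
have x2 : cabs x <= 2 by rewrite (le_trans (cabsB _ _)) // v1 cabs1; lra.
have d0 := law_deficit_ge0 N; have d2 := law_deficit_le2 N.
set y := psi N w - 1.
set R1 := y - x / h%:R - (char_beta N)%:C%C * x ^+ 2.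
pose R2 := y ^+ 2 - x ^+ 2 / h%:R ^+ 2.
pose R3 := psi N w ^+ h - 1 - h%:R * y - 'C(h, 2)%:R * y ^+ 2.
pose R4 := h%:R * R1 + 'C(h, 2)%:R * R2 + R3.
pose g : R := h%:R * char_beta N + b / h%:R ^+ 2.
have gE : g%:C%C = h%:R * (char_beta N)%:C%C + 'C(h, 2)%:R / h%:R ^+ 2 :> C.
  by rewrite realcD !realcM realcV realcX !realc_nat.
have phE : psi N w ^+ h = 1 + x + g%:C%C * x ^+ 2 + R4.
  by rewrite gE /R4 /R3 /R2 /R1; field.
have vv := unit_conj v1.
have xv : x ^+ 2 * (v^*)%C = - (cabs x ^+ 2)%:C%C.
  rewrite (cabs_sub_sqr v1) /x.
  transitivity (v * (v * (v^*)%C) - 2 * (v * (v^*)%C) + (v^*)%C); first by ring.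
  by rewrite vv; ring.
have E : phi_fun N w = (1 - g * cabs x ^+ 2)%:C%C + R4 * (v^*)%C.
  rewrite /phi_fun -/v phE realcB realcM -[X in _ - _ * X]opprK -xv.
  rewrite [1%:C%C](_ : _ = 1 :> C) // -[X in X - _]vv /x; ring.
have -> : phi_fun N w - (phi_fun N w)^*%C = R4 * (v^*)%C - (R4 * (v^*)%C)^*%C.
  rewrite E.
  have -> a (z : C) : (a%:C%C + z)^*%C = a%:C%C + z^*%C.
    by rewrite rmorphD; congr (_ + _); exact: conjc_real.
  by ring.
apply: (le_trans (cabsB _ _)); rewrite cabs_conj cabsM cabs_conj v1 mulr1.
have T1 : cabs y <= cabs x + delta N := char_fun_taylor1 N w1.
have T2 : cabs (y - x / h%:R) <= V * cabs x ^+ 2 + 2 * delta N := char_fun_taylor2 N w1.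
have y0 := cabs_ge0 y.
have xh : cabs (x / h%:R) <= cabs x.
  rewrite cabsM -(rmorph_nat (real_complex R)) -fmorphV cabs_real ger0_norm ?invr_ge0 //.
  by rewrite ler_pdivrMr ?ltr0n // ler_peMr.
have B1 : h%:R * cabs R1 <= h%:R * (e / (2 * h%:R) * cabs x ^+ 2 + K * cabs x ^+ 3 + 2 * delta N).
  by rewrite ler_wpM2l.
have B1E : h%:R * (e / (2 * h%:R) * cabs x ^+ 2) = e / 2 * cabs x ^+ 2.
  by field; rewrite pnatr_eq0 -lt0n.
have B2 : cabs R2 <= 2 * V * cabs x ^+ 3 + (4 * V + 12) * delta N.
  have -> : R2 = (y - x / h%:R) * (y + x / h%:R) by rewrite /R2; field.
  rewrite cabsM; apply: (@le_trans _ _ ((V * cabs x ^+ 2 + 2 * delta N) * (2 * cabs x + delta N))).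
    apply: ler_pM; rewrite ?cabs_ge0 //; apply: (le_trans (cabsD _ _)); lra.
  have xx2 : cabs x ^+ 2 <= 4 by nra.
  have := mulr_ge0 (mulr_ge0 V0 d0) (_ : 0 <= 4 - cabs x ^+ 2); rewrite subr_ge0 => /(_ xx2) A1.
  have A2 : delta N * cabs x <= delta N * 2 by rewrite ler_wpM2l.
  have A3 : delta N * delta N <= delta N * 2 by rewrite ler_wpM2l.
  have -> : cabs x ^+ 3 = cabs x ^+ 2 * cabs x by rewrite exprSr.
  lra.
have B2' : b * cabs R2 <= b * (2 * V * cabs x ^+ 3 + (4 * V + 12) * delta N) by rewrite ler_wpM2l.
have B3 : cabs R3 <= b3 * (cabs x ^+ 3 + 28 * delta N).
  apply: (le_trans (unit_pow_taylor3 h (char_fun_le1 pP N w1))); rewrite -/y ler_wpM2l //.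
  apply: (@le_trans _ _ ((cabs x + delta N) ^+ 3)).
    by have s0 := addr_ge0 x0 d0; apply: lerXn2r; rewrite ?nnegrE.
  have xx2 : cabs x ^+ 2 <= 4 by nra.
  have dd2 : delta N ^+ 2 <= 2 * delta N by nra.
  have dd3 : delta N ^+ 3 <= 4 * delta N by rewrite exprSr; nra.
  have A1 : delta N * cabs x ^+ 2 <= delta N * 4 by rewrite ler_wpM2l.
  have A2 : delta N ^+ 2 * cabs x <= 2 * delta N * 2 by rewrite ler_pM ?sqr_ge0.
  have -> : (cabs x + delta N) ^+ 3 = cabs x ^+ 3 + 3 * (delta N * cabs x ^+ 2) +
     3 * (delta N ^+ 2 * cabs x) + delta N ^+ 3 by ring.
  lra.
have : cabs R4 <= h%:R * cabs R1 + b * cabs R2 + cabs R3.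
  apply: (le_trans (cabsD _ _)); rewrite lerD2r; apply: (le_trans (cabsD _ _)).
  by rewrite !cabsM !cabs_nat.
lra.
Qed.

End char_taylor.

(** * Averages of powers of the decay factor *)

Lemma central_bin_bound l : ('C(l.*2, l) ^ 2 * l.*2.+1 <= 16 ^ l)%N.
Proof.
elim: l => [|l IH]; first by [].
have E : (l.+1 * 'C(l.+1.*2, l.+1) = 2 * (l.*2.+1 * 'C(l.*2, l)))%N.
  have E1 := mul_bin_diag l.+1.*2 l; have E2 := mul_bin_down l.*2.+1 l.
  rewrite doubleS /= in E1 E2 *.
  have l1 : (l.*2.+1 - l = l.+1)%N by lia.
  rewrite l1 in E2.
  have : (l.+1 * (l.+1 * 'C(l.*2.+2, l.+1)) = l.+1 * (2 * (l.*2.+1 * 'C(l.*2, l))))%N.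
    rewrite -E1 E2; lia.
  by move/eqP; rewrite eqn_mul2l /= => /eqP.
rewrite -(leq_pmul2l (_ : 0 < l.+1 ^ 2)%N) ?expn_gt0 //.
have -> : (l.+1 ^ 2 * ('C(l.+1.*2, l.+1) ^ 2 * l.+1.*2.+1) =
  (l.+1 * 'C(l.+1.*2, l.+1)) ^ 2 * l.+1.*2.+1)%N by rewrite expnMn mulnA.
rewrite E; set c := 'C(l.*2, l) in IH *.
have -> : ((2 * (l.*2.+1 * c)) ^ 2 * l.+1.*2.+1 =
  (c ^ 2 * l.*2.+1) * (4 * (l.*2.+1 * l.+1.*2.+1)))%N by nia.
apply: (@leq_trans (16 ^ l * (4 * (l.*2.+1 * l.+1.*2.+1)))%N); first by rewrite leq_mul2r IH orbT.
have -> : (l.+1 ^ 2 * 16 ^ l.+1 = 16 ^ l * (16 * l.+1 ^ 2))%N by rewrite (expnSr 16) mulnCA [(_ * 16)%N]mulnC.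
rewrite leq_mul2l; apply/orP; right; rewrite doubleS; nia.
Qed.

Section kernel_bounds.
Variable R : rcfType.
Local Notation C := (R[i]).

(** The order of magnitude of the local probabilities at time [n]. *)
Definition rate n : R := (Num.sqrt n.+1%:R)^-1.

Lemma rate_gt0 n : 0 < rate n.
Proof. by rewrite invr_gt0 sqrtr_gt0 ltr0n. Qed.

Lemma rate_sqr n : rate n ^+ 2 = n.+1%:R^-1.
Proof. by rewrite exprVn sqr_sqrtr. Qed.

Lemma rate_le m n : (m <= n)%N -> rate n <= rate m.
Proof.
move=> mn; rewrite lef_pV2 ?posrE ?sqrtr_gt0 ?ltr0n // ler_sqrt ?ler0n //.
by rewrite ler_nat.
Qed.

Lemma rate_le1 n : rate n <= 1.
Proof. by apply: (le_trans (rate_le (leq0n n))); rewrite /rate sqrtr1 invr1. Qed.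

Lemma rate_scale m n a : (0 < a)%N -> (n.+1 <= a * m.+1)%N -> rate m <= a%:R * rate n.
Proof.
move=> a0 H; rewrite -(ler_pXn2r (n := 2)) ?nnegrE ?mulr_ge0 ?(ltW (rate_gt0 _)) //.
rewrite exprMn !rate_sqr ler_pdivlMr ?ltr0n // ler_pdivrMl ?ltr0n //.
rewrite -natrX -natrM ler_nat (leq_trans H) // mulnC leq_mul2l /= -{1}(muln1 a) expnS expn1.
by rewrite leq_mul2l a0 orbT.
Qed.

Lemma bernoulli_decay (y : R) m : 0 <= y <= 1 -> y * (1 - y) ^+ m <= m.+1%:R^-1.
Proof.
move=> /andP[y0 y1].
have H : (1 - y) ^+ m * (1 + m%:R * y) <= 1.
  elim: m => [|m IH]; first by rewrite mul0r addr0 mulr1.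
  apply: le_trans IH; rewrite exprSr -mulrA ler_wpM2l ?exprn_ge0 ?subr_ge0 //.
  rewrite -natr1; have := sqr_ge0 y; have : 0 <= m%:R * y ^+ 2 by rewrite mulr_ge0 ?sqr_ge0.
  nra.
rewrite -[leRHS]mul1r ler_pdivlMr ?ltr0n // -mulrA mulrCA.
apply: le_trans H; rewrite ler_wpM2l ?exprn_ge0 ?subr_ge0 //.
by rewrite -natr1; nra.
Qed.

(** Dividing by [l.+1] turns the binomial weights for [n] into weights for
    [n.+1], whose sum is at most one. *)
Lemma binomial_harmonic (a : R) n : 0 < a <= 1 ->
  \sum_(l < n.+1) ((1 - a) ^+ (n - l) * a ^+ l *+ 'C(n, l)) / l.+1%:R <=
  (a * n.+1%:R)^-1.
Proof.
move=> /andP[a0 a1]; rewrite -[leRHS]mul1r ler_pdivlMr ?mulr_gt0 ?ltr0n //.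
apply: (@le_trans _ _ (\sum_(l < n.+2) (1 - a) ^+ (n.+1 - l) * a ^+ l *+ 'C(n.+1, l))).
  rewrite [leRHS]big_ord_recl [leLHS]mulr_suml -[leLHS]add0r; apply: lerD.
    by rewrite mulrn_wge0 // mulr_ge0 ?exprn_ge0 ?subr_ge0 // ltW.
  apply: ler_sum => l _; rewrite lift0 subSS le_eqVlt; apply/orP; left; apply/eqP.
  have E : 'C(n, l)%:R * n.+1%:R = l.+1%:R * 'C(n.+1, l.+1)%:R :> R.
    by rewrite -!natrM mulnC mul_bin_diag.
  have l0 : l.+1%:R != 0 :> R by rewrite pnatr_eq0.
  rewrite -[_ *+ 'C(n, l)]mulr_natr -[_ *+ 'C(n.+1, l.+1)]mulr_natr exprS.
  transitivity ((1 - a) ^+ (n - l) * (a * a ^+ l) * ('C(n, l)%:R * n.+1%:R / l.+1%:R)).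
    by field; rewrite -natr1 in l0; rewrite addrC.
  by rewrite E; congr (_ * _); rewrite mulrAC divff // mul1r.
by rewrite -exprDn subrK expr1n.
Qed.

Lemma realc_ravg M z (F : C -> R) :
  (root_ravg M z F)%:C%C = root_avg M z (fun w => (F w)%:C%C).
Proof.
rewrite /root_ravg /root_avg realcM realcV realc_nat; congr (_ * _).
exact: (big_morph _ (@realcD R) (erefl _)).
Qed.

Variables (h : nat) (c : R).
Hypotheses (h0 : (0 < h)%N) (c0 : 0 < c) (c8 : c <= 8^-1).

(** With [v = w ^+ h] on the unit circle, [1 - |v - 1| ^ 2 / 4 = |1 + v| ^ 2 / 4],
    and the average of [|1 + v| ^ (2 * l)] is a central binomial coefficient. *)
Lemma avg_cos_pow M (z : C) l : (0 < M)%N -> M.-primitive_root z -> (2 * h * l < M)%N ->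
  root_ravg M z (fun w => (1 - cabs (w ^+ h - 1) ^+ 2 / 4) ^+ l) =
  'C(l.*2, l)%:R / 4 ^+ l.
Proof.
move=> M0 zP lM; have z1 := prim_root_cabs M0 zP.
pose P : {poly R} := (1 + 'X^h) ^+ l.*2.
have PE : P = \sum_(i < l.*2.+1) 'C(l.*2, i)%:R *: 'X^(h * i).
  rewrite /P exprDn; apply: eq_bigr => i _.
  by rewrite expr1n mul1r -exprM scaler_nat.
have sP : (size P <= M)%N.
  rewrite PE; apply: (leq_trans (size_sum _ _ _)); apply/bigmax_leqP => i _.
  apply: (leq_trans (size_scale_leq _ _)); rewrite size_polyXn.
  have il : (i <= l.*2)%N by rewrite -ltnS.
  by apply: leq_ltn_trans lM; rewrite -mulnA mulnCA leq_mul2l mul2n il orbT.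
have coefP : P`_(h * l) = 'C(l.*2, l)%:R.
  have ll : (l < l.*2.+1)%N by rewrite -addnn ltnS leq_addr.
  rewrite PE coef_sum (bigD1 (Ordinal ll)) //= coefZ coefXn eqxx mulr1 big1 ?addr0 //.
  move=> i il; rewrite coefZ coefXn eqn_pmul2l // eq_sym.
  by rewrite (_ : (i == l :> nat) = false) ?mulr0 // -(negbTE il).
apply: (@complexI R); rewrite realc_ravg.
have hlM : (h * l < M)%N by apply: leq_ltn_trans lM; rewrite -mulnA leq_pmull.
rewrite realcM realcV realcX -coefP -(root_avg_coef M0 zP sP hlM) mulrC -root_avgZ.
apply: eq_root_avg => // w w1; set v := w ^+ h.
have v1 : cabs v = 1 by rewrite cabsX w1 expr1n.
have -> : (map_poly (real_complex R) P).[w] = (1 + v) ^+ l.*2.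
  by rewrite /P rmorphXn rmorphD rmorph1 /= map_polyXn horner_exp !hornerE.
rewrite realcX realcB realcM (cabs_sub_sqr v1) realcV !realc_nat.
have -> : (w^*)%C ^+ (h * l) = (v^*)%C ^+ l by rewrite exprM -rmorphXn.
rewrite [1%:C%C](_ : _ = 1 :> C) // -exprVn -mul2n exprM -!exprMn.
congr (_ ^+ l); have vv := unit_conj v1.
transitivity ((v * (v^*)%C + 1 + v + (v^*)%C) / 4); first by rewrite vv; field.
transitivity ((4^-1) * ((v^*)%C + 2 * (v * (v^*)%C) + v * (v * (v^*)%C))); last by ring.
by rewrite vv; ring.
Qed.

(** Expanding the kernel as a binomial mixture of the powers averaged in
    [avg_cos_pow] replaces the usual comparison with a Gaussian integral. *)
Lemma avg_kernel0 M (z : C) n : (0 < M)%N -> M.-primitive_root z -> (2 * h * n < M)%N ->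
  root_ravg M z (fun w => (1 - c * cabs (w ^+ h - 1) ^+ 2) ^+ n) <= c^-1 * rate n.
Proof.
move=> M0 zP nM; have z1 := prim_root_cabs M0 zP.
have c0' := c0; have c8' := c8.
pose a : R := 4 * c.
have a0 : 0 < a by rewrite /a; lra.
have a1 : a <= 2^-1 by rewrite /a; lra.
pose q w : R := 1 - cabs (w ^+ h - 1) ^+ 2 / 4.
have -> : root_ravg M z (fun w => (1 - c * cabs (w ^+ h - 1) ^+ 2) ^+ n) =
   \sum_(l < n.+1) ((1 - a) ^+ (n - l) * a ^+ l *+ 'C(n, l)) * root_ravg M z (fun w => q w ^+ l).
  under eq_bigr do rewrite -root_ravgZ.
  rewrite /root_ravg -mulr_sumr exchange_big /=; congr (_ * _); apply: eq_bigr => i _.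
  set w := z ^+ i.
  have -> : 1 - c * cabs (w ^+ h - 1) ^+ 2 = (1 - a) + a * q w by rewrite /q /a; field.
  rewrite exprDn; apply: eq_bigr => l _.
  by rewrite exprMn mulrnAl mulrA.
pose s : R := Num.sqrt n.+1%:R.
have s0 : 0 < s by rewrite sqrtr_gt0 ltr0n.
have s2 : s ^+ 2 = n.+1%:R by rewrite sqr_sqrtr.
have ul (l : 'I_n.+1) : root_ravg M z (fun w => q w ^+ l) <= s / l.+1%:R + s^-1.
  rewrite avg_cos_pow //; last first.
    by apply: leq_ltn_trans nM; rewrite leq_mul2l -ltnS ltn_ord orbT.
  set u := _ / _.
  have l10 : 0 < l.+1%:R :> R by rewrite ltr0n.
  have u2 : u ^+ 2 * l.+1%:R <= 1.
    rewrite /u expr_div_n -exprM mulrAC ler_pdivrMr ?exprn_gt0 // mul1r.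
    rewrite -[4]/(4%:R) -!natrX -natrM ler_nat (mulnC l) expnM.
    apply: leq_trans (central_bin_bound l).
    by rewrite leq_mul2l -addnn ltnS leq_addr orbT.
  have {}u2 : u ^+ 2 <= l.+1%:R^-1 by rewrite -[leRHS]mul1r ler_pdivlMr.
  have si0 : 0 < s^-1 by rewrite invr_gt0.
  (* AM-GM; the weight [s] balances both terms for [l] of order [n] *)
  have A : 2 * u <= s * u ^+ 2 + s^-1.
    have := sqr_ge0 (s * u - 1) => H.
    have : 0 <= s^-1 * (s * u - 1) ^+ 2 by rewrite mulr_ge0 // ltW.
    have -> : s^-1 * (s * u - 1) ^+ 2 = s * u ^+ 2 - 2 * u + s^-1.
      by field; rewrite gt_eqF.
    lra.
  have B : s * u ^+ 2 <= s / l.+1%:R by rewrite ler_wpM2l // ltW.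
  have : 0 <= s / l.+1%:R by rewrite divr_ge0 // ltW.
  have : 0 <= u by rewrite /u divr_ge0 // exprn_ge0.
  move: A B si0; move: (s * u ^+ 2) (s / l.+1%:R) (s^-1) => A1 A2 A3; lra.
apply: (@le_trans _ _ (\sum_(l < n.+1) ((1 - a) ^+ (n - l) * a ^+ l *+ 'C(n, l)) * (s / l.+1%:R + s^-1))).
  apply: ler_sum => l _; apply: ler_wpM2l (ul l).
  by rewrite mulrn_wge0 // mulr_ge0 ?exprn_ge0 //; lra.
under eq_bigr do rewrite mulrDr mulrCA.
rewrite big_split /= -mulr_sumr -mulr_suml -exprDn subrK expr1n mul1r.
have H := @binomial_harmonic a n; rewrite a0 /= in H.
have {}H := H ltac:(lra).
have : s * (a * n.+1%:R)^-1 = a^-1 * s^-1.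
  by rewrite -s2; field; rewrite !gt_eqF.
have : s * \sum_(i < n.+1) ((1 - a) ^+ (n - i) * a ^+ i *+ 'C(n, i)) / i.+1%:R <=
   s * (a * n.+1%:R)^-1 by rewrite ler_wpM2l // ltW.
rewrite /rate -/s => H1 H2.
have si0 : 0 < s^-1 by rewrite invr_gt0.
have H3 : a^-1 + 1 <= c^-1.
  rewrite /a invfM; have : 8 <= c^-1 by rewrite -[8]invrK lef_pV2 ?posrE // invr_gt0.
  lra.
have : (a^-1 + 1) * s^-1 <= c^-1 * s^-1 by rewrite ler_wpM2r // ltW.
by rewrite mulrDl mul1r; apply: le_trans; rewrite lerD2r -H2.
Qed.

Definition kernel_const : R := locked (5 / c).
Local Notation D := kernel_const.

Lemma kernel_const_ge1 : 1 <= D.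
Proof. by have c8' := c8; rewrite /D -lock ler_pdivlMr // mul1r; lra. Qed.

(** Each of the [j] factors [cabs (w ^+ h - 1)] takes a fifth of the exponent and
    yields a factor [rate n] by [bernoulli_decay]; a last fifth is left for
    [avg_kernel0]. *)
Lemma avg_kernel M (z : C) n j : (j <= 4)%N ->
  (0 < M)%N -> M.-primitive_root z -> (2 * h * n < M)%N ->
  root_ravg M z (fun w => cabs (w ^+ h - 1) ^+ j * (1 - c * cabs (w ^+ h - 1) ^+ 2) ^+ n)
  <= (D * rate n) ^+ j.+1.
Proof.
move=> j4 M0 zP nM; have z1 := prim_root_cabs M0 zP.
have c0' := c0; have c8' := c8.
pose m := (n %/ 5)%N; have mn : (5 * m <= n)%N by rewrite mulnC leq_trunc_div.
have nm : (n.+1 <= 5 * m.+1)%N by rewrite mulnC; exact: ltn_ceil.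
have c1 : 0 < c^-1 by rewrite invr_gt0.
pose s := Num.sqrt c^-1; have s0 : 0 < s by rewrite sqrtr_gt0.
have s2 : s ^+ 2 = c^-1 by rewrite sqr_sqrtr // ltW.
have s8 : 1 <= s.
  rewrite -(ler_pXn2r (n := 2)) ?nnegrE ?(ltW s0) // expr1n s2.
  by rewrite -[leLHS]invr1 lef_pV2 ?posrE //; lra.
have rm := rate_gt0 m; have rn := rate_gt0 n.
have key w : cabs w = 1 -> cabs (w ^+ h - 1) ^+ j * (1 - c * cabs (w ^+ h - 1) ^+ 2) ^+ n <=
   (s * rate m) ^+ j * (1 - c * cabs (w ^+ h - 1) ^+ 2) ^+ m.
  move=> w1; set x := cabs _; set y := c * x ^+ 2.
  have x0 : 0 <= x by exact: cabs_ge0.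
  have x2 : x <= 2 by rewrite (le_trans (cabsB _ _)) // cabsX w1 expr1n cabs1; lra.
  have xx2 : x ^+ 2 <= 4 by nra.
  have y01 : 0 <= y <= 1.
    apply/andP; split; first by rewrite mulr_ge0 ?sqr_ge0 // ltW.
    by rewrite /y; have := sqr_ge0 x; nra.
  have [y0 y1] := andP y01.
  have b0 : 0 <= 1 - y by rewrite subr_ge0.
  have b1 : 1 - y <= 1 by lra.
  have Y : x * (1 - y) ^+ m <= s * rate m.
    rewrite -(ler_pXn2r (n := 2)) ?nnegrE ?mulr_ge0 ?exprn_ge0 ?(ltW rm) ?(ltW s0) //.
    rewrite !exprMn s2 rate_sqr -ler_pdivrMl // invrK mulrA -/y.
    apply: le_trans (bernoulli_decay m y01); rewrite ler_wpM2l // -exprM.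
    by apply: ler_wiXn2l => //; rewrite muln2 -addnn leq_addr.
  apply: (@le_trans _ _ (x ^+ j * (1 - y) ^+ (m * j + m))).
    rewrite ler_wpM2l ?exprn_ge0 //; apply: ler_wiXn2l => //.
    by apply: leq_trans mn; rewrite addnC -mulnS mulnC leq_mul2r ltnS j4 orbT.
  rewrite exprD mulrA exprM -exprMn ler_wpM2r ?exprn_ge0 //.
  by rewrite lerXn2r ?nnegrE ?mulr_ge0 ?exprn_ge0 ?(ltW rm) ?(ltW s0).
apply: le_trans (@root_ravg_le R M z (fun w => cabs (w ^+ h - 1) ^+ j * (1 - c * cabs (w ^+ h - 1) ^+ 2) ^+ n)
  (fun w => (s * rate m) ^+ j * (1 - c * cabs (w ^+ h - 1) ^+ 2) ^+ m) z1 key) _; rewrite root_ravgZ exprSr.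
have mM : (2 * h * m < M)%N.
  by apply: leq_ltn_trans nM; rewrite leq_mul2l leq_div orbT.
have rmn : rate m <= 5 * rate n by rewrite -[5]/(5%:R); exact: rate_scale.
have sc : s <= c^-1 by rewrite -s2 expr2 ler_peMl ?(ltW s0).
apply: ler_pM.
- by rewrite exprn_ge0 // mulr_ge0 // ltW.
- rewrite /root_ravg mulr_ge0 ?invr_ge0 //; apply: sumr_ge0 => i _; apply: exprn_ge0.
  set w := z ^+ i; have w1 : cabs w = 1 by rewrite cabsX z1 expr1n.
  have x0 : 0 <= cabs (w ^+ h - 1) by exact: cabs_ge0.
  have x2 : cabs (w ^+ h - 1) <= 2 by rewrite (le_trans (cabsB _ _)) // cabsX w1 expr1n cabs1; lra.
  have xx2 : cabs (w ^+ h - 1) ^+ 2 <= 4 by nra.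
  by have := sqr_ge0 (cabs (w ^+ h - 1)); nra.
- apply: lerXn2r; rewrite ?nnegrE ?mulr_ge0 ?(ltW s0) ?(ltW rm) ?(ltW rn) //.
    exact: le_trans ler01 kernel_const_ge1.
  apply: (@le_trans _ _ (c^-1 * (5 * rate n))); last by rewrite /D -lock mulrCA mulrA.
  by rewrite ler_pM // ltW.
- apply: (le_trans (avg_kernel0 M0 zP mM)).
  apply: (@le_trans _ _ (c^-1 * (5 * rate n))); last by rewrite /D -lock mulrCA mulrA.
  by rewrite ler_wpM2l // ltW.
Qed.

End kernel_bounds.

(** * Concentration of the walk *)

Section concentration.
Variables (R : archiRcfType) (p : nat -> R) (V : R).
Hypothesis pP : critical_law p V.
Local Notation C := (R[i]).
Local Notation psi := (char_fun p).
Local Notation delta := (law_deficit p).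

Lemma deriv_horner1 (P : {poly R}) n : (size P <= n.+1)%N ->
  P^`().[1] = \sum_(i < n.+1) i%:R * P`_i.
Proof.
move=> sP; rewrite (horner_coef_wide _ (n := n)); last first.
  apply/leq_sizeP => j nj; rewrite coef_deriv.
  by move/leq_sizeP: sP => /(_ j.+1 nj) ->; rewrite mul0rn.
rewrite big_ord_recl mul0r add0r; apply: eq_bigr => i _.
by rewrite coef_deriv expr1n mulr1 lift0 mulr_natl.
Qed.

Lemma sqr_deviation (P : {poly R}) n k : (size P <= n.+1)%N ->
  \sum_(i < n.+1) (i%:R - k%:R) ^+ 2 * P`_i =
  P^`(2).[1] + (1 - 2 * k%:R) * P^`().[1] + k%:R ^+ 2 * P.[1].
Proof.
move=> sP; have sP' : (size P^`() <= n.+1)%N.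
  apply/leq_sizeP => j nj; rewrite coef_deriv.
  by move/leq_sizeP: sP => /(_ j.+1 (leqW nj)) ->; rewrite mul0rn.
rewrite derivnS derivn1 (@deriv_horner1 P^`() n) // (@deriv_horner1 P n) //.
rewrite (horner_coef_wide 1 sP) 2!mulr_sumr.
have -> : \sum_(i < n.+1) i%:R * P^`()`_i = \sum_(i < n.+1) (i%:R ^+ 2 - i%:R) * P`_i.
  rewrite big_ord_recr /= coef_deriv.
  have -> : P`_n.+1 = 0 by move/leq_sizeP: sP; exact.
  rewrite mul0rn mulr0 addr0 [RHS]big_ord_recl /= expr0n subr0 mul0r add0r.
  apply: eq_bigr => i _; rewrite coef_deriv /bump /= add1n -[_ *+ _]mulr_natl -(natr1 i); ring.
rewrite -!big_split /=; apply: eq_bigr => i _; rewrite expr1n; ring.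
Qed.

Lemma trunc_gf1 N : (trunc_gf p N).[1] = mass p N.
Proof.
rewrite (horner_coef_wide _ (n := N.+1)) ?size_poly //; apply: eq_bigr => i _.
by rewrite coef_poly ltn_ord expr1n mulr1.
Qed.

Lemma trunc_gf_deriv1 N : (trunc_gf p N)^`().[1] = mean p N.
Proof.
rewrite (@deriv_horner1 _ N) ?size_poly //; apply: eq_bigr => i _.
by rewrite coef_poly ltn_ord.
Qed.

Lemma trunc_gf_deriv2 N : 0 <= (trunc_gf p N)^`(2).[1] <= V.
Proof.
have -> : (trunc_gf p N)^`(2).[1] = \sum_(i < N.+1) (i%:R ^+ 2 - i%:R) * p i.
  have := @sqr_deviation (trunc_gf p N) N 0 (size_poly _ _).
  rewrite trunc_gf1 trunc_gf_deriv1 mulr0 subr0 mul1r expr0n mul0r addr0.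
  move=> H; apply: (addIr (mean p N)); rewrite -H /mean -big_split /=.
  by apply: eq_bigr => i _; rewrite coef_poly ltn_ord; ring.
have pg := law_ge0 pP.
have ii (i : nat) : i%:R <= i%:R ^+ 2 :> R.
  by rewrite -natrX ler_nat; case: i => // i; rewrite leq_pmulr.
apply/andP; split; first by apply: sumr_ge0 => i _; rewrite mulr_ge0 ?subr_ge0.
apply: le_trans (law_mom2 pP N); apply: ler_sum => i _.
by rewrite ler_wpM2r // gerBl.
Qed.

Lemma bernoulli_ineq (d : R) k : 0 <= d <= 1 -> 1 - k%:R * d <= (1 - d) ^+ k.
Proof.
move=> /andP[d0 d1]; elim: k => [|k IH]; first by rewrite mul0r subr0.
rewrite exprS; apply: (@le_trans _ _ ((1 - d) * (1 - k%:R * d))); last first.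
  by rewrite ler_wpM2l ?subr_ge0.
rewrite -natr1; have : 0 <= k%:R * d ^+ 2 by rewrite mulr_ge0 ?sqr_ge0.
lra.
Qed.

(** Moments of the walk are derivatives at [1] of a power of the truncated
    generating function. The truncation shifts the mean of the walk, which must
    stay negligible in a variance of order [k]: this is why the deficit is
    compared with [k ^ (- 3)]. *)
Lemma walk_moments N k : delta N <= 1 -> 2 * k.+1%:R ^+ 3 * delta N <= 4^-1 ->
  let P := trunc_gf p N ^+ k.+1 in
  3 / 4 <= P.[1] /\
  \sum_(i < (N * k.+1).+1) (i%:R - k.+1%:R) ^+ 2 * P`_i <= k.+1%:R * V + 1.
Proof.
move=> d1 kd P; have d0 := law_deficit_ge0 pP N; have V0 := law_V_ge0 pP.
have m1 := law_mass pP N; have mn1 := law_mean pP N.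
have [a0 b0] := (mass_ge0 pP N, mean_ge0 pP N).
have ad : 1 - delta N <= mass p N by rewrite /law_deficit; lra.
have bd : 1 - delta N <= mean p N by rewrite /law_deficit; lra.
have kR : 1 <= k.+1%:R :> R by rewrite ler1n.
have k3 : k.+1%:R <= k.+1%:R ^+ 3 :> R by rewrite -natrX ler_nat -[leqLHS]expn1 leq_pexp2l.
have kd' : k.+1%:R * delta N <= 8^-1.
  by have : k.+1%:R * delta N <= k.+1%:R ^+ 3 * delta N by [rewrite ler_wpM2r]; lra.
have sd : 0 <= 1 - delta N by lra.
have bk : 1 - k.+1%:R * delta N <= (1 - delta N) ^+ k.+1 by apply: bernoulli_ineq; rewrite d0.
have sP : (size P <= (N * k.+1).+1)%N.
  apply: (leq_trans (size_poly_exp_leq _ _)); rewrite ltnS leq_mul2r.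
  by rewrite -subn1 leq_subLR add1n size_poly orbT.
split.
  rewrite /P horner_exp trunc_gf1.
  have : (1 - delta N) ^+ k.+1 <= mass p N ^+ k.+1 by rewrite lerXn2r ?nnegrE.
  lra.
rewrite (sqr_deviation _ sP) /P.
have E1 : (trunc_gf p N ^+ k.+1)^`().[1] = k.+1%:R * (mean p N * mass p N ^+ k).
  by rewrite deriv_exp hornerMn hornerM horner_exp trunc_gf1 trunc_gf_deriv1 mulr_natl.
have [g20 g2V] := andP (trunc_gf_deriv2 N); rewrite derivnS derivn1 in g20 g2V.
have ak1 : mass p N ^+ k <= 1 by rewrite exprn_ile1.
have ak0 : 0 <= mass p N ^+ k by rewrite exprn_ge0.
have E2 : (trunc_gf p N ^+ k.+1)^`(2).[1] <= k.+1%:R * (V + k%:R).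
  rewrite derivnS derivn1 deriv_exp derivMn derivM hornerMn hornerD 2!hornerM.
  rewrite -[X in X <= _]mulr_natl ler_wpM2l // [in X in X + _ <= _]horner_exp trunc_gf1.
  apply: lerD.
    by apply: (@le_trans _ _ (V * 1)); [apply: ler_pM|rewrite mulr1].
  rewrite deriv_exp hornerMn hornerM horner_exp trunc_gf1 trunc_gf_deriv1.
  rewrite -mulr_natr mulrA mulrA ler_piMl //.
  rewrite mulr_ile1 ?mulr_ge0 ?exprn_ge0 ?exprn_ile1 ?mulr_ile1 //.
have E1' : k.+1%:R * (1 - k.+1%:R * delta N) <= (trunc_gf p N ^+ k.+1)^`().[1].
  rewrite E1 ler_wpM2l //; apply: (le_trans bk); rewrite exprS.
  by rewrite ler_pM ?exprn_ge0 // lerXn2r ?nnegrE.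
have E3 : (trunc_gf p N ^+ k.+1).[1] <= 1 by rewrite horner_exp trunc_gf1 exprn_ile1.
have X1 : (2 * k.+1%:R - 1) * (k.+1%:R * (1 - k.+1%:R * delta N)) <=
   (2 * k.+1%:R - 1) * (trunc_gf p N ^+ k.+1)^`().[1] by rewrite ler_wpM2l //; lra.
have X2 : k.+1%:R ^+ 2 * (trunc_gf p N ^+ k.+1).[1] <= k.+1%:R ^+ 2.
  by rewrite ler_piMr ?sqr_ge0.
have X3 : 0 <= k.+1%:R ^+ 2 * delta N by rewrite mulr_ge0 ?sqr_ge0.
have X4 : k.+1%:R = k%:R + 1 :> R by rewrite natr1.
rewrite X4 in E2 X1 X2 X3 kd *.
lra.
Qed.

Lemma window_count S k B :
  \sum_(j < S) ((k < j + B)%N && (j < k + B)%N)%:R <= (2 * B)%:R :> R.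
Proof.
rewrite -natr_sum ler_nat -(big_mkord xpredT (fun j => nat_of_bool ((k < j + B) && (j < k + B))%N)).
rewrite -big_mkcond /= sum1_count -size_filter -(size_iota (k.+1 - B) (2 * B)).
apply: uniq_leq_size; first by rewrite filter_uniq // iota_uniq.
move=> j; rewrite mem_filter mem_iota => /andP[/andP[j1 j2] _]; apply/andP; split; lia.
Qed.

(** By Chebyshev's inequality half of the mass lies in a window of [2 * B]
    integers, and the sum of squares is smallest when this half is spread evenly
    over the window. *)
Lemma sum_sqr_ge S (u : nat -> R) k B W : (0 < B)%N ->
  (forall i, 0 <= u i) -> 3 / 4 <= \sum_(i < S) u i ->
  \sum_(i < S) (i%:R - k%:R) ^+ 2 * u i <= W -> 4 * W <= B%:R ^+ 2 ->
  (8 * B%:R)^-1 <= \sum_(i < S) u i ^+ 2.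
Proof.
move=> B0 u0 um uW WB; pose I (j : nat) : R := ((k < j + B)%N && (j < k + B)%N)%:R.
have BR : 0 < B%:R :> R by rewrite ltr0n.
pose lam : R := (4 * B%:R)^-1; have lam0 : 0 < lam by rewrite invr_gt0; lra.
have out : \sum_(i < S) (1 - I i) * u i <= 4^-1.
  rewrite -(ler_pM2l (exprn_gt0 2 BR)).
  apply: (@le_trans _ _ W); last by lra.
  apply: le_trans uW; rewrite mulr_sumr; apply: ler_sum => i _.
  rewrite mulrA ler_wpM2r // /I.
  have [/andP[_ _]|H] := boolP ((k < i + B)%N && (i < k + B)%N).
    by rewrite subrr mulr0 sqr_ge0.
  rewrite subr0 mulr1; have : (B <= k - i)%N || (B <= i - k)%N.
    by move: H; rewrite negb_and -!leqNgt => /orP[?|?]; apply/orP; [left|right]; lia.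
  case/orP => H1; have {}H2 := H1; rewrite -(ler_nat R) natrB in H1; try lia.
    by rewrite -[leRHS]sqrrN opprB lerXn2r ?nnegrE // (le_trans _ H1).
  by rewrite lerXn2r ?nnegrE // (le_trans _ H1).
have inn : 2^-1 <= \sum_(i < S) I i * u i.
  have : \sum_(i < S) u i = \sum_(i < S) I i * u i + \sum_(i < S) (1 - I i) * u i.
    by rewrite -big_split /=; apply: eq_bigr => i _; ring.
  lra.
(* tangent line of the square at the even spread [lam] over the window *)
have : \sum_(i < S) (2 * lam * (I i * u i) - lam ^+ 2 * I i) <= \sum_(i < S) u i ^+ 2.
  apply: ler_sum => i _; have := sqr_ge0 (u i - lam * I i).
  have -> : (u i - lam * I i) ^+ 2 = u i ^+ 2 - 2 * lam * (I i * u i) + lam ^+ 2 * (I i * I i) by ring.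
  by rewrite -[I i * I i]natrM mulnb andbb; lra.
rewrite sumrB -2!mulr_sumr; apply: le_trans.
have w := window_count S k B; rewrite natrM in w.
have w' : lam ^+ 2 * \sum_(i < S) I i <= lam ^+ 2 * (2 * B%:R) by rewrite ler_wpM2l ?sqr_ge0.
have i' : 2 * lam * 2^-1 <= 2 * lam * \sum_(i < S) I i * u i by rewrite ler_wpM2l //; lra.
have e1 : lam ^+ 2 * (2 * B%:R) = lam / 2 by rewrite /lam; field; rewrite gt_eqF.
have e2 : (8 * B%:R)^-1 = lam / 2 by rewrite /lam; field; rewrite gt_eqF.
lra.
Qed.

Lemma nat_sqrt_up k : exists2 s : nat, (k <= s ^ 2)%N & (s <= k)%N /\ ((s.-1) ^ 2 <= k)%N.
Proof.
have ex : exists s, (k <= s ^ 2)%N by exists k; case: k => // k; rewrite expnS expn1 leq_pmulr.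
have [s ks smin] := ex_minnP ex; exists s => //; split.
  by apply: smin; case: (k) => // j; rewrite expnS expn1 leq_pmulr.
case: s ks smin => [//|s] ks smin /=; rewrite leqNgt; apply/negP => H.
by have := smin s (ltnW H); rewrite ltnn.
Qed.

Lemma parseval N k M z : (0 < M)%N -> M.-primitive_root z -> (N * k < M)%N ->
  root_ravg M z (fun w => cabs (psi N w ^+ k) ^+ 2) =
  \sum_(j < (N * k).+1) (trunc_gf p N ^+ k)`_j ^+ 2.
Proof.
move=> M0 zP NM; have z1 := prim_root_cabs M0 zP.
set P := trunc_gf p N ^+ k.
have sP : (size P <= (N * k).+1)%N.
  apply: (leq_trans (size_poly_exp_leq _ _)); rewrite ltnS leq_mul2r.
  by rewrite -subn1 leq_subLR add1n size_poly orbT.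
apply: (@complexI R); rewrite realc_ravg.
transitivity (root_avg M z (fun w => \sum_(j < (N * k).+1) (P`_j)%:C%C *
   ((map_poly (real_complex R) P).[w] * (w^*)%C ^+ j))).
  apply: eq_root_avg => // w w1; rewrite cabs_sqr.
  have -> : psi N w ^+ k = (map_poly (real_complex R) P).[w].
    by rewrite /P rmorphXn /= horner_exp char_funE.
  rewrite {2}(horner_coef_wide w (n := (N * k).+1)) ?size_map_poly //.
  rewrite rmorph_sum mulr_sumr; apply: eq_bigr => j _.
  rewrite coef_map rmorphM mulrCA; congr (_ * (_ * _)); first exact: conjc_real.
  exact: rmorphXn.
rewrite /root_avg exchange_big /= mulr_sumr (big_morph _ (@realcD R) (erefl _)).
apply: eq_bigr => j _; rewrite -mulr_sumr mulrCA.
have jM : (j < M)%N by apply: leq_trans NM; rewrite ltn_ord.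
have := root_avg_coef M0 zP (leq_trans sP NM) jM; rewrite /root_avg => ->.
by rewrite realcX expr2.
Qed.

Variable v0 : nat.
Hypothesis Vv0 : V <= v0%:R.

(** Up to the truncation of the law, the right-hand side is the probability that
    two independent walks are at the same place after [k.+1] steps. *)
Lemma parseval_lower k N : delta N <= 1 -> 2 * k.+1%:R ^+ 3 * delta N <= 4^-1 ->
  (32 * v0.+1%:R)^-1 * rate R k.+1 <=
  \sum_(j < (N * k.+1).+1) (trunc_gf p N ^+ k.+1)`_j ^+ 2.
Proof.
move=> d1 kd; have [m W] := walk_moments d1 kd.
set P := trunc_gf p N ^+ k.+1 in m W *.
have P0 i : 0 <= P`_i.
  rewrite /P; have t0 j : 0 <= (trunc_gf p N)`_j.
    by rewrite coef_poly; case: ifP => // _; exact: law_ge0 pP j.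
  elim: k.+1 i => [|l IH] i; first by rewrite expr0 coef1.
  by rewrite exprS coefM; apply: sumr_ge0 => j _; rewrite mulr_ge0.
have sP : (size P <= (N * k.+1).+1)%N.
  apply: (leq_trans (size_poly_exp_leq _ _)); rewrite ltnS leq_mul2r.
  by rewrite -subn1 leq_subLR add1n size_poly orbT.
rewrite (horner_coef_wide 1 sP) in m.
have {}m : 3 / 4 <= \sum_(i < (N * k.+1).+1) P`_i.
  by apply: le_trans m _; apply: ler_sum => i _; rewrite expr1n mulr1.
have [s ks [_ sk]] := nat_sqrt_up k.+1.
have s0 : (0 < s)%N by case: s ks {sk}.
pose B := (2 * v0.+1 * s)%N.
have B0 : (0 < B)%N by rewrite !muln_gt0 s0.
have WB : 4 * (k.+1%:R * V + 1) <= B%:R ^+ 2.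
  apply: (@le_trans _ _ (4 * (k.+1%:R * v0%:R + 1))).
    by rewrite ler_wpM2l // lerD2r ler_wpM2l.
  have -> : 4 * (k.+1%:R * v0%:R + 1) = (4 * (k.+1 * v0 + 1))%N%:R :> R.
    by rewrite natrM natrD natrM.
  rewrite -natrX ler_nat /B !expnMn -mulnA leq_mul2l /=.
  apply: (@leq_trans (v0.+1 * k.+1)%N); first by rewrite mulnC mulSn; lia.
  by rewrite leq_mul // expnS expn1 leq_pmulr.
have := sum_sqr_ge B0 P0 m W WB; apply: le_trans.
have BR : 0 < B%:R :> R by rewrite ltr0n.
have v1 : 0 < v0.+1%:R :> R by rewrite ltr0n.
have sr : s%:R * rate R k.+1 <= 2.
  rewrite /rate ler_pdivrMr ?sqrtr_gt0 ?ltr0n //.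
  rewrite -(ler_pXn2r (n := 2)) ?nnegrE // ?mulr_ge0 ?sqrtr_ge0 //.
  rewrite exprMn sqr_sqrtr // -natrX -[2 ^+ 2]/(2%:R ^+ 2) -natrX -natrM ler_nat.
  case: s s0 ks sk {B B0 WB BR} => // s _ _ /= sk; nia.
have BE : 32 * v0.+1%:R * 2^-1 * s%:R = 8 * B%:R :> R by rewrite /B !natrM; field.
rewrite -ler_pdivlMl ?invr_gt0 ?mulr_gt0 // invrK.
rewrite ler_pdivlMr ?mulr_gt0 // -BE.
have : 32 * v0.+1%:R * 2^-1 * (s%:R * rate R k.+1) <= 32 * v0.+1%:R * 2^-1 * 2.
  by rewrite ler_wpM2l // mulr_ge0 ?invr_ge0 // mulr_ge0.
lra.
Qed.

End concentration.

(** * Local limit estimates *)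

Lemma big_modulus (N m k a b M : nat) : (k <= m)%N ->
  M = (N * m.+1 + a + m + b).+1 ->
  [/\ (N * m.+1 < M)%N, (N * k < M)%N, (k < M)%N, (m < M)%N & (a < M)%N].
Proof.
move=> km ->; have : (N * k <= N * m)%N by rewrite leq_mul2l km orbT.
rewrite mulnS; move: (N * k)%N (N * m)%N => x y xy; split; lia.
Qed.

Lemma halve_index a c l : (2 * (a + c + 2) <= l)%N ->
  exists2 i, l = (odd l + i.+1.*2)%N & (a <= i)%N /\ (c <= i)%N.
Proof.
move=> al; have l2 : (a + c + 2 <= l./2)%N by lia.
exists (l./2).-1; first by rewrite prednK ?odd_double_half //; lia.
by move: (l./2) l2 => x; split; lia.
Qed.

Lemma four_summands_lt (a b c d : nat) (M := (a + b + c + d).+1) :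
  [/\ (a < M)%N, (b < M)%N, (c < M)%N & (d < M)%N].
Proof. by rewrite /M; split; lia. Qed.

Section local_estimates.
Variables (R : archiRcfType) (p : nat -> R) (V : R) (h : nat) (c : R) (N0 : nat).
Hypotheses (pP : critical_law p V) (h0 : (0 < h)%N).
Hypothesis h_span : forall a, 0 < p a -> (h %| a)%N.
Hypotheses (c0 : 0 < c) (c8 : c <= 8^-1).
Local Notation C := (R[i]).
Local Notation psi := (char_fun p).
Local Notation phi := (phi_fun p h).
Local Notation delta := (law_deficit p).
Local Notation D := (kernel_const c).
Local Notation ret m := (conv_pow p m m).
Hypothesis psi_decay : forall N, (N0 <= N)%N -> forall w : C, cabs w = 1 ->
    cabs (psi N w) <= 1 - c * cabs (w ^+ h - 1) ^+ 2.

Definition ker j n (w : C) : R :=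
  cabs (w ^+ h - 1) ^+ j * (1 - c * cabs (w ^+ h - 1) ^+ 2) ^+ n.

Lemma ker_base w : cabs w = 1 -> 0 <= 1 - c * cabs (w ^+ h - 1) ^+ 2 <= 1.
Proof.
move=> w1; have c0' := c0; have c8' := c8.
have x0 : 0 <= cabs (w ^+ h - 1) by exact: cabs_ge0.
have x2 : cabs (w ^+ h - 1) <= 2.
  by rewrite (le_trans (cabsB _ _)) // cabsX w1 expr1n cabs1; lra.
have xx2 : cabs (w ^+ h - 1) ^+ 2 <= 4 by nra.
have xx0 := sqr_ge0 (cabs (w ^+ h - 1)).
by apply/andP; split; nra.
Qed.

Lemma psi_ker N n w : (N0 <= N)%N -> cabs w = 1 -> cabs (psi N w) ^+ n <= ker 0 n w.
Proof.
move=> NN w1; rewrite /ker expr0 mul1r; have /andP[b0 _] := ker_base w1.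
by apply: lerXn2r; rewrite ?nnegrE ?cabs_ge0 //; exact: psi_decay.
Qed.

Lemma ker_mulx j i n w : cabs (w ^+ h - 1) ^+ i * ker j n w = ker (i + j) n w.
Proof. by rewrite /ker exprD mulrA. Qed.

Lemma avg_ker M z n j : (j <= 4)%N ->
  (0 < M)%N -> M.-primitive_root z -> (2 * h * n < M)%N ->
  root_ravg M z (ker j n) <= (D * rate R n) ^+ j.+1.
Proof. exact: avg_kernel. Qed.

Lemma kernel_const_gt0 : 0 < D.
Proof. by apply: lt_le_trans (kernel_const_ge1 c0 c8). Qed.

Lemma conv_pow_avg N n j M z : (0 < M)%N -> M.-primitive_root z ->
  (j <= N)%N -> (N * n < M)%N -> (j < M)%N ->
  root_avg M z (fun w => psi N w ^+ n * (w^*)%C ^+ j) = (conv_pow p n j)%:C%C.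
Proof.
move=> M0 zP jN nM jM; rewrite -(coef_trunc_gf_exp _ _ jN) -(root_avg_coef M0 zP) //.
  apply: eq_root_avg; first exact: prim_root_cabs zP.
  by move=> w _; rewrite rmorphXn /= horner_exp char_funE.
apply: leq_trans nM; apply: (leq_trans (size_poly_exp_leq _ _)); rewrite ltnS.
by rewrite leq_mul2r -subn1 leq_subLR add1n size_poly orbT.
Qed.

Lemma conv_pow_le n j : conv_pow p n j <= D * rate R n.
Proof.
pose N := maxn N0 j; pose M := (N * n + 2 * h * n + j).+1.
have [z zP] := @complex_prim_root R M (ltn0Sn _).
have z1 := prim_root_cabs (ltn0Sn _) zP.
have E := @conv_pow_avg N n j M z (ltn0Sn _) zP (leq_maxr _ _) ltac:(lia) ltac:(lia).
have <- : cabs (conv_pow p n j)%:C%C = conv_pow p n j.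
  by rewrite cabs_real ger0_norm // conv_pow_ge0 //; exact: law_ge0 pP.
rewrite -E; apply: (@le_trans _ _ (root_ravg M z (ker 0 n))).
  apply: cabs_root_avg => // w w1.
  rewrite cabsM !cabsX cabs_conj w1 expr1n mulr1 psi_ker //; exact: leq_maxl.
by rewrite -[leRHS]expr1; apply: avg_ker => //; rewrite /M; lia.
Qed.

(** Removes the truncation from a bound between quantities that do not depend on
    it. *)
Lemma deficit_limit (x y B : R) N1 : 0 <= B ->
  (forall N, (N1 <= N)%N -> x <= y + B * delta N) -> x <= y.
Proof.
move=> B0 H; apply/ler_addgt0Pr => e e0.
have B1 : 0 < e / (B + 1) by rewrite divr_gt0 //; lra.
have [N2 H2] := law_deficit_lim pP B1.
have h1 := H (maxn N1 N2) (leq_maxl _ _); have h2 := H2 (maxn N1 N2) (leq_maxr _ _).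
apply: (le_trans h1); rewrite lerD2l.
apply: (@le_trans _ _ ((B + 1) * (e / (B + 1)))).
  by rewrite ler_pM ?(law_deficit_ge0 pP) //; lra.
by rewrite mulrCA divff ?mulr1 //; rewrite gt_eqF //; lra.
Qed.

Lemma rate_small (B e : R) : 0 <= B -> 0 < e ->
  exists n0, forall m, (n0 <= m)%N -> B * rate R m <= e.
Proof.
move=> B0 e0; pose t := (B / e) ^+ 2.
have Be : 0 <= B / e by rewrite divr_ge0 // ltW.
pose n0 := Num.bound t.
have Hn0 : t <= n0%:R by rewrite ltW // archi_boundP // sqr_ge0.
exists n0 => m nm; have tm : t <= m.+1%:R.
  by apply: (le_trans Hn0); rewrite ler_nat (leq_trans nm).
have : B / e <= Num.sqrt m.+1%:R.
  by rewrite -[leLHS]ger0_norm // -sqrtr_sqr ler_wsqrtr.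
rewrite /rate ler_pdivrMr // => H; rewrite ler_pdivrMr ?sqrtr_gt0 ?ltr0n //.
by rewrite mulrC.
Qed.

(** In the Fourier averages the two probabilities differ by the factor
    [1 - phi], which is of second order by [phi_fun_sub1]. *)
Lemma return_shift : exists2 B, 0 <= B & forall m,
  `| ret m - conv_pow p (m + h) (m + h) | <= B * rate R m ^+ 3.
Proof.
have [K K0 HK] := phi_fun_sub1 pP h0 h_span.
have D0 := kernel_const_gt0.
exists (K * D ^+ 3); first by rewrite mulr_ge0 ?exprn_ge0 ?(ltW D0).
move=> m; have r0 := rate_gt0 R m.
apply: (@deficit_limit _ _ (K * D) (maxn N0 (m + h))).
  by rewrite mulr_ge0 ?(ltW D0).
move=> N; rewrite geq_max => /andP[NN mN].
pose M := (N * (m + h) + 2 * h * m + m + h).+1.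
have [z zP] := @complex_prim_root R M (ltn0Sn _).
have z1 := prim_root_cabs (ltn0Sn _) zP.
have E1 := @conv_pow_avg N m m M z (ltn0Sn _) zP ltac:(lia) ltac:(rewrite /M; nia) ltac:(lia).
have E2 := @conv_pow_avg N (m + h) (m + h) M z (ltn0Sn _) zP mN ltac:(rewrite /M; nia) ltac:(lia).
rewrite -cabs_real realcB -E1 -E2 -root_avgB.
apply: (@le_trans _ _ (root_ravg M z (fun w => K * (ker 2 m w + delta N * ker 0 m w)))).
  apply: cabs_root_avg => // w w1.
  have -> : psi N w ^+ m * (w^*)%C ^+ m - psi N w ^+ (m + h) * (w^*)%C ^+ (m + h) =
     psi N w ^+ m * (w^*)%C ^+ m * (1 - phi N w).
    by rewrite /phi_fun rmorphXn !exprD; ring.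
  rewrite cabsM cabsM !cabsX cabs_conj w1 expr1n mulr1 cabsC.
  apply: (@le_trans _ _ (ker 0 m w * (K * (cabs (w ^+ h - 1) ^+ 2 + delta N)))).
    by apply: ler_pM; rewrite ?exprn_ge0 ?cabs_ge0 ?psi_ker //; exact: HK.
  by rewrite -[2%N]/(2 + 0)%N -ker_mulx le_eqVlt; apply/orP; left; apply/eqP; ring.
rewrite root_ravgZ root_ravgD root_ravgZ.
have A2 : root_ravg M z (ker 2 m) <= (D * rate R m) ^+ 3 by apply: avg_ker => //; rewrite /M; lia.
have A0 : root_ravg M z (ker 0 m) <= (D * rate R m) ^+ 1 by apply: avg_ker => //; rewrite /M; lia.
have d0 := law_deficit_ge0 pP N.
have A0' : root_ravg M z (ker 0 m) <= D.
  by apply: (le_trans A0); rewrite expr1 ler_piMr ?rate_le1 // ltW.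
have B1 : delta N * root_ravg M z (ker 0 m) <= delta N * D by rewrite ler_wpM2l.
rewrite exprMn in A2.
have : K * (root_ravg M z (ker 2 m) + delta N * root_ravg M z (ker 0 m)) <=
  K * (D ^+ 3 * rate R m ^+ 3 + delta N * D) by rewrite ler_wpM2l // lerD.
lra.
Qed.

Lemma cabs_pow_sub (a b : C) (k : R) l : cabs a <= k -> cabs b <= k ->
  cabs (a ^+ l.+1 - b ^+ l.+1) <= l.+1%:R * k ^+ l * cabs (a - b).
Proof.
move=> ak bk; have k0 : 0 <= k by apply: le_trans ak; exact: cabs_ge0.
rewrite subrXX cabsM mulrC ler_wpM2r ?cabs_ge0 //.
apply: (le_trans (cabs_sum _ _ _)).
apply: (@le_trans _ _ (\sum_(i < l.+1) k ^+ l)); last first.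
  by rewrite sumr_const card_ord -[leLHS]mulr_natl.
apply: ler_sum => i _; have il : (i <= l)%N by rewrite -ltnS.
have -> : k ^+ l = k ^+ (l - i) * k ^+ i by rewrite -exprD subnK.
rewrite cabsM !cabsX.
by rewrite ler_pM ?exprn_ge0 ?cabs_ge0 // lerXn2r ?nnegrE ?cabs_ge0.
Qed.

Lemma cabs_phi N w : cabs w = 1 -> cabs (phi N w) = cabs (psi N w) ^+ h.
Proof.
by move=> w1; rewrite /phi_fun cabsM cabs_conj !cabsX w1 expr1n mulr1.
Qed.

Lemma phi_pow N w l : phi N w ^+ l = psi N w ^+ (h * l) * (w^*)%C ^+ (h * l).
Proof. by rewrite /phi_fun rmorphXn exprMn -!exprM. Qed.

(** The powers of [phi] inherit from [phi_fun_conj] that they are almost real. *)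
Lemma phi_pow_conj N l w (e K K0 : R) : (N0 <= N)%N -> cabs w = 1 ->
  cabs (phi N w - (phi N w)^*%C) <=
    e * cabs (w ^+ h - 1) ^+ 2 + K * cabs (w ^+ h - 1) ^+ 3 + K0 * delta N ->
  cabs (phi N w ^+ l.+1 - ((phi N w)^*)%C ^+ l.+1) <=
  l.+1%:R * (e * ker 2 (h * l) w + K * ker 3 (h * l) w + K0 * delta N * ker 0 (h * l) w).
Proof.
move=> NN w1 H.
have a1 : cabs (phi N w) <= cabs (psi N w) ^+ h by rewrite cabs_phi.
have b1 : cabs ((phi N w)^*)%C <= cabs (psi N w) ^+ h by rewrite cabs_conj cabs_phi.
apply: (le_trans (cabs_pow_sub l a1 b1)); rewrite -exprM -mulrA ler_wpM2l //.
apply: (@le_trans _ _ (ker 0 (h * l) w * (e * cabs (w ^+ h - 1) ^+ 2 + K * cabs (w ^+ h - 1) ^+ 3 + K0 * delta N))).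
  by apply: ler_pM => //; rewrite ?exprn_ge0 ?cabs_ge0 ?psi_ker.
rewrite -[2%N]/(2 + 0)%N -[3%N]/(3 + 0)%N -!ker_mulx le_eqVlt; apply/orP; left; apply/eqP; ring.
Qed.

Definition shift_const : R := locked (D * h.+1%:R).
Local Notation E := shift_const.

Lemma E_ge1 : 1 <= E.
Proof. by rewrite /shift_const -lock mulr_ege1 ?kernel_const_ge1 // ler1n. Qed.

Lemma avg_ker_shift M z l j : (j <= 4)%N ->
  (0 < M)%N -> M.-primitive_root z -> (2 * h * (h * l.+1) < M)%N ->
  root_ravg M z (ker j (h * l)) <= (E * rate R (h * l.+1)) ^+ j.+1.
Proof.
move=> j4 M0 zP lM; apply: (@le_trans _ _ ((D * rate R (h * l)) ^+ j.+1)).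
  apply: avg_ker => //; apply: leq_ltn_trans lM.
  by rewrite !leq_mul2l leqnSn !orbT.
have D0 := kernel_const_gt0; have E0 : 0 < E by exact: lt_le_trans ltr01 E_ge1.
apply: lerXn2r; rewrite ?nnegrE ?mulr_ge0 ?(ltW (rate_gt0 _ _)) ?(ltW D0) ?(ltW E0) //.
rewrite /shift_const -lock -mulrA ler_wpM2l ?(ltW D0) //; apply: rate_scale => //; nia.
Qed.

(** The difference is the average of [phi ^ l.+1 * (psi - 1)], where
    [psi - 1 = x / h + O(x ^ 2)] and [x = w ^+ h - 1]. Bounding the term [x / h]
    by its modulus would only give [O(1 / m)]. Its average is real, so it equals
    its half-sum with the conjugate; there [x + x^* = - |x| ^ 2] gains one order,
    and [phi_pow_conj] bounds the rest by [o(1 / m)]. *)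
Lemma return_step e : 0 < e -> exists n0, forall l, (n0 <= l)%N ->
  `| conv_pow p (h * l.+1).+1 (h * l.+1) - ret (h * l.+1)%N | <=
  e * rate R (h * l.+1) ^+ 2.
Proof.
move=> e0; have E1 := E_ge1; have D1 := kernel_const_ge1 c0 c8.
have D0 := kernel_const_gt0.
have E0 : 0 < E by exact: lt_le_trans ltr01 E1.
have V0 := law_V_ge0 pP.
have h1R : 1 <= h%:R :> R by rewrite ler1n.
have [K0 K00 HK0] := phi_fun_conj pP h0 h_span.
have e'0 : 0 < e / (2 * E ^+ 4) by rewrite divr_gt0 // mulr_gt0 // exprn_gt0.
have [K K_0 HK] := HK0 _ e'0.
pose B := D ^+ 3 + K * E ^+ 5 + 2 * V * D ^+ 3.
have B0 : 0 <= B by rewrite /B !addr_ge0 ?mulr_ge0 ?exprn_ge0 ?(ltW D0) ?(ltW E0).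
have e2 : 0 < e / 2 by lra.
have [n0 Hn0] := rate_small B0 e2.
exists n0 => l nl; have Bl : B * rate R (h * l.+1) <= e / 2.
  by apply: Hn0; rewrite (leq_trans nl) // (leq_trans (leqnSn l)) // leq_pmull.
have lm0 : (l.+1 <= h * l.+1)%N by rewrite leq_pmull.
have hlm : (h * l <= h * l.+1)%N by rewrite leq_mul2l leqnSn orbT.
have mE : (h * l.+1 = h + h * l)%N by rewrite mulnS.
have AS := avg_ker_shift; move: Bl lm0 hlm mE; move Em : (h * l.+1)%N => m Bl lm0 hlm mE.
have r0 := rate_gt0 R m; have r1 := rate_le1 R m.
apply: (@deficit_limit _ _ (K0 * E ^+ 2 * m.+1%:R + 2 * D) (maxn N0 m)).
  by rewrite addr_ge0 ?mulr_ge0 ?exprn_ge0 ?(ltW D0) ?(ltW E0).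
move=> N; rewrite geq_max => /andP[NN mN].
pose M := (N * m.+1 + 2 * h * m + m + h).+1.
have [b1 b2 b3 b4 hM] := big_modulus (N := N) (a := (2 * h * m)%N) (b := h) hlm (erefl M).
have [_ c2 _ _ _] := big_modulus (N := N) (a := (2 * h * m)%N) (b := h) (leqnn m) (erefl M).
have [z zP] := @complex_prim_root R M (ltn0Sn _).
have z1 := prim_root_cabs (ltn0Sn _) zP.
have {}AS j : (j <= 4)%N -> root_ravg M z (ker j (h * l)) <= (E * rate R m) ^+ j.+1.
  by move=> j4; rewrite -Em; apply: AS => //; rewrite Em.
have AK j : (j <= 4)%N -> root_ravg M z (ker j m) <= (D * rate R m) ^+ j.+1.
  by move=> j4; apply: avg_ker.
have E2 := @conv_pow_avg N m.+1 m M z (ltn0Sn _) zP mN b1 b4.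
have E3 := @conv_pow_avg N m m M z (ltn0Sn _) zP mN c2 b4.
have E4 := @conv_pow_avg N m (h * l) M z (ltn0Sn _) zP (leq_trans hlm mN) c2 b3.
have d0 := law_deficit_ge0 pP N.
pose x (w : C) := w ^+ h - 1.
rewrite -cabs_real realcB -E2 -E3 -root_avgB.
have -> : root_avg M z (fun w => psi N w ^+ m.+1 * (w^*)%C ^+ m - psi N w ^+ m * (w^*)%C ^+ m)
  = h%:R^-1 * root_avg M z (fun w => phi N w ^+ l.+1 * x w) +
    root_avg M z (fun w => phi N w ^+ l.+1 * (psi N w - 1 - x w / h%:R)).
  rewrite -root_avgZ -root_avgD; apply: eq_root_avg => // w w1.
  by rewrite phi_pow Em exprS; field; rewrite pnatr_eq0 -lt0n.
apply: (le_trans (cabsD _ _)).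
(* The average [S] is real: [2 * S = S + S^*] brings in [x + x^*]. *)
have T1 : cabs (h%:R^-1 * root_avg M z (fun w => phi N w ^+ l.+1 * x w)) <=
   (D * rate R m) ^+ 3 + l.+1%:R * (e / (2 * E ^+ 4) * (E * rate R m) ^+ 4 +
     K * (E * rate R m) ^+ 5 + K0 * delta N * (E * rate R m) ^+ 2).
  rewrite cabsM -realc_nat -realcV cabs_real ger0_norm ?invr_ge0 //.
  set S := root_avg _ _ _.
  apply: (@le_trans _ _ (2 * cabs S)).
    rewrite ler_wpM2r ?cabs_ge0 // (@le_trans _ _ 1) //; last by lra.
    by rewrite invf_le1 // ltr0n.
  have SE : S = (conv_pow p m (h * l) - ret m)%:C%C.
    rewrite realcB -E4 -E3 -root_avgB; apply: eq_root_avg => // w w1.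
    rewrite phi_pow Em /x mulrBr mulr1; congr (_ - _).
    have ww : (w^*)%C ^+ h * w ^+ h = 1.
      by rewrite -exprMn mulrC unit_conj // expr1n.
    have cE : (w^*)%C ^+ m = (w^*)%C ^+ h * (w^*)%C ^+ (h * l) by rewrite mE exprD.
    transitivity (psi N w ^+ m * (w^*)%C ^+ (h * l) * ((w^*)%C ^+ h * w ^+ h)).
      by rewrite cE; ring.
    by rewrite ww mulr1.
  have SS : 2 * S = root_avg M z (fun w => phi N w ^+ l.+1 * (x w + (x w)^*%C) +
       (((phi N w)^*)%C ^+ l.+1 - phi N w ^+ l.+1) * (x w)^*%C).
    have Sc : S^*%C = S by rewrite SE; exact: conjc_real.
    transitivity (S + S^*%C); first by rewrite Sc; ring.
    rewrite -root_avg_conj -root_avgD; apply: eq_root_avg => // w w1.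
    by rewrite rmorphM rmorphXn; ring.
  have -> : 2 * cabs S = cabs (2 * S) by rewrite cabsM cabs_nat.
  rewrite SS.
  apply: (@le_trans _ _ (root_ravg M z (fun w => ker 2 m w +
    l.+1%:R * (e / (2 * E ^+ 4) * ker 3 (h * l) w + K * ker 4 (h * l) w +
       K0 * delta N * ker 1 (h * l) w)))).
    apply: cabs_root_avg => // w w1; apply: (le_trans (cabsD _ _)); apply: lerD.
      have v1 : cabs (w ^+ h) = 1 by rewrite cabsX w1 expr1n.
      have -> : x w + (x w)^*%C = - (cabs (x w) ^+ 2)%:C%C.
        rewrite /x (cabs_sub_sqr v1) rmorphB rmorph1; ring.
      rewrite cabsM cabsN cabs_real ger0_norm ?sqr_ge0 // cabsX cabs_phi // -exprM Em.
      by rewrite -[2%N]/(2 + 0)%N -ker_mulx mulrC ler_wpM2l ?exprn_ge0 ?cabs_ge0 ?psi_ker.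
    rewrite cabsM cabs_conj cabsC mulrC.
    have := @phi_pow_conj N l w _ _ _ NN w1 (HK N w w1).
    move=> H; have := ler_wpM2l (cabs_ge0 (x w)) H; move/le_trans; apply.
    have k1 j : ker j.+1 (h * l) w = cabs (x w) * ker j (h * l) w.
      by rewrite -[j.+1]/(1 + j)%N -ker_mulx expr1.
    by rewrite !k1 le_eqVlt; apply/orP; left; apply/eqP; ring.
  rewrite root_ravgD root_ravgZ 2!root_ravgD 3!root_ravgZ.
  apply: lerD; first exact: AK.
  rewrite ler_wpM2l //; apply: lerD; first apply: lerD.
  - by rewrite ler_wpM2l ?(ltW e'0) // AS.
  - by rewrite ler_wpM2l // AS.
  - by rewrite ler_wpM2l ?mulr_ge0 // AS.
have T2 : cabs (root_avg M z (fun w => phi N w ^+ l.+1 * (psi N w - 1 - x w / h%:R))) <=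
  V * (D * rate R m) ^+ 3 + 2 * delta N * (D * rate R m).
  apply: (@le_trans _ _ (root_ravg M z (fun w => V * ker 2 m w + 2 * delta N * ker 0 m w))).
    apply: cabs_root_avg => // w w1; rewrite cabsM cabsX cabs_phi // -exprM Em.
    apply: (@le_trans _ _ (ker 0 m w * (V * cabs (x w) ^+ 2 + 2 * delta N))).
      by apply: ler_pM; rewrite ?exprn_ge0 ?cabs_ge0 ?psi_ker //; exact: char_fun_taylor2.
    rewrite -[2%N]/(2 + 0)%N -ker_mulx /x le_eqVlt.
    by apply/orP; left; apply/eqP; rewrite addn0; ring.
  rewrite root_ravgD 2!root_ravgZ; apply: lerD; rewrite ler_wpM2l ?mulr_ge0 //.
    exact: AK.
  by rewrite -[leRHS]expr1; exact: AK.
have lm : l.+1%:R <= m.+1%:R :> R by rewrite ler_nat (leq_trans lm0).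
have r2 : m.+1%:R * rate R m ^+ 2 = 1 by rewrite rate_sqr divff // pnatr_eq0.
have X1 : l.+1%:R * (e / (2 * E ^+ 4) * (E * rate R m) ^+ 4 +
     K * (E * rate R m) ^+ 5 + K0 * delta N * (E * rate R m) ^+ 2) <=
   m.+1%:R * (e / (2 * E ^+ 4) * (E * rate R m) ^+ 4 +
     K * (E * rate R m) ^+ 5 + K0 * delta N * (E * rate R m) ^+ 2).
  have Er : 0 <= E * rate R m by rewrite mulr_ge0 ?(ltW E0) ?(ltW r0).
  rewrite ler_wpM2r //; apply: addr_ge0; [apply: addr_ge0|].
  - by apply: mulr_ge0; [exact: ltW|exact: exprn_ge0].
  - by apply: mulr_ge0 => //; exact: exprn_ge0.
  - by apply: mulr_ge0; [exact: mulr_ge0|exact: exprn_ge0].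
have X2 : m.+1%:R * (e / (2 * E ^+ 4) * (E * rate R m) ^+ 4 +
     K * (E * rate R m) ^+ 5 + K0 * delta N * (E * rate R m) ^+ 2) =
   e / 2 * rate R m ^+ 2 + K * E ^+ 5 * rate R m ^+ 3 + K0 * E ^+ 2 * delta N.
  transitivity ((m.+1%:R * rate R m ^+ 2) * (e / 2 * rate R m ^+ 2 +
     K * E ^+ 5 * rate R m ^+ 3 + K0 * E ^+ 2 * delta N)); last by rewrite r2 mul1r.
  by field; rewrite gt_eqF.
have X3 : K0 * E ^+ 2 * delta N <= K0 * E ^+ 2 * m.+1%:R * delta N.
  rewrite ler_wpM2r // ler_peMr ?mulr_ge0 ?exprn_ge0 ?(ltW E0) //.
  by rewrite ler1n.
have X4 : 2 * delta N * (D * rate R m) <= 2 * D * delta N.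
  by rewrite -mulrA -[leRHS]mulrA ler_wpM2l // [leRHS]mulrC ler_wpM2l // ler_piMr // ltW.
have X5 : 0 <= V * (D * rate R m) ^+ 3 by rewrite mulr_ge0 ?exprn_ge0 ?mulr_ge0 ?(ltW D0) ?(ltW r0).
have X6 : (B * rate R m) * rate R m ^+ 2 <= e / 2 * rate R m ^+ 2 by rewrite ler_wpM2r ?sqr_ge0.
rewrite /B in X6.
have Y3 : (D * rate R m) ^+ 3 = D ^+ 3 * rate R m * rate R m ^+ 2 by ring.
have Y5 : K * E ^+ 5 * rate R m ^+ 3 = K * E ^+ 5 * rate R m * rate R m ^+ 2 by ring.
rewrite X2 Y5 in X1; rewrite Y3 in T1 T2 X5.
lra.
Qed.

Variable v0 : nat.
Hypothesis Vv0 : V <= v0%:R.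

(** Since [phi] is almost real, the return probability at time [2 * m] is close
    to the average of [|psi| ^ (2 * m)], which [parseval_lower] bounds below. *)
Lemma return_lower_even : exists2 b, 0 < b & exists n0, forall l, (n0 <= l)%N ->
  b * rate R (h * l.+1) <= ret (h * l.+1 + h * l.+1)%N.
Proof.
have E1 := E_ge1; have E0 : 0 < E by exact: lt_le_trans ltr01 E1.
pose b : R := (64 * v0.+1%:R)^-1.
have b0 : 0 < b by rewrite invr_gt0 mulr_gt0.
have [K0 K00 HK0] := phi_fun_conj pP h0 h_span.
have e'0 : 0 < b / E ^+ 3 by rewrite divr_gt0 // exprn_gt0.
have [K K_0 HK] := HK0 _ e'0.
exists (b / 2); first by lra.
have b2 : 0 < b / 2 by lra.
have KE : 0 <= K * E ^+ 4 by rewrite mulr_ge0 ?exprn_ge0 // ltW.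
have [n0 Hn0] := rate_small KE b2.
exists n0 => l nl; have AS := avg_ker_shift.
have hl : (h * l <= h * l.+1)%N by rewrite leq_mul2l leqnSn orbT.
have lm : (l.+1 <= h * l.+1)%N by rewrite leq_pmull.
have Bl : K * E ^+ 4 * rate R (h * l.+1) <= b / 2.
  by apply: Hn0; rewrite (leq_trans nl) // (leq_trans (leqnSn l)).
move: AS hl lm Bl; move Em : (h * l.+1)%N => m AS hl lm Bl.
have [k Ek] : exists k, m = k.+1 by case: m lm {Em AS hl Bl} => // k _; exists k.
have r0 := rate_gt0 R m; have r1 := rate_le1 R m.
pose t : R := 8 * m%:R ^+ 3 + 1.
have t0 : 1 <= t by rewrite /t lerDr mulr_ge0 // exprn_ge0.
have ti0 : 0 < t^-1 by rewrite invr_gt0; lra.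
have [N2 HN2] := law_deficit_lim pP ti0.
apply: (@deficit_limit _ _ (K0 * E * m.+1%:R) (maxn N2 (maxn N0 (m + m)))).
  by rewrite !mulr_ge0 // ltW.
move=> N; rewrite !geq_max => /andP[/HN2 Nd /andP[NN mN]].
have d0 := law_deficit_ge0 pP N.
have td : t * delta N <= 1.
  by apply: (le_trans (ler_wpM2l _ Nd)); [lra|rewrite divff // gt_eqF; lra].
have m3 : 0 <= m%:R ^+ 3 * delta N by rewrite mulr_ge0 // exprn_ge0.
have dd1 : delta N <= 1 by rewrite /t in td; lra.
have PL := parseval_lower pP Vv0 (k := k) dd1; rewrite -Ek in PL.
have {}PL := PL ltac:(rewrite /t in td; lra).
pose M := (N * (m + m) + 2 * h * m + (m + m) + N * m).+1.
have [M1 M2 M3 M4] : [/\ (N * (m + m) < M)%N, (2 * h * m < M)%N, (m + m < M)%N & (N * m < M)%N].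
  exact: four_summands_lt.
have [z zP] := @complex_prim_root R M (ltn0Sn _).
have z1 := prim_root_cabs (ltn0Sn _) zP.
have {}AS j : (j <= 4)%N -> root_ravg M z (ker j (h * l)) <= (E * rate R m) ^+ j.+1.
  by move=> j4; rewrite -Em; apply: AS => //; rewrite Em.
have E2 := @conv_pow_avg N (m + m) (m + m) M z (ltn0Sn _) zP mN M1 M3.
have PS := @parseval R p N m M z (ltn0Sn _) zP M4.
have dif : `| ret (m + m)%N - root_ravg M z (fun w => cabs (psi N w ^+ m) ^+ 2) | <=
  l.+1%:R * (b / E ^+ 3 * (E * rate R m) ^+ 3 + K * (E * rate R m) ^+ 4 +
    K0 * delta N * (E * rate R m) ^+ 1).
  rewrite -cabs_real realcB -E2 realc_ravg -root_avgB.
  apply: (@le_trans _ _ (root_ravg M z (fun w => l.+1%:R * (b / E ^+ 3 * ker 2 (h * l) w +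
     K * ker 3 (h * l) w + K0 * delta N * ker 0 (h * l) w)))).
    apply: cabs_root_avg => // w w1.
    have -> : psi N w ^+ (m + m) * (w^*)%C ^+ (m + m) - (cabs (psi N w ^+ m) ^+ 2)%:C%C =
       phi N w ^+ l.+1 * (phi N w ^+ l.+1 - ((phi N w)^*)%C ^+ l.+1).
      have pc : ((phi N w)^*)%C ^+ l.+1 = ((psi N w ^+ m)^*)%C * w ^+ m.
        rewrite -rmorphXn phi_pow Em rmorphM; congr (_ * _); rewrite rmorphXn.
        by congr (_ ^+ _); exact: conjcK.
      have ww : (w^*)%C ^+ m * w ^+ m = 1 by rewrite -exprMn mulrC unit_conj // expr1n.
      rewrite mulrBr pc phi_pow Em cabs_sqr 2!exprD.
      transitivity (psi N w ^+ m * (w^*)%C ^+ m * (psi N w ^+ m * (w^*)%C ^+ m) -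
        psi N w ^+ m * ((psi N w ^+ m)^*)%C * ((w^*)%C ^+ m * w ^+ m)); last by ring.
      by rewrite ww; ring.
    rewrite cabsM; have H := @phi_pow_conj N l w _ _ _ NN w1 (HK N w w1).
    apply: le_trans H; rewrite ler_piMl ?cabs_ge0 // cabsX cabs_phi // -exprM.
    by rewrite exprn_ile1 ?cabs_ge0 // (char_fun_le1 pP).
  rewrite root_ravgZ 2!root_ravgD 3!root_ravgZ ler_wpM2l //.
  apply: lerD; first apply: lerD.
  - by rewrite ler_wpM2l ?(ltW e'0) // AS.
  - by rewrite ler_wpM2l // AS.
  - by rewrite ler_wpM2l ?mulr_ge0 // AS.
rewrite PS in dif.
have lm1 : l.+1%:R <= m.+1%:R :> R by rewrite ler_nat (leq_trans lm).
have r2 : m.+1%:R * rate R m ^+ 2 = 1 by rewrite rate_sqr divff // pnatr_eq0.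
set Q := b / E ^+ 3 * _ + _ + _ in dif.
have Q0 : 0 <= Q.
  have Er : 0 <= E * rate R m by rewrite mulr_ge0 ?(ltW E0) ?(ltW r0).
  apply: addr_ge0; [apply: addr_ge0|].
  - by apply: mulr_ge0; [exact: ltW|exact: exprn_ge0].
  - by apply: mulr_ge0 => //; exact: exprn_ge0.
  - by apply: mulr_ge0; [exact: mulr_ge0|exact: exprn_ge0].
have X1 : l.+1%:R * Q <= m.+1%:R * Q by rewrite ler_wpM2r.
have X2 : m.+1%:R * Q = b * rate R m + K * E ^+ 4 * rate R m * rate R m + K0 * E * delta N * (m.+1%:R * rate R m).
  transitivity ((m.+1%:R * rate R m ^+ 2) * (b * rate R m + K * E ^+ 4 * rate R m * rate R m) + K0 * E * delta N * (m.+1%:R * rate R m)).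
    by rewrite /Q; field; rewrite gt_eqF.
  by rewrite r2 mul1r.
have X3 : K0 * E * delta N * (m.+1%:R * rate R m) <= K0 * E * m.+1%:R * delta N.
  have -> : K0 * E * m.+1%:R * delta N = K0 * E * delta N * (m.+1%:R * 1) by ring.
  have q0 : 0 <= K0 * E * delta N by rewrite mulr_ge0 // mulr_ge0 // ltW.
  by rewrite ler_wpM2l // ler_wpM2l.
have X4 : K * E ^+ 4 * rate R m * rate R m <= b / 2 * rate R m.
  by rewrite ler_wpM2r ?(ltW r0).
have bE : (32 * v0.+1%:R)^-1 = 2 * b.
  by rewrite /b; field; rewrite -[1 + _]/(1 + _) addrC natr1 pnatr_eq0.
rewrite bE in PL.
move: dif; rewrite ler_norml => /andP[dif _].
lra.
Qed.

(** Odd multiples of the span are reached from even ones by [return_shift], and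
    the last step of the walk is [return_step]. *)
Lemma return_lower : exists2 b, 0 < b & exists n0, forall l, (n0 <= l)%N ->
  b * rate R (h * l) <= conv_pow p (h * l).+1 (h * l).
Proof.
have [b b0 [n1 H1]] := return_lower_even.
have [B B0 H2] := return_shift.
have b4 : 0 < b / 4 by lra.
have [n3 H3] := return_step b4.
have [n4 H4] := rate_small B0 b4.
exists (b / 2); first by lra.
exists (2 * (n1 + n4 + 2) + n3.+1)%N => l nl.
have [i Ei [n1i n4i]] := halve_index (leq_trans (leq_addr _ _) nl).
have n3l : (n3.+1 <= l)%N := leq_trans (leq_addl _ _) nl.
have := H3 l.-1; rewrite prednK ?(leq_trans _ n3l) // -ltnS prednK ?(leq_trans _ n3l) // => /(_ isT) {}H3.
have r0 := rate_gt0 R (h * l); have r1 := rate_le1 R (h * l).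
have rr : rate R (h * l) ^+ 2 <= rate R (h * l) by rewrite expr2 ler_piMl // ltW.
suff A : 3 / 4 * b * rate R (h * l) <= ret (h * l)%N.
  have : b / 4 * rate R (h * l) ^+ 2 <= b / 4 * rate R (h * l) by rewrite ler_wpM2l // ltW.
  move: H3; rewrite ler_norml => /andP[? _]; lra.
have K1 := H1 i n1i.
have hi : (h * i.+1 + h * i.+1 = h * i.+1.*2)%N by rewrite -mulnDr addnn.
rewrite hi in K1.
have K2 : b * rate R (h * i.+1.*2) <= ret (h * i.+1.*2)%N.
  apply: le_trans K1; rewrite ler_wpM2l ?(ltW b0) // rate_le // leq_mul2l -addnn leq_addr orbT //.
have s0 := rate_gt0 R (h * i.+1.*2); have s1 := rate_le1 R (h * i.+1.*2).
move: Ei; case: (odd l) => Ei; last first.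
  by rewrite Ei /= add0n; nra.
have le : (h * l = h * i.+1.*2 + h)%N by rewrite Ei /= add1n mulnSr.
have := H2 (h * i.+1.*2)%N; rewrite -le ler_norml => /andP[_ K3].
have K4 : B * rate R (h * i.+1.*2) <= b / 4.
  apply: H4; apply: (@leq_trans i.+1.*2); first by rewrite -addnn (leq_trans n4i) // (leq_trans (leqnSn i)) // leq_addr.
  by rewrite leq_pmull.
have K5 : rate R (h * l) <= rate R (h * i.+1.*2) by rewrite rate_le // le leq_addr.
set s := rate R (h * i.+1.*2) in K2 K3 K4 K5 s0 s1 *.
have K6 : B * s ^+ 3 <= b / 4 * s.
  have -> : B * s ^+ 3 = (B * s) * s ^+ 2 by ring.
  have ss : s ^+ 2 <= s by rewrite expr2 ler_piMl // ltW.
  apply: (@le_trans _ _ (b / 4 * s ^+ 2)); first by rewrite ler_wpM2r ?sqr_ge0.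
  by rewrite ler_wpM2l // ltW.
have : 3 / 4 * b * rate R (h * l) <= 3 / 4 * b * s by rewrite ler_wpM2l //; lra.
lra.
Qed.

End local_estimates.

(** The form of the local limit theorem used below, with [h] the span of the law:
    the return probabilities vanish off the multiples of [h]. *)
Theorem local_limit_estimates (R : archiRcfType) (p : nat -> R) (V : R) (v0 : nat) :
  critical_law p V -> V <= v0%:R -> exists h : nat, [/\ (0 < h)%N,
    forall a, 0 < p a -> (h %| a)%N &
    exists B b : R, [/\ 0 < B, 0 < b, forall n j, conv_pow p n j <= B * rate R n,
      forall m, `| conv_pow p m m - conv_pow p (m + h) (m + h) | <= B * rate R m ^+ 3 &
     (forall e, 0 < e -> exists n0, forall l, (n0 <= l)%N ->
      `| conv_pow p (h * l).+1 (h * l) - conv_pow p (h * l) (h * l) | <=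
          e * rate R (h * l) ^+ 2) /\
     exists n0, forall l, (n0 <= l)%N ->
       b * rate R (h * l) <= conv_pow p (h * l).+1 (h * l)]].
Proof.
move=> pP Vv0; have [h [h0 hs [c [N0 [c0 [c8 dec]]]]]] := exists_span pP.
exists h; split => //.
have [B B0 H2] := return_shift pP h0 hs c0 c8 dec.
have [b b0 H4] := return_lower pP h0 hs c0 c8 dec Vv0.
have H1 := conv_pow_le pP h0 c0 c8 dec.
have D0 := kernel_const_gt0 c0 c8.
exists (B + kernel_const c), b; split => //; first by lra.
- move=> n j; apply: (le_trans (H1 n j)); rewrite ler_wpM2r ?(ltW (rate_gt0 _ _)) //; lra.
- move=> m; apply: (le_trans (H2 m)); rewrite ler_wpM2r ?exprn_ge0 ?(ltW (rate_gt0 _ _)) //; lra.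
split; last exact: H4.
move=> e e0; have [n0 Hn] := return_step pP h0 hs c0 c8 dec e0.
by exists n0.+1 => -[//|l] nl; exact: Hn.
Qed.

(** * The mean of an additive functional under conditioning on the size *)

Lemma conv_pow_dvd (R : realFieldType) (p : nat -> R) h n j :
  (forall a, p a != 0 -> (h %| a)%N) -> conv_pow p n j != 0 -> (h %| j)%N.
Proof.
move=> hp; elim: n j => [|n IH] j.
  by rewrite /conv_pow; case: (j =P 0%N) => [->|_]; rewrite ?dvdn0 // eqxx.
rewrite conv_powS => sn0.
have [/existsP[i pi]|] := boolP [exists i : 'I_j.+1, p i * conv_pow p n (j - i)%N != 0]; last first.
  rewrite negb_exists => /forallP H; case/negP: sn0; apply/eqP.
  by apply: big1 => i _; apply/eqP; rewrite -[_ == _]negbK H.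
move: pi; rewrite mulf_eq0 negb_or => /andP[/hp hi /IH hji].
by rewrite -(subnK (_ : (i <= j)%N)) ?dvdn_add // -ltnS.
Qed.

Lemma double_succ_bound x y : (x <= 2 * y)%N -> (x.+2 <= 2 * y.+2)%N.
Proof. by lia. Qed.

Lemma sum_rate (R : rcfType) n : \sum_(k < n) rate R k <= 2 * Num.sqrt n%:R.
Proof.
elim: n => [|n IH]; first by rewrite big_ord0 mulr_ge0 // sqrtr_ge0.
rewrite big_ord_recr /=; apply: (le_trans (lerD IH (lexx _))).
set a := Num.sqrt n%:R; set s := Num.sqrt n.+1%:R.
have a0 : 0 <= a by rewrite sqrtr_ge0.
have s0 : 0 < s by rewrite sqrtr_gt0 ltr0n.
have aa : a ^+ 2 = n%:R by rewrite sqr_sqrtr.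
have ss : s ^+ 2 = n%:R + 1 by rewrite sqr_sqrtr // natr1.
rewrite /rate -/s -(ler_pM2r s0) mulrDl mulVf ?gt_eqF //.
have := sqr_ge0 (s - a); lra.
Qed.

Section total_progeny.
Variables (R : archiRcfType) (p : nat -> R) (V : R) (v0 : nat).
Hypotheses (pP : critical_law p V) (Vv0 : V <= v0%:R).
Local Notation A m := (conv_pow p m m).
Local Notation q k := (forest_wt p k 1).
Hypothesis q_sum : forall N, \sum_(k < N) q k <= 1.

Let p0 := law_ge0 pP.

Lemma q_ge0 k : 0 <= q k. Proof. exact: forest_wt_ge0. Qed.
Hint Resolve q_ge0 : core.

Lemma q_conv n : n.+1%:R * q n.+1 = conv_pow p n.+1 n.
Proof. by rewrite forest_wtE // mul1r subn1. Qed.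

(** A tree with [n] nodes has [n] nodes to mark: this is the case of a constant
    functional. *)
Lemma q_renewal n : n.+1%:R * q n.+1 = \sum_(k < n.+2) q k * A (n.+1 - k)%N.
Proof. by rewrite q_conv -(@first_passage R p n.+1 1) // subn1. Qed.

Section with_span.
Variables (h : nat) (B b : R).
Hypotheses (h0 : (0 < h)%N) (hs : forall a, 0 < p a -> (h %| a)%N).
Hypotheses (B0 : 0 < B) (b0 : 0 < b).
Hypothesis cpB : forall n j, conv_pow p n j <= B * rate R n.
Hypothesis shiftB : forall m, `| A m - A (m + h)%N | <= B * rate R m ^+ 3.
Hypothesis stepe : forall e, 0 < e -> exists n0, forall l, (n0 <= l)%N ->
      `| conv_pow p (h * l).+1 (h * l) - A (h * l)%N | <= e * rate R (h * l) ^+ 2.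
Hypothesis lowb : exists n0, forall l, (n0 <= l)%N ->
       b * rate R (h * l) <= conv_pow p (h * l).+1 (h * l).

Lemma q_span n : q n.+1 != 0 -> (h %| n)%N.
Proof.
move=> qn; apply: (@conv_pow_dvd R p h n.+1).
  by move=> a pa; apply: hs; rewrite lt_def pa p0.
by rewrite -q_conv mulf_neq0 // pnatr_eq0.
Qed.

Lemma q_le k : q k <= 2 * B * rate R k ^+ 3.
Proof.
have r0 := rate_gt0 R k.
case: k r0 => [|k] r0; first by rewrite mulr_ge0 ?exprn_ge0 ?mulr_ge0 // ltW.
rewrite -(ler_pM2l (_ : 0 < k.+1%:R)) ?ltr0n // q_conv.
apply: (le_trans (cpB _ _)).
have -> : k.+1%:R * (2 * B * rate R k.+1 ^+ 3) = (2 * k.+1%:R * rate R k.+1 ^+ 2) * (B * rate R k.+1).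
  by ring.
rewrite ler_peMl ?mulr_ge0 ?(ltW B0) ?(ltW r0) // rate_sqr ler_pdivlMr ?ltr0n // mul1r.
by rewrite -natrM ler_nat; lia.
Qed.

Lemma A_telescope l k : (2 * k <= l)%N ->
  `| A (h * (l - k))%N - A (h * l)%N | <= 8 * B * k%:R * rate R (h * l).+1 ^+ 3.
Proof.
move=> kl; set rn := rate R (h * l).+1; have rn0 : 0 < rn := rate_gt0 _ _.
suff H j : (j <= k)%N -> `| A (h * (l - j))%N - A (h * l)%N | <= 8 * B * j%:R * rn ^+ 3.
  exact: H.
elim: j => [|j IH] jk; first by rewrite subn0 subrr normr0 mulr0 mul0r.
have E : (h * (l - j.+1) + h = h * (l - j))%N.
  by rewrite -mulnSr; congr (_ * _)%N; lia.
have := shiftB (h * (l - j.+1))%N; rewrite E => S.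
apply: (le_trans (ler_distD (A (h * (l - j))%N) _ _)).
have -> : 8 * B * j.+1%:R * rn ^+ 3 = 8 * B * rn ^+ 3 + 8 * B * j%:R * rn ^+ 3.
  by rewrite -(natr1 j); ring.
apply: lerD; last by apply: IH; exact: ltnW.
apply: (le_trans S).
have rr : rate R (h * (l - j.+1)) <= 2%:R * rn.
  apply: rate_scale => //; have : (h * l <= h * (2 * (l - j.+1)))%N by rewrite leq_mul2l; apply/orP; right; lia.
  by rewrite mulnCA; move: (h * l)%N (h * _)%N => x y; lia.
have : rate R (h * (l - j.+1)) ^+ 3 <= (2%:R * rn) ^+ 3.
  by apply: lerXn2r; rewrite ?nnegrE ?mulr_ge0 ?(ltW rn0) ?(ltW (rate_gt0 _ _)).
move=> H; have := ler_wpM2l (ltW B0) H; rewrite exprMn.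
have -> : (2%:R : R) ^+ 3 = 8 by rewrite -natrX.
lra.
Qed.

Lemma rate_pred m : rate R m <= 2 * rate R m.+1.
Proof. by rewrite -[2]/(2%:R); apply: rate_scale => //; lia. Qed.

Lemma renewal_gap_small e : 0 < e -> exists n0, forall l, (n0 <= l)%N -> forall k,
  (2 * k <= l)%N ->
  `| A (h * (l - k))%N - (h * l).+1%:R * q (h * l).+1 | <=
    8 * B * k%:R * rate R (h * l).+1 ^+ 3 + e * rate R (h * l).+1 ^+ 2.
Proof.
move=> e0; have e4 : 0 < e / 4 by lra.
have [n0 Hn0] := stepe e4; exists n0 => l nl k kl.
rewrite q_conv; apply: (le_trans (ler_distD (A (h * l)%N) _ _)).
apply: lerD; first exact: A_telescope.
rewrite distrC; apply: (le_trans (Hn0 l nl)).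
have rr := rate_pred (h * l).
have r0 := rate_gt0 R (h * l); have r1 := rate_gt0 R (h * l).+1.
have : rate R (h * l) ^+ 2 <= (2 * rate R (h * l).+1) ^+ 2.
  by apply: lerXn2r; rewrite ?nnegrE ?mulr_ge0 ?(ltW r0) ?(ltW r1).
rewrite exprMn => H; have := ler_wpM2l (ltW e4) H; lra.
Qed.

(** The cost of replacing every [A (n - k)] by [n * q n] in the mean of a bounded
    functional. *)
Definition renewal_gap n : R := \sum_(k < n.+1) q k * `| A (n - k)%N - n%:R * q n |.

(** For small [k] the difference is [O(k * n ^ (- 3 / 2))] by [A_telescope],
    against [q k = O(k ^ (- 3 / 2))]. For large [k] the factor [q k] is itself
    [O(n ^ (- 3 / 2))]. Either half adds up to [O(1 / n)]. *)
Lemma renewal_gap_le : exists2 K, 0 < K & exists n0, forall l, (n0 <= l)%N ->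
  renewal_gap (h * l).+1 <= K * rate R (h * l).+1 ^+ 2.
Proof.
have [n0 Hn0] := renewal_gap_small ltr01.
exists (1 + 80 * B ^+ 2).
  by have : 0 < B ^+ 2 by [rewrite exprn_gt0]; lra.
exists n0 => l /Hn0 Hl; set n := (h * l).+1 in Hl *.
set r := rate R n in Hl *; have r0 : 0 < r := rate_gt0 _ _.
have B2 : 0 < B ^+ 2 by rewrite exprn_gt0.
have r3 : 0 < r ^+ 3 by rewrite exprn_gt0.
have c16 : 0 <= 16 * B ^+ 2 by rewrite mulr_ge0 // ltW.
have sn : Num.sqrt n.+1%:R = r^-1 by rewrite /r /rate invrK.
have nr2 : n.+1%:R * r ^+ 2 = 1 by rewrite /r rate_sqr divff // pnatr_eq0.
(* [t1] bounds the terms with [k] below about [n / 2], [t2] the others *)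
pose t1 k := 16 * B ^+ 2 * rate R k * r ^+ 3 + q k * r ^+ 2.
pose t2 k := 16 * B ^+ 2 * r ^+ 3 * (rate R (n - k) + r).
apply: (@le_trans _ _ (\sum_(k < n.+1) (t1 k + t2 k))).
  apply: ler_sum => k _.
  have t10 : 0 <= t1 k.
    exact: addr_ge0 (mulr_ge0 (mulr_ge0 c16 (ltW (rate_gt0 _ _))) (ltW r3)) (mulr_ge0 (q_ge0 _) (sqr_ge0 _)).
  have t20 : 0 <= t2 k.
    exact: mulr_ge0 (mulr_ge0 c16 (ltW r3)) (addr_ge0 (ltW (rate_gt0 _ _)) (ltW r0)).
  have [qk|qk] := eqVneq (q k) 0; first by rewrite qk mul0r addr_ge0.
  have kn : (k <= n)%N by rewrite -ltnS.
  case: (nat_of_ord k) qk kn t10 t20 => [|j] qk kn t10 t20; first by rewrite /= eqxx in qk.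
  have /dvdnP[i Ei] := q_span qk; rewrite mulnC in Ei.
  have rk := rate_gt0 R j.+1.
  have [il|il] := leqP (2 * i)%N l.
    apply: (@le_trans _ _ (t1 j.+1)); last by rewrite lerDl.
    have nk : (n - j.+1 = h * (l - i))%N by rewrite /n Ei subSS mulnBr.
    rewrite nk; have := Hl i il; rewrite mul1r => H.
    apply: (@le_trans _ _ (q j.+1 * (8 * B * i%:R * r ^+ 3 + r ^+ 2))); first by rewrite ler_wpM2l.
    rewrite /t1 mulrDr lerD2r.
    have ij : i%:R <= j.+2%:R :> R by rewrite ler_nat Ei; apply: leq_trans (leq_pmull _ h0) _; rewrite ltnW // ltnW.
    apply: (@le_trans _ _ (2 * B * rate R j.+1 ^+ 3 * (8 * B * j.+2%:R * r ^+ 3))).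
      apply: ler_pM; [by []| |exact: q_le|].
        by apply: mulr_ge0 (ltW r3); rewrite mulr_ge0 // mulr_ge0 // ltW.
      by rewrite ler_wpM2r ?(ltW r3) // ler_wpM2l // mulr_ge0 // ltW.
    have -> : 2 * B * rate R j.+1 ^+ 3 * (8 * B * j.+2%:R * r ^+ 3) =
      16 * B ^+ 2 * (j.+2%:R * rate R j.+1 ^+ 2) * rate R j.+1 * r ^+ 3 by ring.
    by rewrite rate_sqr divff ?mulr1 // pnatr_eq0.
  apply: (@le_trans _ _ (t2 j.+1)); last by rewrite lerDr.
  have qr : q j.+1 <= 16 * B * r ^+ 3.
    apply: (le_trans (q_le _)).
    have : rate R j.+1 <= 2%:R * r.
      apply: rate_scale => //; rewrite /n Ei; have : (h * l <= h * (2 * i))%N by rewrite leq_mul2l (ltnW il) orbT.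
      by rewrite mulnCA; exact: double_succ_bound.
    move=> rr; have : rate R j.+1 ^+ 3 <= (2%:R * r) ^+ 3.
      by apply: lerXn2r; rewrite ?nnegrE ?mulr_ge0 ?(ltW rk) ?(ltW r0).
    rewrite exprMn; have -> : (2%:R : R) ^+ 3 = 8 by rewrite -natrX.
    move=> H; have := ler_wpM2l (ltW B0) H; lra.
  apply: (@le_trans _ _ (16 * B * r ^+ 3 * (B * rate R (n - j.+1) + B * r))).
    apply: ler_pM => //; apply: (le_trans (ler_normB _ _)); apply: lerD.
      by rewrite ger0_norm ?conv_pow_ge0.
    by rewrite ger0_norm ?mulr_ge0 // /n q_conv.
  by rewrite /t2 le_eqVlt; apply/orP; left; apply/eqP; ring.
rewrite big_split /= /t1 /t2 big_split /= -!mulr_suml -!mulr_sumr big_split /=.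
have s1 : \sum_(i < n.+1) rate R i <= 2 * r^-1.
  by rewrite -sn; exact: sum_rate.
have s2 : \sum_(i < n.+1) rate R (n - i) <= 2 * r^-1.
  apply: le_trans s1; rewrite le_eqVlt; apply/orP; left; apply/eqP.
  rewrite (reindex_inj rev_ord_inj) /=; apply: eq_bigr => i _.
  by rewrite subSS subKn // -ltnS.
rewrite sumr_const card_ord -[r *+ _]mulr_natl.
have rn : n.+1%:R * r = r^-1.
  by apply: (mulIf (_ : r != 0)); rewrite ?gt_eqF // mulVf ?gt_eqF // -mulrA -expr2.
rewrite rn.
have c0 : 0 <= 16 * B ^+ 2 by rewrite mulr_ge0 // ltW.
have c3 : 0 <= 16 * B ^+ 2 * r ^+ 3 by rewrite mulr_ge0 // ltW.
have X1 := ler_wpM2l c3 s1.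
have X2 := ler_wpM2l c3 s2.
have X3 : (\sum_(i < n.+1) q i) * r ^+ 2 <= r ^+ 2.
  by rewrite ler_piMl ?sqr_ge0.
have X4 : 16 * B ^+ 2 * r ^+ 3 * r^-1 = 16 * B ^+ 2 * r ^+ 2 by field; rewrite gt_eqF.
have X5 : 16 * B ^+ 2 * r ^+ 3 * (2 * r^-1) = 32 * B ^+ 2 * r ^+ 2 by field; rewrite gt_eqF.
rewrite X5 in X1 X2; rewrite mulrDr X4 [16 * B ^+ 2 * _ * _]mulrAC.
lra.
Qed.

Lemma q_lower : exists n0, forall l, (n0 <= l)%N ->
  b * rate R (h * l).+1 <= (h * l).+1%:R * q (h * l).+1.
Proof.
have [n0 H] := lowb; exists n0 => l /H; rewrite q_conv; apply: le_trans.
by rewrite ler_wpM2l ?(ltW b0) // rate_le.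
Qed.

(** Subtracting [n * q n] times the sum of the [q k] from [q_renewal] leaves the
    renewal gap. Hence the critical tree is almost surely finite, with a rate. *)
Lemma q_tail : exists2 K, 0 < K & exists n0, forall l, (n0 <= l)%N ->
  1 - \sum_(k < (h * l).+2) q k <= K * rate R (h * l).+1.
Proof.
have [K K0 [m1 H1]] := renewal_gap_le; have [m2 H2] := q_lower.
exists (K / b); first by rewrite divr_gt0.
exists (maxn m1 m2) => l; rewrite geq_max => /andP[/H1 {}H1 /H2 {}H2].
set n := (h * l).+1 in H1 H2 *; set r := rate R n in H1 H2 *.
have r0 : 0 < r := rate_gt0 _ _.
have nq0 : 0 < n%:R * q n by apply: lt_le_trans H2; rewrite mulr_gt0.
set s := \sum_(k < n.+1) q k; have s1 : 0 <= 1 - s by rewrite subr_ge0 q_sum.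
have E : n%:R * q n * (1 - s) = \sum_(k < n.+1) q k * (A (n - k)%N - n%:R * q n).
  under eq_bigr do rewrite mulrBr.
  have QR : n%:R * q n = \sum_(k < n.+1) q k * A (n - k)%N := q_renewal (h * l).
  by rewrite sumrB -QR -mulr_suml -/s mulrBr mulr1 [s * _]mulrC.
have H3 : n%:R * q n * (1 - s) <= K * r ^+ 2.
  apply: le_trans H1; rewrite E; apply: ler_sum => k _.
  by rewrite ler_wpM2l // ler_norm.
have H4 : b * r * (1 - s) <= K * r ^+ 2 by apply: le_trans H3; rewrite ler_wpM2r.
rewrite -(ler_pM2l (mulr_gt0 b0 r0)); apply: (le_trans H4).
by rewrite le_eqVlt; apply/orP; left; apply/eqP; field; rewrite gt_eqF.
Qed.

(** Bounded [k] contribute [o(1 / n)] by [renewal_gap_small], and the others are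
    damped by the weight. *)
Lemma weighted_gap (w : nat -> R) : (forall k, 0 <= w k <= 1) ->
  (forall e, 0 < e -> exists K, forall k, (K <= k)%N -> w k <= e) ->
  forall e, 0 < e -> exists n0, forall l, (n0 <= l)%N ->
  \sum_(k < (h * l).+2) w k * (q k * `| A ((h * l).+1 - k)%N - (h * l).+1%:R * q (h * l).+1 |)
   <= e * rate R (h * l).+1 ^+ 2.
Proof.
move=> w01 wlim e e0; have [K K0 [m1 H1]] := renewal_gap_le.
have e3 : 0 < e / 3 by lra.
have [m2 H2] := renewal_gap_small e3.
have [N HN] := wlim (e / 3 / K) (divr_gt0 e3 K0).
have c0 : 0 <= 8 * B * N%:R by rewrite !mulr_ge0 // ltW.
have [m3 H3] := @rate_small R _ _ c0 e3.
exists (maxn (maxn m1 m2) (maxn m3 (2 * N))) => l; rewrite !geq_max.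
move=> /andP[/andP[/H1 {}H1 /H2 {}H2] /andP[m3l Nl]].
have {}H3 : 8 * B * N%:R * rate R (h * l).+1 <= e / 3.
  by apply: H3; rewrite (leq_trans m3l) // (leq_trans (leq_pmull _ h0)).
set n := (h * l).+1 in H1 H2 H3 *; set r := rate R n in H1 H2 H3 *.
have r0 : 0 < r := rate_gt0 _ _.
have er0 : 0 <= 2 * (e / 3) * r ^+ 2.
  by apply: mulr_ge0 (sqr_ge0 _); rewrite mulr_ge0 // (ltW e3).
apply: (@le_trans _ _ (\sum_(k < n.+1) (q k * (2 * (e / 3) * r ^+ 2) +
   e / 3 / K * (q k * `| A (n - k)%N - n%:R * q n |)))).
  apply: ler_sum => k _; have /andP[w0 w1] := w01 k.
  set g := `| _ |; have g0 : 0 <= g := normr_ge0 _.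
  have t10 : 0 <= q k * (2 * (e / 3) * r ^+ 2) := mulr_ge0 (q_ge0 _) er0.
  have t20 : 0 <= e / 3 / K * (q k * g).
    by rewrite mulr_ge0 //; [rewrite ltW // divr_gt0|rewrite mulr_ge0].
  have [Nk|kN] := leqP N k.
    apply: (@le_trans _ _ (e / 3 / K * (q k * g))); last by rewrite lerDr.
    by rewrite ler_wpM2r ?mulr_ge0 // HN.
  apply: (@le_trans _ _ (q k * (2 * (e / 3) * r ^+ 2))); last by rewrite lerDl.
  have [qk|qk] := eqVneq (q k) 0; first by rewrite qk !mul0r mulr0.
  apply: (@le_trans _ _ (q k * g)); first by rewrite ler_piMl // mulr_ge0.
  rewrite ler_wpM2l //; rewrite /g.
  case: (nat_of_ord k) qk kN {g g0 t10 t20 w0 w1} => [|j] qk kN; first by rewrite /= eqxx in qk.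
  have /dvdnP[i Ei] := q_span qk; rewrite mulnC in Ei.
  have iN : (i <= N)%N by rewrite (leq_trans (leq_pmull i h0)) // -Ei ltnW // ltnW.
  have il : (2 * i <= l)%N by rewrite (leq_trans _ Nl) // leq_mul2l iN.
  have nk : (n - j.+1 = h * (l - i))%N by rewrite /n Ei subSS mulnBr.
  rewrite nk; apply: (le_trans (H2 i il)).
  have : 8 * B * i%:R * r ^+ 3 <= e / 3 * r ^+ 2.
    apply: (@le_trans _ _ (8 * B * N%:R * r * r ^+ 2)); last by rewrite ler_wpM2r ?sqr_ge0.
    rewrite -[8 * B * N%:R * r * _]mulrA -exprS ler_wpM2r ?exprn_ge0 ?(ltW r0) //.
    by rewrite ler_wpM2l ?ler_nat // mulr_ge0 // ltW.
  lra.
rewrite big_split /= -mulr_suml -mulr_sumr -/(renewal_gap n).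
have X1 : (\sum_(i < n.+1) q i) * (2 * (e / 3) * r ^+ 2) <= 2 * (e / 3) * r ^+ 2.
  by rewrite ler_piMl.
have X2 : e / 3 / K * renewal_gap n <= e / 3 * r ^+ 2.
  apply: (@le_trans _ _ (e / 3 / K * (K * r ^+ 2))).
    by rewrite ler_wpM2l // ltW // divr_gt0.
  by rewrite mulrA divfK ?gt_eqF.
lra.
Qed.

End with_span.

(** Once [A (n - k)] is replaced by [n * q n], the sum divided by [q n] is [n]
    times a truncation of the mean of [f]. The replacement costs
    [o(1 / n) / q n = o(sqrt n)] by [weighted_gap], and the truncation costs
    [n * o(1) * O(n ^ (- 1 / 2))] by [q_tail]. The function [f] enters through
    its bound [w] only, whence the uniformity in the exponent later on. *)
Theorem conditioned_mean (w : nat -> R) : (forall k, 0 <= w k <= 1) ->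
  (forall e, 0 < e -> exists K, forall k, (K <= k)%N -> w k <= e) ->
  forall e, 0 < e -> exists n0, forall n, (n0 <= n)%N -> 0 < q n ->
  forall (f : nat -> R) (mu : R), (forall k, (0 < k)%N -> `|f k| <= w k) ->
   (forall d, (forall k, (n < k)%N -> w k <= d) ->
      `| mu - \sum_(k < n.+1) f k * q k | <= d * (1 - \sum_(k < n.+1) q k)) ->
   `| (\sum_(k < n.+1) f k * (q k * A (n - k)%N)) / q n - n%:R * mu | <= e * Num.sqrt n%:R.
Proof.
move=> w01 wlim e e0.
have [h [h0 hs [B [b [B0 b0 cpB shiftB [stepe lowb]]]]]] := local_limit_estimates pP Vv0.
have [K K0 [m1 H1]] := q_tail h0 hs B0 b0 cpB shiftB stepe lowb.
have [m2 H2] := q_lower b0 lowb.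
have d0 : 0 < e * b / 2 by rewrite divr_gt0 // mulr_gt0.
have [m3 H3] := weighted_gap h0 hs B0 b0 cpB shiftB stepe w01 wlim d0.
have d0' : 0 < e / 2 / K by rewrite !divr_gt0.
have [N HN] := wlim _ d0'.
exists (maxn (h * maxn m1 (maxn m2 m3)).+1 N) => -[|n]; first by rewrite ltxx.
rewrite geq_max ltnS => /andP[hn Nn] qn f mu fw muf.
have /dvdnP[l El] : (h %| n)%N by apply: (q_span hs); rewrite gt_eqF.
rewrite mulnC in El; rewrite {}El in hn Nn qn muf *.
move: hn; rewrite leq_mul2l (gtn_eqF h0) /= !geq_max => /and3P[/H1 {}H1 /H2 {}H2 /H3 {}H3].
set m := (h * l).+1 in H1 H2 H3 Nn qn muf *; set r := rate R m in H1 H2 H3 *.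
have r0 : 0 < r := rate_gt0 _ _.
have {}muf := muf (e / 2 / K) (fun k mk => HN k (leq_trans Nn (ltnW mk))).
set s := \sum_(k < m.+1) q k in H1 muf; set sf := \sum_(k < m.+1) f k * q k in muf.
set y := \sum_(k < m.+1) f k * (q k * A (m - k)%N).
have Y : `| y - m%:R * q m * sf | <= e * b / 2 * r ^+ 2.
  apply: le_trans H3; rewrite /y /sf mulr_sumr -sumrB; apply: (le_trans (ler_norm_sum _ _ _)).
  apply: ler_sum => k _.
  have -> : f k * (q k * A (m - k)%N) - m%:R * q m * (f k * q k) =
    f k * (q k * (A (m - k)%N - m%:R * q m)) by ring.
  rewrite normrM normrM (ger0_norm (q_ge0 _)).
  case: (nat_of_ord k) => [|j]; first by rewrite /= !mul0r !mulr0.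
  by rewrite ler_wpM2r ?mulr_ge0 // fw.
have mr : m%:R * r <= Num.sqrt m%:R.
  rewrite -(ler_pXn2r (n := 2)) ?nnegrE ?mulr_ge0 ?sqrtr_ge0 ?(ltW r0) //.
  rewrite exprMn /r rate_sqr sqr_sqrtr // ler_pdivrMr ?ltr0n //.
  by rewrite expr2 -natrM -natrM ler_nat leq_mul2l leqnSn orbT.
have E : y / q m - m%:R * mu = (y - m%:R * q m * sf) / q m - m%:R * (mu - sf).
  by field; rewrite gt_eqF.
rewrite E; apply: (le_trans (ler_normB _ _)).
have -> : e * Num.sqrt m%:R = e / 2 * Num.sqrt m%:R + e / 2 * Num.sqrt m%:R by field.
apply: lerD.
  rewrite normrM normfV (gtr0_norm qn) ler_pdivrMr //; apply: (le_trans Y).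
  have m0 : 0 < m%:R :> R by rewrite ltr0n.
  rewrite -(ler_pM2l m0).
  apply: (@le_trans _ _ (e / 2 * Num.sqrt m%:R * (b * r))); last first.
    rewrite [leRHS]mulrCA ler_wpM2l // mulr_ge0 ?sqrtr_ge0 //; lra.
  have -> : m%:R * (e * b / 2 * r ^+ 2) = (e / 2 * (m%:R * r)) * (b * r) by field.
  rewrite ler_wpM2r ?mulr_ge0 ?(ltW b0) ?(ltW r0) // ler_wpM2l //; lra.
rewrite normrM normr_nat.
apply: (@le_trans _ _ (m%:R * (e / 2 / K * (K * r)))).
  rewrite ler_wpM2l //; apply: (le_trans muf); rewrite ler_wpM2l //; exact: ltW.
have -> : m%:R * (e / 2 / K * (K * r)) = e / 2 * (m%:R * r).
  by field; rewrite gt_eqF.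
by rewrite ler_wpM2l //; lra.
Qed.

Lemma q_total e : 0 < e -> exists N, forall n, (N <= n)%N -> 1 - e <= \sum_(k < n) q k.
Proof.
move=> e0.
have [h [h0 hs [B [b [B0 b0 cpB shiftB [stepe lowb]]]]]] := local_limit_estimates pP Vv0.
have [K K0 [m1 H1]] := q_tail h0 hs B0 b0 cpB shiftB stepe lowb.
have [m2 H2] := @rate_small R _ _ (ltW K0) e0.
pose l := maxn m1 m2.
have le1 : K * rate R (h * l).+1 <= e.
  apply: H2; apply: leq_trans (leq_maxr m1 m2) _.
  by rewrite -/l (leq_trans (leq_pmull l h0)).
exists (h * l).+2 => n ln; have := H1 l (leq_maxl _ _).
have : \sum_(k < (h * l).+2) q k <= \sum_(k < n) q k.
  rewrite -!(big_mkord xpredT (fun k => q k)) (big_cat_nat _ ln) //= lerDl.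
  by apply: sumr_ge0.
lra.
Qed.

End total_progeny.

(** * The law of the exploration *)

Section exploration_law.
Context d (T : measurableType d) (R : realType) (P : probability T R).
Variable xis : seq nat -> {mfun T >-> nat}.
Local Notation cc w := (fun u => xis u w).

Definition pr (A : set T) : R := fine (P A).

Lemma prE A : measurable A -> P A = (pr A)%:E.
Proof. by move=> mA; rewrite /pr fineK // fin_num_measure. Qed.

Lemma pr_ge0 A : 0 <= pr A.
Proof. by rewrite /pr fine_ge0. Qed.

Lemma measurable_xi v (B : set nat) : measurable (xis v @^-1` B).
Proof. by rewrite -[X in measurable X]setTI; exact: measurable_funPT. Qed.

Lemma measurable_split v (Y : nat -> set T) : (forall j, measurable (Y j)) ->
  measurable [set w | Y (xis v w) w].
Proof.
move=> mY; rewrite (_ : mkset _ = \bigcup_j (xis v @^-1` [set j] `&` Y j)).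
  by apply: bigcupT_measurable => j; apply: measurableI => //; exact: measurable_xi.
apply/seteqP; split => [w Yw|w [j _ [/= <-]]] //; by exists (xis v w).
Qed.

Definition kids v j : seq (seq nat) := [seq rcons v i | i <- iota 0 j].

Lemma size_kids v j : size (kids v j) = j.
Proof. by rewrite size_map size_iota. Qed.

(** What the exploration has revealed so far. *)
Definition context (s : seq (seq nat)) (a : seq nat -> nat) : set T :=
  [set w | forall u, u \in s -> xis u w = a u].

Lemma measurable_context s a : measurable (context s a).
Proof.
elim: s => [|v s IH].
  by rewrite (_ : context _ _ = setT) //; apply/seteqP; split.
rewrite (_ : context _ _ = (xis v @^-1` [set a v]) `&` context s a).
  by apply: measurableI => //; exact: measurable_xi.
apply/seteqP; split => [w H|w [H1 H2] u].
  by split; [apply: H; rewrite mem_head|move=> u us; apply: H; rewrite inE us orbT].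
by rewrite inE => /orP[/eqP -> //|/H2].
Qed.

Definition explored n L : set T := [set w | explores (cc w) n L].

Lemma measurable_explored n L : measurable (explored n L).
Proof.
elim: n L => [|n IH] [|v L].
- by rewrite (_ : explored _ _ = setT) //; apply/seteqP; split.
- by rewrite (_ : explored _ _ = set0) //; apply/seteqP; split.
- by rewrite (_ : explored _ _ = set0) //; apply/seteqP; split.
exact: (@measurable_split v (fun j => explored n (kids v j ++ L))).
Qed.

Definition marked k n L i : set T :=
  [set w | explores (cc w) n L && explores (cc w) k [:: nth [::] (dfs (cc w) n L) i]].

Lemma measurable_marked k n L i : (i < n)%N -> measurable (marked k n L i).
Proof.
elim: n L i => [|n IH] [|v L] [|i] // ni; try by
  rewrite (_ : marked _ _ _ _ = set0) //; apply/seteqP; split.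
- rewrite (_ : marked _ _ _ _ = explored n.+1 (v :: L) `&` explored k [:: v]).
    by apply: measurableI; exact: measurable_explored.
  by apply/seteqP; split => w /=; [move/andP|move=> [? ?]; apply/andP].
by apply: (@measurable_split v (fun j => marked k n (kids v j ++ L) i)) => j; exact: IH.
Qed.

Definition upd (a : seq nat -> nat) v j u := if u == v then j else a u.

(** Total probability over the offspring number of the next node [v], which then
    joins the context. *)
Lemma pr_split s a v n (Y : set T) (Yj : nat -> set T) : v \notin s ->
  (forall j, measurable (Yj j)) ->
  (forall w, Y w <-> (xis v w < n)%N /\ Yj (xis v w) w) ->
  pr (context s a `&` Y) = \sum_(j < n) pr (context (v :: s) (upd a v j) `&` Yj j).
Proof.
move=> vs mY YE; pose F j := context (v :: s) (upd a v j) `&` Yj j.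
have Fv j w : F j w -> xis v w = j.
  by move=> [/(_ v)]; rewrite mem_head /upd eqxx => /(_ isT).
have mF j : measurable (F j) by apply: measurableI => //; exact: measurable_context.
rewrite (_ : _ `&` Y = \big[setU/set0]_(j < n) F j).
  rewrite /pr measure_bigsetU //; last first.
    by apply/trivIsetP => i j _ _ ij; rewrite -subset0 => w [/Fv iw /Fv jw]; rewrite -iw -jw eqxx in ij.
  rewrite sum_fine // => i _; exact: fin_num_measure (mF i).
rewrite -bigcup_mkord; apply/seteqP; split => [w [cw /YE[vn Yw]]|w [j /= jn Fw]].
  exists (xis v w) => //; split => // u; rewrite inE /upd; case: eqVneq => [-> //|_ /=].
  exact: cw.
have jw := Fv _ _ Fw; case: Fw => cw Yw; split; last by apply/YE; rewrite jw.
move=> u us; have := cw u; rewrite inE us orbT /upd => /(_ isT) ->.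
by case: eqVneq => // uv; rewrite -uv us in vs.
Qed.

(** Below the waiting nodes [L] no offspring number has been revealed yet. *)
Definition away (L : seq (seq nat)) (s : seq (seq nat)) :=
  forall x u, x \in L -> u \in s -> ~~ prefix x u.

Lemma away_kids v L s j : antichain (v :: L) -> away (v :: L) s ->
  away (kids v j ++ L) (v :: s).
Proof.
move=> /= /andP[/allP vL _] aw x u; rewrite mem_cat => /orP[/mapP[i _ ->]|xL].
  rewrite inE => /orP[/eqP ->|us].
    by apply/negP => /size_prefix; rewrite size_rcons ltnn.
  by apply: contra (aw v u (mem_head _ _) us); exact: prefix_rconsr.
rewrite inE => /orP[/eqP ->|us]; first by have /andP[_] := vL x xL.
by apply: aw => //; rewrite inE xL orbT.
Qed.

Lemma away_head v L s : away (v :: L) s -> v \notin s.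
Proof. by move=> aw; apply/negP => vs; have := aw v v (mem_head _ _) vs; rewrite prefix_refl. Qed.

Variable p : nat -> R.
Local Notation wt s a := (\prod_(u <- s) p (a u)).
Hypothesis context_prob : forall s a, uniq s -> pr (context s a) = wt s a.

Lemma wt_upd s a v j : v \notin s -> wt (v :: s) (upd a v j) = wt s a * p j.
Proof.
move=> vs; rewrite big_cons /upd eqxx mulrC; congr (_ * _).
apply: eq_big_seq => u us; case: eqVneq => // uv; by rewrite -uv us in vs.
Qed.

Lemma kids_antichain v L j : antichain (v :: L) -> antichain (kids v j ++ L).
Proof. exact: (@antichain_children (fun=> j)). Qed.

(** The branching property, relative to an event [E] about the trees that wait
    behind those of [L]; [E] is needed to separate a marked subtree from the rest
    of its forest. *)
Lemma explored_prob (L2 : seq (seq nat)) (E : set T) (g : R) : measurable E ->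
  (forall s a, uniq s -> away L2 s -> pr (context s a `&` E) = wt s a * g) ->
  forall n L s a, uniq s -> away (L ++ L2) s -> antichain (L ++ L2) ->
  pr (context s a `&` (E `&` explored n L)) = wt s a * g * forest_wt p n (size L).
Proof.
move=> mE HE; elim=> [|n IH] [|v L] s a us aw aL.
- rewrite (_ : explored _ _ = setT); last by apply/seteqP; split.
  by rewrite setIT HE //= mulr1.
- rewrite (_ : explored _ _ = set0); last by apply/seteqP; split.
  by rewrite !setI0 /pr measure0 /= mulr0.
- rewrite (_ : explored _ _ = set0); last by apply/seteqP; split.
  by rewrite !setI0 /pr measure0 /= mulr0.
have vs := away_head aw.
rewrite (@pr_split s a v n.+1 _ (fun j => E `&` explored n (kids v j ++ L))) //.
- rewrite /= mulr_sumr; apply: eq_bigr => j _.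
  rewrite IH; last 3 first.
  + by rewrite /= vs.
  + by rewrite -catA; exact: away_kids.
  + by rewrite -catA; exact: kids_antichain.
  by rewrite wt_upd // size_cat size_kids addnC; ring.
- by move=> j; apply: measurableI => //; exact: measurable_explored.
move=> w; split=> [[Ew ew]|[vn [Ew ew]]] //; split => //.
have := @explores_size (cc w) n (children (cc w) v ++ L) ew; rewrite size_cat size_map size_iota ltnS.
exact: leq_trans (leq_addr _ _).
Qed.

Lemma forest_prob n L s a : uniq s -> away L s -> antichain L ->
  pr (context s a `&` explored n L) = wt s a * forest_wt p n (size L).
Proof.
move=> us aw aL; rewrite -[X in _ `&` X]setTI.
rewrite (@explored_prob [::] setT 1) ?cats0 ?mulr1 // => s' a' us' _.
by rewrite setIT context_prob // mulr1.
Qed.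

(** The case of the first visited node is [explored_prob]; the other nodes are
    visited after its offspring number has joined the context. *)
Lemma marked_prob k n L s a : uniq s -> away L s -> antichain L ->
  \sum_(i < n) pr (context s a `&` marked k n L i) = wt s a * marked_wt p k n (size L).
Proof.
elim: n L s a => [|n IH] [|v L] s a us aw aL.
- by rewrite big_ord0 /= mulr0.
- by rewrite big_ord0 /= mulr0.
- rewrite big1 ?mulr0 // => i _; rewrite (_ : marked _ _ _ _ = set0).
    by rewrite setI0 /pr measure0.
  by apply/seteqP; split.
have vs := away_head aw.
have EC w (e2 : explores (cc w) k [:: v]) : explores (cc w) n.+1 (v :: L) =
    (k <= n.+1)%N && explores (cc w) (n.+1 - k) L := explores_catP n.+1 L e2.
have M0 : marked k n.+1 (v :: L) 0 =
    [set w | explores (cc w) n.+1 (v :: L) && explores (cc w) k [:: v]] by [].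
rewrite big_ord_recl [marked_wt _ _ _ _]/= mulrDr; congr (_ + _).
  rewrite M0.
  have [kn|nk] := leqP k n.+1; last first.
    rewrite mulr0 (_ : mkset _ = set0) ?setI0 /pr ?measure0 //.
    apply/seteqP; split => // w /andP[e1 e2].
    by have := EC w e2; rewrite e1 leqNgt nk.
  rewrite (_ : mkset _ = explored (n.+1 - k) L `&` explored k [:: v]).
    rewrite (@explored_prob L (explored (n.+1 - k) L) (forest_wt p (n.+1 - k) (size L))) //.
    - by rewrite mulrA mulrAC.
    - exact: measurable_explored.
    - move=> s' a' us' aw'; rewrite forest_prob //.
      by move: aL => /= /andP[].
  apply/seteqP; split => w.
    by move=> /andP[e1 e2]; split => //; move: e1; rewrite (EC w e2) kn.
  by move=> [e1 e2]; apply/andP; split => //; rewrite (EC w e2) kn.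
transitivity (\sum_(i < n) \sum_(j < n.+1)
   pr (context (v :: s) (upd a v j) `&` marked k n (kids v j ++ L) i)).
  apply: eq_bigr => i _.
  apply: (@pr_split s a v n.+1 _ (fun j => marked k n (kids v j ++ L) i)) => //.
    by move=> j; apply: measurable_marked.
  move=> w; rewrite lift0; split=> [|[vn]] //.
  move=> mw; split => //; move: mw => /= /andP[ew _].
  have := @explores_size (cc w) n (children (cc w) v ++ L) ew; rewrite size_cat size_map size_iota ltnS.
  exact: leq_trans (leq_addr _ _).
rewrite exchange_big /= mulr_sumr; apply: eq_bigr => j _.
rewrite IH; last 3 first.
- by rewrite /= vs.
- exact: away_kids.
- exact: kids_antichain.
by rewrite wt_upd // size_cat size_kids addnC; ring.
Qed.

Local Notation size_is n := (gw_size xis @^-1` [set n]).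

Lemma size_explored n : (0 < n)%N -> size_is n = explored n [:: [::]].
Proof.
move=> n0; apply/seteqP; split => w /= H.
  by rewrite /explored /= -card_tree //; apply/eqP.
by apply/eqP; rewrite /gw_size /gw_tree card_tree.
Qed.

Lemma pr_size n : (0 < n)%N -> pr (size_is n) = forest_wt p n 1.
Proof.
move=> n0; rewrite size_explored //.
rewrite -[X in pr X]setTI (_ : setT = context [::] (fun=> 0%N)).
  by rewrite forest_prob // big_nil mul1r.
by apply/seteqP; split.
Qed.

Lemma pr_marked k n : (0 < k <= n)%N ->
  \sum_(i < n) pr (marked k n [:: [::]] i) = forest_wt p k 1 * conv_pow p (n - k)%N (n - k)%N.
Proof.
move=> /andP[k0 kn].
transitivity (\sum_(i < n) pr (context [::] (fun=> 0%N) `&` marked k n [:: [::]] i)).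
  apply: eq_bigr => i _; rewrite (_ : context _ _ = setT) ?setTI //.
  by apply/seteqP; split.
rewrite marked_prob // big_nil mul1r [size _]/= marked_wtE // add0n kn mul1r subn0 //.
Qed.

End exploration_law.

(** * The offspring law *)

Section integer_law.
Context d (T : measurableType d) (R : realType) (P : probability T R).
Variable xi : {mfun T >-> nat}.

Definition law_of k : R := pr P (xi @^-1` [set k]).
Local Notation p := law_of.

Lemma measurable_xi1 (B : set nat) : measurable (xi @^-1` B).
Proof. by rewrite -[X in measurable X]setTI; exact: measurable_funPT. Qed.

Lemma law_of_ge0 k : 0 <= p k.
Proof. exact: pr_ge0. Qed.

Lemma measurable_comp_nat (h : nat -> R) : measurable_fun setT (fun w => h (xi w)).
Proof.
move=> _ Y mY; rewrite setTI (_ : _ @^-1` Y = xi @^-1` (h @^-1` Y)) //.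
exact: measurable_xi1.
Qed.

Lemma expectation_series (h : nat -> R) : (forall k, 0 <= h k) ->
  ('E_P[(fun w => h (xi w))%R] = \sum_(k <oo) (h k * p k)%:E)%E.
Proof.
move=> h0; rewrite unlock.
rewrite [X in integral _ X _](_ : setT = \bigcup_k (xi @^-1` [set k])); last first.
  by apply/seteqP; split => // w _; exists (xi w).
rewrite ge0_integral_bigcup; last 4 first.
- by move=> k; exact: measurable_xi1.
- apply/measurable_EFinP; apply: (@measurable_funS _ _ _ _ setT) => //; exact: measurable_comp_nat.
- by move=> w _; rewrite lee_fin.
- by apply/trivIsetP => i j _ _ ij; rewrite -subset0 => w [/= iw jw]; rewrite -iw -jw eqxx in ij.
apply: eq_eseriesr => k _.
rewrite (eq_integral (fun=> (h k)%:E)); last by move=> w /set_mem /= ->.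
rewrite integral_cst ?EFinM; last exact: measurable_xi1.
by congr (_ * _)%E; exact: prE (measurable_xi1 _).
Qed.

Lemma series_of_expectation (h : nat -> R) s : (forall k, 0 <= h k) ->
  ('E_P[(fun w => h (xi w))%R] = s%:E)%E ->
  (forall N, \sum_(k < N) h k * p k <= s) /\
  (forall e, 0 < e -> exists N0, forall N, (N0 <= N)%N -> s - e <= \sum_(k < N) h k * p k).
Proof.
move=> h0; rewrite expectation_series // => hs.
have g0 k : (0 <= (h k * p k)%:E)%E by rewrite lee_fin mulr_ge0 // law_of_ge0.
have le N : \sum_(k < N) h k * p k <= s.
  rewrite -lee_fin -hs -sumEFin -(big_mkord xpredT (fun k => (h k * p k)%:E)).
  by apply: nneseries_lim_ge => k _ _; exact: g0.
split => // e e0.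
have [N0 HN0] : exists N0, s - e <= \sum_(k < N0) h k * p k.
  apply: contrapT => /forallNP H.
  have : (\sum_(k <oo) (h k * p k)%:E <= (s - e)%:E)%E.
    apply: lime_le; first by apply: is_cvg_nneseries => k _ _; exact: g0.
    apply: nearW => N; rewrite sumEFin lee_fin big_mkord.
    by have := H N; move/negP; rewrite -ltNge => /ltW.
  by rewrite hs lee_fin; lra.
exists N0 => N N0N; apply: (le_trans HN0).
rewrite -!(big_mkord xpredT (fun k => h k * p k)) [leRHS](big_cat_nat (leq0n N0) N0N) //= lerDl.
by apply: sumr_ge0 => k _; apply: mulr_ge0 => //; exact: law_of_ge0.
Qed.

Hypothesis xi1 : ('E_P[(fun w => (xi w)%:R)%R] = 1)%E.
Hypothesis xiV : (0 < 'V_P[(fun w => (xi w)%:R)%R] < +oo)%E.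

Let V0 : R := fine 'V_P[(fun w => (xi w)%:R)%R]%E.

Lemma variance_series : 'E_P[(fun w => ((xi w)%:R - 1) ^+ 2)%R]%E = V0%:E.
Proof.
rewrite /V0 fineK; last first.
  by case/andP: xiV => h1 h2; rewrite ge0_fin_numE // ltW.
rewrite /variance covariance.unlock xi1; congr expectation.
Qed.

Lemma variance_gt0 : 0 < V0.
Proof. by case/andP: xiV => h1 h2; rewrite fine_gt0 // h1. Qed.

Lemma sum_nat_split (F : nat -> R) K N : (K <= N)%N ->
  \sum_(K <= k < N) F k = \sum_(k < N) F k - \sum_(k < K) F k.
Proof. by move=> KN; rewrite -!(big_mkord xpredT F) [X in X - _](big_cat_nat (leq0n K) KN) /= addrAC subrr add0r. Qed.

(** That [0] is an atom uses the variance: otherwise all [(k - 1) * p k] would be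
    nonnegative with sum [0], and the law would be concentrated at [1]. *)
Theorem critical_law_of : critical_law p (2 * V0 + 2).
Proof.
have [m1 m2] : (forall N, \sum_(k < N) 1 * p k <= 1) /\
  (forall e, 0 < e -> exists N0, forall N, (N0 <= N)%N -> 1 - e <= \sum_(k < N) 1 * p k).
  apply: (@series_of_expectation (fun=> 1)) => //; exact: expectation_cst.
have [n1 n2] := @series_of_expectation (fun k => k%:R) 1 (fun k => ler0n _ k) xi1.
have [v1 v2] := @series_of_expectation (fun k => (k%:R - 1) ^+ 2) V0 (fun k => sqr_ge0 _) variance_series.
have p0 := law_of_ge0.
have sq k : k%:R ^+ 2 * p k <= 2 * ((k%:R - 1) ^+ 2 * p k) + 2 * (1 * p k).
  rewrite mulrA mulrA -mulrDl; apply: ler_wpM2r => //.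
  have := sqr_ge0 (k%:R - 2%:R : R); rewrite !expr2; lra.
have sqs (r : seq nat) : \sum_(k <- r) k%:R ^+ 2 * p k <=
    2 * (\sum_(k <- r) (k%:R - 1) ^+ 2 * p k) + 2 * (\sum_(k <- r) 1 * p k).
  by rewrite !mulr_sumr -big_split; apply: ler_sum => k _; exact: sq.
split.
- exact: p0.
- by move=> N; have := m1 N.+1; under eq_bigr do rewrite mul1r.
- by move=> N; exact: n1.
- move=> N; rewrite /mom2 -(big_mkord xpredT (fun k => k%:R ^+ 2 * p k)).
  apply: (le_trans (sqs _)); rewrite !big_mkord.
  have := m1 N.+1; have := v1 N.+1; lra.
- move=> e e0; have [N0 H] := m2 e e0; exists N0 => N N0N.
  by have := H N.+1 (leqW N0N); under eq_bigr do rewrite mul1r.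
- by move=> e e0; have [N0 H] := n2 e e0; exists N0 => N N0N; apply: H; exact: leqW.
- move=> e e0; have e40 : 0 < e / 4 by lra.
  have [N1 H1] := m2 _ e40; have [N2 H2] := v2 _ e40.
  exists (maxn N1 N2) => N.
  have [KN|NK] := leqP (maxn N1 N2) N; last by rewrite big_geq ?(ltnW NK) // ltW.
  apply: (le_trans (sqs _)); rewrite !(sum_nat_split _ KN).
  have := H1 _ (leq_maxl N1 N2); have := H2 _ (leq_maxr N1 N2).
  have := m1 N; have := v1 N; lra.
- rewrite lt_neqAle p0 andbT; apply/eqP => p00.
  have Z k : (k%:R - 1) * p k = 0.
    have nn j : 0 <= (j.+1%:R - 1) * p j.+1.
      by apply: mulr_ge0 => //; rewrite -natr1 addrK.
    case: k => [|k]; first by rewrite -p00 mulr0.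
    apply/eqP; rewrite eq_le nn andbT; apply/ler_addgt0Pl => e e0; rewrite addr0.
    have [N0 H] := m2 e e0; have := H (maxn N0 k.+2) (leq_maxl _ _).
    have := n1 (maxn N0 k.+2); set N := maxn N0 k.+2 => h1 h2.
    have kN : (k.+1 < N)%N by rewrite leq_max ltnSn orbT.
    have : \sum_(j < N) (j%:R - 1) * p j <= e.
      under eq_bigr do rewrite mulrBl; rewrite sumrB; lra.
    apply: le_trans; rewrite (bigD1 (Ordinal kN)) //= lerDl; apply: sumr_ge0 => -[[|j] jN] _ /=.
      by rewrite -p00 mulr0.
    exact: nn.
  have := variance_gt0; rewrite lt_neqAle => /andP[/eqP]; case.
  have e0 : 0 < V0 / 2 by have := variance_gt0; lra.
  have [N1 H1] := v2 _ e0; have := H1 N1 (leqnn _); rewrite big1.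
    have := variance_gt0; lra.
  by move=> k _; rewrite expr2 -mulrA Z mulr0.
have h0 : 0 < 2^-1 :> R by lra.
have [N1 H1] := n2 _ h0; have := H1 N1 (leqnn _).
have [/existsP[k /andP[k0 pk]]|] := boolP [exists k : 'I_N1, (0 < k)%N && (0 < p k)].
  by move=> _; exists k.
rewrite negb_exists => /forallP Hk; rewrite big1; first lra.
move=> [[|k] kN] _ /=; first by rewrite mul0r.
have := Hk (Ordinal kN) => /=; rewrite -leNgt => pk.
by rewrite (_ : p k.+1 = 0) ?mulr0 //; apply/eqP; rewrite eq_le pk p0.
Qed.

End integer_law.

Section context_law.
Context d (T : measurableType d) (R : realType) (P : probability T R).
Context d0 (T0 : measurableType d0) (P0 : probability T0 R) (xi : {mfun T0 >-> nat}).
Variable xis : seq nat -> {mfun T >-> nat}.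
Hypothesis xis_iid : iid_copies xis P P0 xi.

Lemma iid_context_prob s a : uniq s ->
  pr P (context xis s a) = \prod_(u <- s) law_of P0 xi (a u).
Proof.
case: xis_iid => ind dist us.
have -> : context xis s a = \bigcap_(i in [set` s]) (xis i @^-1` [set a i]).
  by apply/seteqP; split.
rewrite /pr (ind s (fun i => [set a i]) us) //.
have E u : P (xis u @^-1` [set a u]) = (law_of P0 xi (a u))%:E.
  have := dist u [set a u]; rewrite /distribution /pushforward => ->.
  exact: prE (measurable_xi1 _ _).
rewrite (eq_bigr _ (fun u _ => E u)).
by rewrite prodEFin.
Qed.
End context_law.

(** * Means of step functions and of the conditioned tree *)

Section step_functions.
Context d (T : measurableType d) (R : realType) (P : probability T R).
Implicit Types (f : T -> R).

Lemma fine_expectation f : fine 'E_P[f]%E = \int[P]_w f w.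
Proof. by rewrite unlock. Qed.

Lemma bounded_integrable f M : measurable_fun setT f -> (forall w, `|f w| <= M) ->
  P.-integrable setT (EFin \o f).
Proof.
move=> mf fM; apply: measurable_bounded_integrable => //.
  by apply: (@le_lt_trans _ _ 1%E); [exact: probability_le1|exact: ltry].
by exists M; split; [exact: num_real|move=> x Mx w _ /=; exact: (le_trans (fM w)) (ltW Mx)].
Qed.

Section step.
Variables (I : Type) (r : seq I) (c : I -> R) (A : I -> set T).
Hypothesis mA : forall i, measurable (A i).
Definition step w := \sum_(i <- r) c i * \1_(A i) w.

Lemma step_integrable : P.-integrable setT (EFin \o step).
Proof.
rewrite (_ : EFin \o _ = fun w => (\sum_(i <- r) (c i)%:E * (\1_(A i) w)%:E)%E); last first.
  by apply/funext => w; rewrite /= /step -sumEFin; apply: eq_bigr => i _; rewrite EFinM.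
apply: (@integrable_sum _ _ _ _ _ _ _ r xpredT (fun i w => (c i)%:E * (\1_(A i) w)%:E)%E) => // i _.
by apply: integrableZl => //; exact: integrable_indic.
Qed.

Lemma step_mean : \int[P]_w step w = \sum_(i <- r) c i * pr P (A i).
Proof.
rewrite /Rintegral (_ : (fun w => _) = fun w => (\sum_(i <- r) (c i)%:E * (\1_(A i) w)%:E)%E); last first.
  by apply/funext => w; rewrite /= /step -sumEFin; apply: eq_bigr => i _; rewrite EFinM.
rewrite (@integral_sum _ _ _ _ _ measurableT _ (fun i w => (c i)%:E * (\1_(A i) w)%:E)%E); last first.
  by move=> i; apply: integrableZl => //; exact: integrable_indic.
rewrite (eq_bigr (fun i => (c i * pr P (A i))%:E)) ?sumEFin // => i _.
rewrite integralZl //; last exact: integrable_indic.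
by rewrite integral_indic // setIT EFinM; congr (_ * _)%E; exact: prE.
Qed.

(** Conditioning the tree on its size puts all the mass on an event [D] where the
    functional is a step function. *)
Lemma mean_eq_step f (D : set T) : measurable_fun setT f -> measurable D ->
  P (~` D) = 0%E -> (forall w, D w -> f w = step w) ->
  \int[P]_w f w = \sum_(i <- r) c i * pr P (A i).
Proof.
move=> mf mD PD fD; rewrite -step_mean; congr fine.
apply: ae_eq_integral => //; first exact/measurable_EFinP.
  by case/integrableP: step_integrable.
exists (~` D); split => //; first exact: measurableC.
by move=> w /= H Dw; apply: H => _; rewrite fD.
Qed.

End step.

Variable N : T -> nat.
Hypothesis mN : forall B : set nat, measurable (N @^-1` B).

Lemma measurable_comp_discrete (f : nat -> R) : measurable_fun setT (fun w => f (N w)).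
Proof. by move=> _ Y mY; rewrite setTI (_ : _ @^-1` Y = N @^-1` (f @^-1` Y)). Qed.

Lemma pr_initial n : \sum_(k < n) pr P (N @^-1` [set (k : nat)]) = pr P (N @^-1` [set k | (k < n)%N]).
Proof.
rewrite (_ : N @^-1` _ = \big[setU/set0]_(k < n) (N @^-1` [set (k : nat)])).
  rewrite /pr (@measure_bigsetU _ _ _ P (fun k => N @^-1` [set k])) // ?sum_fine //.
    by move=> k _; exact: fin_num_measure.
  apply/trivIsetP => i j _ _ ij; rewrite -subset0 => w [/= iw jw].
  by rewrite -iw -jw eqxx in ij.
rewrite -(bigcup_mkord n (fun k => N @^-1` [set k])); apply/seteqP; split => [w /= nw|w [k /= kn /= Nk]].
  by exists (N w).
by rewrite Nk.
Qed.

Lemma pr_initial_le1 n : \sum_(k < n) pr P (N @^-1` [set (k : nat)]) <= 1.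
Proof.
by rewrite pr_initial -lee_fin -prE //; exact: probability_le1.
Qed.

Lemma pr_tail n : pr P (N @^-1` [set k | (n <= k)%N]) =
  1 - \sum_(k < n) pr P (N @^-1` [set (k : nat)]).
Proof.
rewrite pr_initial; have := probability_setC P (mN [set k | (k < n)%N]).
rewrite (_ : ~` _ = N @^-1` [set k | (n <= k)%N]); last first.
  by apply/seteqP; split => w /=; [move/negP; rewrite -leqNgt|move=> H; apply/negP; rewrite -leqNgt].
by rewrite (prE P (mN [set k | (n <= k)%N])) (prE P (mN [set k | (k < n)%N])) -EFinB => -[].
Qed.

(** The difference is the mean of [f] on the event that [N] exceeds [n]. *)
Lemma mean_truncation (f : nat -> R) M n e : (forall k, `|f k| <= M) ->
  (forall k, (n < k)%N -> `|f k| <= e) ->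
  `| \int[P]_w f (N w) - \sum_(k < n.+1) f k * pr P (N @^-1` [set (k : nat)]) | <=
  e * (1 - \sum_(k < n.+1) pr P (N @^-1` [set (k : nat)])).
Proof.
move=> fM fe; set A := fun k : 'I_n.+1 => N @^-1` [set (k : nat)].
have mA k : measurable (A k) by exact: mN.
have If : P.-integrable setT (EFin \o (fun w => f (N w))).
  by apply: bounded_integrable; [exact: measurable_comp_discrete|move=> w; exact: fM].
rewrite -(step_mean (index_enum _) (fun k : 'I_n.+1 => f k) mA).
have Is := step_integrable (index_enum _) (fun k : 'I_n.+1 => f k) mA.
rewrite -RintegralB //.
set B := [set k | (n < k)%N].
have IB : P.-integrable setT (EFin \o (fun w => e * \1_(N @^-1` B) w)).
  rewrite (_ : _ \o _ = (fun w => e%:E * (\1_(N @^-1` B) w)%:E)%E) //.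
  by apply: integrableZl => //; exact: integrable_indic.
have Id : P.-integrable setT (EFin \o (fun w => f (N w) - step (index_enum _) (fun k : 'I_n.+1 => f k) A w)).
  rewrite (_ : _ \o _ = ((EFin \o (fun w => f (N w))) \-
    (EFin \o step (index_enum _) (fun k : 'I_n.+1 => f k) A))%E) //.
  exact: integrableB.
apply: (le_trans (le_normr_Rintegral _ _)) => //.
apply: (@le_trans _ _ (\int[P]_w (e * \1_(N @^-1` B) w))).
  apply: le_Rintegral => //; first exact: integrable_norm.
  move=> w _; have [Nn|nN] := leqP (N w) n.
    have -> : step (index_enum _) (fun k : 'I_n.+1 => f k) A w = f (N w).
      rewrite /step (bigD1 (Ordinal (Nn : (N w < n.+1)%N))) //= indicE mem_set //= mulr1.
      rewrite big1 ?addr0 // => k kN; rewrite indicE memNset ?mulr0 //= => E.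
      by move/eqP: kN; apply; apply: val_inj.
    rewrite subrr normr0 indicE memNset ?mulr0 //= /B /=.
    by apply/negP; rewrite -leqNgt.
  rewrite indicE mem_set //= mulr1 /step big1 ?subr0; first exact: fe.
  move=> k _; rewrite indicE memNset ?mulr0 //= => E.
  by have := ltn_ord k; rewrite ltnS leqNgt -E nN.
rewrite RintegralZl //; last exact: integrable_indic.
rewrite -pr_tail; rewrite /Rintegral integral_indic ?setIT //.
Qed.

End step_functions.

Section conditioned.
Context d (T : measurableType d) (R : realType) (P : probability T R).
Variable xis : seq nat -> {mfun T >-> nat}.
Variable p : nat -> R.
Hypothesis context_prob : forall s a, uniq s ->
  pr P (context xis s a) = \prod_(u <- s) p (a u).
Local Notation q n := (forest_wt p n 1).
Local Notation size_is n := (gw_size xis @^-1` [set n]).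

Definition toll_sum (f : nat -> R) (t : {fset seq nat}) : R :=
  \sum_(v <- t) f #|` subtree t v|%fset.

Lemma gw_condE n A : (0 < P (size_is n))%E ->
  gw_cond xis P n A = (P (A `&` size_is n) * ((pr P (size_is n))^-1)%:E)%E.
Proof.
move=> P0; rewrite /gw_cond /= /mnormalize /mset /= /mrestr setTI gt_eqF //=.
by rewrite lt_eqF // (le_lt_trans (probability_le1 P (measurable_gw_size _ _))) // ltry.
Qed.

Lemma gw_cond_sizeC n : (0 < P (size_is n))%E -> gw_cond xis P n (~` size_is n) = 0%E.
Proof. by move=> P0; rewrite gw_condE // setICl measure0 mul0e. Qed.

Lemma measurable_of_tree (g : {fset seq nat} -> R) : measurable_fun setT (fun w => g (gw_tree xis w)).
Proof.
move=> _ Y mY; rewrite setTI (_ : _ @^-1` Y = gw_tree xis @^-1` (g @^-1` Y)) //.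
exact: measurable_gw_tree.
Qed.

(** On the event that the tree has [n] nodes, [sum_tree] displays the functional
    as a step function, and [pr_marked] gives the probabilities of its steps. *)
Lemma mean_toll_sum f n : (0 < n)%N -> (0 < P (size_is n))%E ->
  fine 'E_(gw_cond xis P n)[(fun w => toll_sum f (gw_tree xis w))]%E =
  (\sum_(k < n.+1) f k * (q k * conv_pow p (n - k)%N (n - k)%N)) / q n.
Proof.
move=> n0 P0; rewrite fine_expectation.
have qE : pr P (size_is n) = q n by exact: pr_size.
have mM (ik : 'I_n * 'I_n.+1) : measurable (marked xis ik.2 n [:: [::]] ik.1).
  by apply: measurable_marked.
rewrite (@mean_eq_step _ _ _ (gw_cond xis P n) _ (index_enum _) (fun ik : 'I_n * 'I_n.+1 => f ik.2)
  (fun ik => marked xis ik.2 n [:: [::]] ik.1) mM _ (size_is n)); last 4 first.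
- exact: measurable_of_tree.
- exact: measurable_gw_size.
- exact: gw_cond_sizeC.
- move=> w; rewrite size_explored // => ew; rewrite /toll_sum (@sum_tree _ _ n f) //.
  rewrite /step pair_big; apply: eq_bigr => ik _.
  rewrite indicE /marked; case: ifP => H.
    by rewrite mem_set ?mulr1 //= H andbT.
  by rewrite memNset ?mulr0 //= H andbF.
transitivity (\sum_(k < n.+1) \sum_(i < n) f k * (pr P (marked xis k n [:: [::]] i) / q n)).
  rewrite exchange_big pair_big /=; apply: eq_bigr => -[i k] _ /=; congr (_ * _).
  rewrite /pr gw_condE // setIidl; last first.
    by move=> w; rewrite size_explored // => /andP[].
  rewrite -[X in _ / X]qE (prE P (measurable_marked xis k [:: [::]] (ltn_ord i))) -EFinM //.
rewrite mulr_suml; apply: eq_bigr => k _; rewrite -mulr_sumr -mulr_suml mulrA; congr (_ * _ / _).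
have [k0|k0] := posnP k; last first.
  by apply: pr_marked => //; rewrite k0 -ltnS ltn_ord.
rewrite k0 big1 ?mul0r // => i _; rewrite (_ : marked _ _ _ _ _ = set0) /pr ?measure0 //.
by apply/seteqP; split => // w /andP[].
Qed.

End conditioned.

(** * Centring the functional *)

Section powers.
Variable R : realType.
Implicit Types (k : nat).

Lemma Re_npowc k (a : R[i]) : complex.Re (npowc k a) =
  expR (complex.Re a * ln k%:R) * cos (complex.Im a * ln k%:R).
Proof. by rewrite /npowc /= mul0r subr0. Qed.

Lemma Im_npowc k (a : R[i]) : complex.Im (npowc k a) =
  expR (complex.Re a * ln k%:R) * sin (complex.Im a * ln k%:R).
Proof. by rewrite /npowc /= mul0r addr0. Qed.

Lemma ln_nat_ge0 k : 0 <= ln k%:R :> R.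
Proof.
case: k => [|k]; first by rewrite ln0.
by rewrite ln_ge0 // ler1n.
Qed.

Definition power_weight (a0 : R) k := expR (a0 * ln k%:R).

Lemma norm_mul_le1 (x y z : R) : 0 <= x -> x <= z -> `|y| <= 1 -> `|x * y| <= z.
Proof.
move=> x0 xz y1; rewrite normrM (ger0_norm x0).
by apply: le_trans xz; rewrite -[leRHS]mulr1; exact: ler_wpM2l.
Qed.

Lemma exp_ln_le (x a0 : R) k : x <= a0 -> expR (x * ln k%:R) <= power_weight a0 k.
Proof. by move=> xa; rewrite ler_expR; apply: ler_wpM2r => //; exact: ln_nat_ge0. Qed.

Lemma Re_npowc_le a0 k (a : R[i]) : complex.Re a <= a0 ->
  `|complex.Re (npowc k a)| <= power_weight a0 k.
Proof.
move=> aa; rewrite Re_npowc; apply: norm_mul_le1; [exact: expR_ge0|exact: exp_ln_le|].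
by rewrite ler_norml cos_geN1 cos_le1.
Qed.

Lemma Im_npowc_le a0 k (a : R[i]) : complex.Re a <= a0 ->
  `|complex.Im (npowc k a)| <= power_weight a0 k.
Proof.
move=> aa; rewrite Im_npowc; apply: norm_mul_le1; [exact: expR_ge0|exact: exp_ln_le|].
by rewrite ler_norml sin_geN1 sin_le1.
Qed.

Lemma power_weight01 a0 k : a0 <= 0 -> 0 <= power_weight a0 k <= 1.
Proof.
move=> a00; rewrite expR_ge0 /= -expR0 ler_expR.
by apply: mulr_le0_ge0 => //; exact: ln_nat_ge0.
Qed.

Lemma power_weight_lim a0 e : a0 < 0 -> 0 < e ->
  exists K, forall k, (K <= k)%N -> power_weight a0 k <= e.
Proof.
move=> a00 e0; exists (Num.bound (expR (ln e / a0))) => k Kk.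
have : expR (ln e / a0) < k%:R.
  apply: (@lt_le_trans _ _ (Num.bound (expR (ln e / a0)))%:R); last by rewrite ler_nat.
  by apply: archi_boundP; exact: expR_ge0.
move=> Ek; have k0 : 0 < k%:R :> R by apply: le_lt_trans Ek; exact: expR_ge0.
have : ln e / a0 <= ln k%:R.
  by rewrite -[leLHS]expRK ler_ln ?posrE ?expR_gt0 // ltW.
by rewrite ler_ndivrMr // => H; rewrite /power_weight -[leRHS](@lnK _ e) ?posrE // ler_expR mulrC.
Qed.
End powers.

Section centering.
Context d (T : measurableType d) (R : realType) (P : probability T R).
Variable xis : seq nat -> {mfun T >-> nat}.
Variables (p : nat -> R) (V : R).
Hypothesis crit : critical_law p V.
Hypothesis context_prob : forall s a, uniq s ->
  pr P (context xis s a) = \prod_(u <- s) p (a u).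
Local Notation q n := (forest_wt p n 1).
Local Notation size_is n := (gw_size xis @^-1` [set n]).

Let V_le : V <= (Num.bound V)%:R.
Proof.
have V0 : 0 <= V.
  by apply: le_trans (law_mom2 crit 0); rewrite /mom2 big_ord1 expr0n mul0r.
by apply: ltW; apply: archi_boundP.
Qed.

Let mS B : measurable (gw_size xis @^-1` B).
Proof. exact: (measurable_gw_tree xis [set t | B #|` t|%fset]). Qed.

Let q0 : q 0 = 0. Proof. by []. Qed.

Lemma sum_q_le1 N : \sum_(k < N) q k <= 1.
Proof.
apply: le_trans (pr_initial_le1 P mS N); apply: ler_sum => -[[|k] kN] _ /=.
  exact: pr_ge0.
by rewrite (pr_size context_prob).
Qed.

(** Size [0] stands for an infinite tree; it has probability [0] because the
    [q k] add up to one. *)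
Lemma pr_size_all k : pr P (size_is k) = q k.
Proof.
case: k => [|k]; last exact: (pr_size context_prob).
apply/eqP; rewrite eq_le pr_ge0 andbT; apply/ler_addgt0Pl => e e0; rewrite addr0.
have [N H] := q_total crit V_le sum_q_le1 e0.
have := H N.+1 (leqnSn N); have := pr_initial_le1 P mS N.+1.
rewrite !big_ord_recl /= add0r.
rewrite (eq_bigr (fun i : 'I_N => q (bump 0 i))); last first.
  by move=> i _; exact: (pr_size context_prob).
lra.
Qed.

(** The real and imaginary parts are instances of [conditioned_mean] with one
    common weight for the whole half plane. *)
Theorem centered_mean a0 e : a0 < 0 -> 0 < e ->
  exists n0, forall n, (n0 <= n)%N -> (0 < P (size_is n))%E ->
  forall a : R[i], complex.Re a <= a0 ->
  cabs (cexpectation (gw_cond xis P n) (gw_X xis a) - n%:R * gw_mu xis P a)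
    <= e * Num.sqrt n%:R.
Proof.
move=> a00 e0; have e20 : 0 < e / 2 by lra.
have [n0 H] := conditioned_mean crit V_le sum_q_le1 (fun k => power_weight01 k (ltW a00))
  (fun d d0 => power_weight_lim a00 d0) e20.
exists (maxn n0 1) => n; rewrite geq_max => /andP[n0n n1] Pn a aa.
have qn : 0 < q n by rewrite -pr_size_all fine_gt0 // Pn -ge0_fin_numE // fin_num_measure.
have real_part (f : nat -> R) : (forall k, `|f k| <= power_weight a0 k) ->
  `|fine 'E_(gw_cond xis P n)[(fun w => toll_sum f (gw_tree xis w))%R]%E -
    n%:R * fine 'E_P[(fun w => f (gw_size xis w))%R]%E| <= e / 2 * Num.sqrt n%:R.
  move=> fw; rewrite (mean_toll_sum context_prob) //; apply: H => // dl dP.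
  rewrite fine_expectation.
  under [X in _ - X]eq_bigr do rewrite -pr_size_all.
  under [X in dl * (1 - X)]eq_bigr do rewrite -pr_size_all.
  apply: (mean_truncation P mS (M := 1)).
    by move=> k; apply: le_trans (fw k) _; case/andP: (power_weight01 k (ltW a00)).
  by move=> k nk; apply: le_trans (fw k) (dP k nk).
have H1 := real_part _ (fun k => Re_npowc_le k aa).
have H2 := real_part _ (fun k => Im_npowc_le k aa).
set z := cexpectation _ _ - _.
have zR : complex.Re z = fine 'E_(gw_cond xis P n)[(fun w => toll_sum (fun k => complex.Re (npowc k a)) (gw_tree xis w))%R]%E -
    n%:R * fine 'E_P[(fun w => complex.Re (npowc (gw_size xis w) a))%R]%E.
  rewrite /z /gw_mu /cexpectation -realc_nat [LHS]/= mul0r subr0; congr (fine 'E_ _ [_]%E - _).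
  by apply/funext => w; rewrite /gw_X /tree_sum raddf_sum.
have zI : complex.Im z = fine 'E_(gw_cond xis P n)[(fun w => toll_sum (fun k => complex.Im (npowc k a)) (gw_tree xis w))%R]%E -
    n%:R * fine 'E_P[(fun w => complex.Im (npowc (gw_size xis w) a))%R]%E.
  rewrite /z /gw_mu /cexpectation -realc_nat [LHS]/= mul0r addr0; congr (fine 'E_ _ [_]%E - _).
  by apply/funext => w; rewrite /gw_X /tree_sum raddf_sum.
rewrite -zR in H1; rewrite -zI in H2.
apply: (le_trans (cabs_le_Re_Im z)); lra.
Qed.

End centering.

(** * Weak convergence under vanishing perturbations *)

Section borel.
Context d (T : measurableType d) (R : realType).

Lemma borel_measurable_comp (S S' : topologicalType) (X : T -> S) (h : S -> S') :
  continuous h -> borel_measurable X -> borel_measurable (h \o X).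
Proof.
move=> ch mX B; apply: (@smallest_sub _ (sigma_algebra setT) open
  [set B | measurable ((h \o X) @^-1` B)]); last first.
  move=> U oU /=; apply: (mX (h @^-1` U)); apply: sub_sigma_algebra.
  by move/continuousP: ch; exact.
split => [|A mA|A mA] /=.
- by rewrite preimage_set0; exact: measurable0.
- rewrite setTD (_ : _ @^-1` _ = ~` ((h \o X) @^-1` A)) //; exact: measurableC.
- by rewrite preimage_bigcup; exact: bigcupT_measurable.
Qed.

Lemma borel_measurable_real (X : T -> R) : borel_measurable X -> measurable_fun setT X.
Proof.
move=> mX; apply: (measurability _ (RGenOpens.measurableE R)) => //.
move=> _ [B [a [b ->]] <-]; rewrite setTI; apply: mX; apply: sub_sigma_algebra.
exact: interval_open.
Qed.

Lemma measurable_continuous_comp (S : topologicalType) (X : T -> S) (h : S -> R) :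
  continuous h -> borel_measurable X -> measurable_fun setT (h \o X).
Proof. by move=> ch mX; apply: borel_measurable_real; exact: borel_measurable_comp. Qed.

End borel.

Lemma cvg_near_dist (R : realType) (U : Type) (G : set_system U) {FG : Filter G}
    (h : U -> R) (l e : R) :
  h @ G --> l -> 0 < e -> \forall t \near G, `|l - h t| < e.
Proof. by move=> /cvgrPdist_lt hl; exact: hl. Qed.

Lemma continuous_near_dist (R : realType) (S : topologicalType) (f : S -> R) (x : S) e :
  continuous f -> 0 < e -> \forall y \near x, `|f x - f y| < e.
Proof. by move=> cf; exact: cvg_near_dist (cf x). Qed.

Section weak_convergence.
Context d d' (T : measurableType d) (T' : measurableType d') (R : realType).
Context (F : set_system nat) {FF : Filter F}.
Variables (P : nat -> probability T R) (Q : probability T' R).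

Lemma cvg_in_dist_map (S S' : topologicalType) X Y (h : S -> S') : continuous h ->
  cvg_in_dist F P X Q Y -> cvg_in_dist F P (fun n => h \o X n) Q (h \o Y).
Proof.
move=> ch [mX mY XY]; split.
- by apply: filterS mX => n; exact: borel_measurable_comp.
- exact: borel_measurable_comp.
- move=> f cf [M fM]; apply: (XY (f \o h)) => [x|]; last by exists M => s; exact: fM.
  by apply: continuous_comp; [exact: ch|exact: cf].
Qed.

Lemma cvg_in_dist_near (S : topologicalType) (X X' : nat -> T -> S) Y :
  (\forall n \near F, X n = X' n) ->
  cvg_in_dist F P X Q Y -> cvg_in_dist F P X' Q Y.
Proof.
move=> XX' [mX mY XY]; split => //.
  by apply: filterS2 XX' mX => n ->.
move=> f cf bf; apply: cvg_trans (XY f cf bf); apply: near_eq_cvg.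
by apply: filterS XX' => n ->.
Qed.

Lemma integrable_weak_test (S : topologicalType) d0 (T0 : measurableType d0)
    (P0 : probability T0 R) (X : T0 -> S) (f : S -> R) M :
  borel_measurable X -> continuous f -> (forall s, `|f s| <= M) ->
  P0.-integrable setT (EFin \o (fun w => f (X w))).
Proof.
move=> mX cf fM; apply: (@bounded_integrable _ _ _ P0 _ M); last by move=> w; exact: fM.
exact: measurable_continuous_comp cf mX.
Qed.

Lemma weak_limitP (S : topologicalType) X (Y : T' -> S) (f : S -> R) M :
  (\forall n \near F, borel_measurable (X n)) -> borel_measurable Y ->
  continuous f -> (forall s, `|f s| <= M) ->
  (('E_(P n)[(f \o X n)%R])%E @[n --> F] --> ('E_Q[(f \o Y)%R])%E) <->
  (forall e, 0 < e -> \forall n \near F,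
     `| \int[Q]_w f (Y w) - \int[P n]_w f (X n w)| < e).
Proof.
move=> mX mY cf fM.
have -> : ('E_Q[(f \o Y)%R])%E = (\int[Q]_w f (Y w))%:E.
  rewrite -(fine_expectation Q (fun w => f (Y w))) fineK // unlock.
  exact: integrable_fin_num (integrable_weak_test Q mY cf fM).
have E : fine \o (fun n => 'E_(P n)[(f \o X n)%R]%E) = fun n => \int[P n]_w f (X n w).
  by apply/funext => n; exact: fine_expectation.
rewrite fine_cvgP E; split=> [[_ /cvgrPdist_lt] //|H]; split; last exact/cvgrPdist_lt.
apply: filterS mX => n mX; rewrite unlock.
exact: integrable_fin_num (integrable_weak_test (P n) mX cf fM).
Qed.

(** The perturbations [tau m] tend to the identity locally uniformly. The late
    perturbations of a test function are squeezed between two fixed functions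
    that are again continuous and bounded. *)
Section slutsky.
Variables (S : topologicalType) (tau : nat -> S -> S).
Hypothesis tau_continuous : forall m, continuous (tau m).
Hypothesis tau_lim : forall (x : S) (U : set S), nbhs x U ->
  exists N, nbhs x [set y | forall m, (N <= m)%N -> U (tau m y)].

Section lower_envelope.
Variables (f : S -> R) (M : R).
Hypothesis f_continuous : continuous f.
Hypothesis fM : forall s, `|f s| <= M.

(** Late perturbations are controlled by [tau_lim], and finitely many others by
    their continuity. *)
Lemma tau_equicontinuous x e : 0 < e ->
  \forall y \near x, forall m, `|f (tau m x) - f (tau m y)| < e.
Proof.
move=> e0; have e20 : 0 < e / 2 by rewrite divr_gt0.
have [N HN] := tau_lim (continuous_near_dist x f_continuous e20).
have H m : \forall y \near x, `|f (tau m x) - f (tau m y)| < e.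
  have c : {for x, continuous (f \o tau m)}.
    by apply: continuous_comp; [exact: tau_continuous|exact: f_continuous].
  exact: cvg_near_dist c e0.
have H1 : \forall y \near x, forall m, (m < N)%N -> `|f (tau m x) - f (tau m y)| < e.
  elim: (N) => [|n IH]; first by apply: nearW.
  apply: filterS2 IH (H n) => y H1 H2 m; rewrite ltnS leq_eqVlt => /orP[/eqP -> //|].
  exact: H1.
have HNx : forall m, (N <= m)%N -> `|f x - f (tau m x)| < e / 2 := nbhs_singleton HN.
apply: filterS2 HN H1 => y H2 H3 m; have [Nm|/H3 //] := leqP N m.
have := HNx m Nm; have := H2 m Nm => /=; rewrite !ltr_norml => /andP[? ?] /andP[? ?].
by apply/andP; split; lra.
Qed.

(** A minorant of all [f \o tau m] with [N <= m]; equicontinuity of the family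
    makes it continuous. *)
Definition envelope N x := inf [set f (tau m x) | m in [set m | (N <= m)%N]].

Lemma envelope_lbound N x : lbound [set f (tau m x) | m in [set m | (N <= m)%N]] (- M).
Proof. by move=> _ [m _ <-]; have := fM (tau m x); rewrite ler_norml => /andP[]. Qed.

Lemma envelope_le N m x : (N <= m)%N -> envelope N x <= f (tau m x).
Proof. by move=> Nm; apply: ge_inf; [exists (- M); exact: envelope_lbound|exists m]. Qed.

Lemma le_envelope N x y : (forall m, (N <= m)%N -> y <= f (tau m x)) -> y <= envelope N x.
Proof.
move=> H; apply: lb_le_inf; first by exists (f (tau N x)), N => /=.
by move=> _ [m Nm <-]; exact: H.
Qed.

Lemma envelope_continuous N : continuous (envelope N).
Proof.
move=> x; apply/cvgrPdist_le => e e0.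
apply: filterS (tau_equicontinuous x e0) => y H.
rewrite ler_norml; apply/andP; split.
  suff : envelope N y - e <= envelope N x by lra.
  apply: le_envelope => m Nm.
  have := envelope_le y Nm; have := H m; rewrite ltr_norml => /andP[? ?]; lra.
suff : envelope N x - e <= envelope N y by lra.
apply: le_envelope => m Nm.
have := envelope_le x Nm; have := H m; rewrite ltr_norml => /andP[? ?]; lra.
Qed.

Lemma envelope_bound N x : `|envelope N x| <= M.
Proof.
rewrite ler_norml; apply/andP; split.
  by apply: le_envelope => m _; have := fM (tau m x); rewrite ler_norml => /andP[].
apply: (le_trans (envelope_le x (leqnn N))).
by have := fM (tau N x); rewrite ler_norml => /andP[].
Qed.

Lemma envelope_cvg x : envelope N x @[N --> \oo] --> f x.
Proof.
apply/cvgrPdist_le => e e0.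
have [N0 /nbhs_singleton HN] := tau_lim (continuous_near_dist x f_continuous e0).
exists N0 => // N /= N0N; rewrite ler_norml; apply/andP; split.
  have := envelope_le x (leqnn N); have := HN N N0N => /=; rewrite ltr_norml => /andP[? ?]; lra.
suff : f x - e <= envelope N x by lra.
apply: le_envelope => m Nm.
by have := HN m (leq_trans N0N Nm) => /=; rewrite ltr_norml => /andP[? ?]; lra.
Qed.

Variables (X : nat -> T -> S) (Y : T' -> S).
Hypothesis XY : cvg_in_dist F P X Q Y.
Hypothesis F_oo : forall N, \forall n \near F, (N <= n)%N.

(** For a fixed [N], weak convergence applies to the envelope; then [N] tends to
    infinity by dominated convergence. *)
Lemma lower_semilimit e : 0 < e ->
  \forall n \near F, \int[Q]_w f (Y w) - e < \int[P n]_w f (tau n (X n w)).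
Proof.
case: XY => mX mY cXY e0; have e20 : 0 < e / 2 by rewrite divr_gt0.
have iQ N := integrable_weak_test Q mY (@envelope_continuous N) (@envelope_bound N).
have [_ _ cv] : [/\ Q.-integrable setT (EFin \o (fun w => f (Y w))),
    [sequence \int[Q]_w `|(envelope n (Y w))%:E - (f (Y w))%:E|]_n%E @ \oo --> 0%E &
    [sequence \int[Q]_w (envelope n (Y w))%:E]_n%E @ \oo --> (\int[Q]_w (f (Y w))%:E)%E].
  apply: (@dominated_convergence _ _ _ Q setT measurableT
     (fun N w => (envelope N (Y w))%:E) (fun w => (f (Y w))%:E) (fun=> M%:E)).
  - by move=> N; exact: measurable_int (iQ N).
  - exact: measurable_int (integrable_weak_test Q mY f_continuous fM).
  - by apply: aeW => w _; apply/cvg_EFin; [exact: nearW|exact: envelope_cvg].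
  - by apply: finite_measure_integrable_cst.
  - by apply: aeW => w N _; rewrite /= lee_fin; exact: envelope_bound.
have [N HN] : exists N, \int[Q]_w f (Y w) - e / 2 < \int[Q]_w envelope N (Y w).
  have fc : \int[Q]_w envelope N (Y w) @[N --> \oo] --> \int[Q]_w f (Y w).
    have -> : (fun N => \int[Q]_w envelope N (Y w)) =
      fine \o [sequence \int[Q]_w (envelope n (Y w))%:E]_n%E by [].
    apply: fine_cvg; rewrite fineK //.
    exact: integrable_fin_num (integrable_weak_test Q mY f_continuous fM).
  have [N _ /(_ N (leqnn N))] := cvg_near_dist fc e20.
  by rewrite ltr_norml => /andP[? ?]; exists N; lra.
have eb : exists M0, forall s, `|envelope N s| <= M0 by exists M => s; exact: envelope_bound.
have := (weak_limitP mX mY (@envelope_continuous N) (@envelope_bound N)).1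
  (cXY _ (@envelope_continuous N) eb) _ e20.
move=> Hn; apply: filterS3 Hn mX (F_oo N) => n H mXn Nn.
have : \int[P n]_w envelope N (X n w) <= \int[P n]_w f (tau n (X n w)).
  apply: le_Rintegral => //.
  - exact: (integrable_weak_test (P n) mXn (@envelope_continuous N) (@envelope_bound N)).
  - apply: (@integrable_weak_test S _ _ (P n) (fun w => tau n (X n w)) f M) => //.
    exact: borel_measurable_comp (@tau_continuous n) mXn.
  - by move=> w _; exact: envelope_le.
by move: H; rewrite ltr_norml => /andP[? ?] ?; lra.
Qed.

End lower_envelope.

(** [lower_semilimit] is used for [f] and for [- f]. *)
Lemma slutsky X Y : (forall N, \forall n \near F, (N <= n)%N) ->
  cvg_in_dist F P X Q Y -> cvg_in_dist F P (fun n => tau n \o X n) Q Y.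
Proof.
move=> F_oo XY; have [mX mY _] := XY.
have mtX : \forall n \near F, borel_measurable (tau n \o X n).
  by apply: filterS mX => n; exact: borel_measurable_comp.
split => // f cf [M fM]; apply/(weak_limitP mtX mY cf fM) => e e0.
have cNf : continuous (fun s => - f s) by move=> s; apply: cvgN; exact: cf.
have fNM s : `|- f s| <= M by rewrite normrN.
have H1 := lower_semilimit cf fM XY F_oo e0.
have H2 := lower_semilimit cNf fNM XY F_oo e0.
have neg d0 (T0 : measurableType d0) (P0 : probability T0 R) (Z : T0 -> S) :
    borel_measurable Z -> \int[P0]_w (- f (Z w)) = - \int[P0]_w f (Z w).
  move=> mZ; rewrite -mulN1r -RintegralZl //; last exact: (integrable_weak_test P0 mZ cf fM).
  by apply: eq_Rintegral => w _; rewrite mulN1r.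
apply: filterS3 H1 H2 mtX => n; rewrite (neg _ _ Q Y mY) => H3 H4 mn.
move: H4; rewrite (neg _ _ (P n) (tau n \o X n) mn) ltr_norml => H4.
by apply/andP; split; move: H3 H4 => /=; lra.
Qed.

End slutsky.

End weak_convergence.

(** * Elementary bounds for complex powers *)

Section elementary_bounds.
Variable R : realType.
Implicit Types x y : R.

Lemma mvt0 (f df : R -> R) y : (forall x, is_derive x 1 f (df x)) -> 0 <= y ->
  exists2 c, 0 <= c <= y & f y - f 0 = df c * y.
Proof.
move=> fd y0; have [c cy E] := MVT_segment y0 (fun x _ => fd x)
  (continuous_subspaceT (fun x => differentiable_continuous ((derivable1_diffP _ _).1 (@ex_derive _ _ _ _ _ _ _ (fd x))))).
by exists c; [move: cy; rewrite in_itv|rewrite E subr0].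
Qed.

Lemma norm_sin_le y : `|sin y| <= `|y|.
Proof.
wlog y0 : y / 0 <= y.
  by move=> H; have [/H //|/ltW y0] := leP 0 y; rewrite -normrN -sinN -(normrN y); apply: H; rewrite oppr_ge0.
have [c _] := mvt0 (@is_derive_sin R) y0.
rewrite sin0 subr0 => ->; rewrite normrM -[leRHS]mul1r; apply: ler_wpM2r => //.
by rewrite ler_norml cos_geN1 cos_le1.
Qed.

Lemma cos_sub1E y : cos y - 1 = - (2 * sin (y / 2) ^+ 2).
Proof.
have E : y = (y / 2) *+ 2 by rewrite mulr2n; field.
by rewrite {1}E cos_mulr2n cos2sin2; ring.
Qed.

Lemma norm_cos_sub1_sqr y : `|cos y - 1| <= y ^+ 2.
Proof.
rewrite cos_sub1E normrN ger0_norm; last by apply: mulr_ge0 => //; exact: sqr_ge0.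
have H : sin (y / 2) ^+ 2 <= (y / 2) ^+ 2.
  by rewrite -(real_normK (num_real (sin _))) -(real_normK (num_real (y / 2))) lerXn2r ?nnegrE // norm_sin_le.
have := sqr_ge0 y; move: H; rewrite !expr2 => H H2; lra.
Qed.

Lemma norm_cos_sub1 y : `|cos y - 1| <= `|y|.
Proof.
rewrite cos_sub1E normrN ger0_norm; last by apply: mulr_ge0 => //; exact: sqr_ge0.
have H := norm_sin_le (y / 2).
have H1 : `|sin (y / 2)| <= 1 by rewrite ler_norml sin_geN1 sin_le1.
rewrite -(real_normK (num_real (sin _))).
have : `|sin (y / 2)| ^+ 2 <= `|y / 2|.
  by rewrite expr2; apply: le_trans H; rewrite -[leRHS]mulr1; apply: ler_wpM2l.
rewrite normrM (ger0_norm (_ : 0 <= 2^-1)) //; lra.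
Qed.

Lemma norm_sin_sub y : `|sin y - y| <= y ^+ 2.
Proof.
wlog y0 : y / 0 <= y.
  move=> H; have [/H //|/ltW y0] := leP 0 y; rewrite -sqrrN -normrN opprB addrC -sinN.
  rewrite -[X in _ + X]opprK; apply: H.
  by rewrite oppr_ge0.
have D x : is_derive x 1 (fun t => sin t - t) (cos x - 1).
  by apply: is_deriveB.
have [c /andP[c0 cy]] := mvt0 D y0.
rewrite sin0 !subr0 => ->; rewrite normrM (ger0_norm y0) expr2.
apply: ler_wpM2r => //; apply: (le_trans (norm_cos_sub1 c)); by rewrite ger0_norm.
Qed.

Lemma expR_sub1_le x : expR x - 1 <= x * expR x.
Proof.
have := expR_ge1Dx (- x); rewrite expRN => H.
have := ler_wpM2r (expR_ge0 x) H; rewrite mulVf ?gt_eqF ?expR_gt0 //; lra.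
Qed.

Lemma expR_norm_ge x : expR x <= expR `|x|.
Proof. by rewrite ler_expR ler_norm. Qed.

Lemma expR_norm_ge1 x : 1 <= expR `|x|.
Proof. by rewrite -expR0 ler_expR. Qed.

Lemma norm_expR_sub1 x : `|expR x - 1| <= `|x| * expR `|x|.
Proof.
have [x0|x0] := leP 0 x.
  by rewrite !ger0_norm // ?expR_sub1_le // subr_ge0 -expR0 ler_expR.
rewrite !ltr0_norm //; last by rewrite subr_lt0 -expR0 ltr_expR.
rewrite opprB; apply: (@le_trans _ _ (- x)); first by have := expR_ge1Dx x; lra.
rewrite -[leLHS]mulr1; apply: ler_wpM2l; first by rewrite oppr_ge0 ltW.
by rewrite -expR0 ler_expR oppr_ge0 ltW.
Qed.

Lemma norm_expR_sub1_sub x : `|expR x - 1 - x| <= x ^+ 2 * expR `|x|.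
Proof.
rewrite ger0_norm; last by have := expR_ge1Dx x; lra.
apply: (@le_trans _ _ (x * (expR x - 1))); first by have := expR_sub1_le x; lra.
apply: (le_trans (ler_norm _)); rewrite normrM -(real_normK (num_real x)) expr2 -mulrA.
by apply: ler_wpM2l => //; exact: norm_expR_sub1.
Qed.

(** The complex exponential of [x + i * y]. *)
Definition cexp (x y : R) : R[i] := (expR x)%:C%C * Complex (cos y) (sin y).

Lemma cabs_cexp x y : cabs (cexp x y) = expR x.
Proof.
rewrite cabsM cabs_real ger0_norm ?expR_ge0 // (_ : cabs _ = 1) ?mulr1 //.
apply/eqP; rewrite -sqrp_eq1 ?cabs_ge0 //; apply/eqP.
have := congr1 (@complex.Re R) (cabs_sqr (Complex (cos y) (sin y))) => /= ->.
by rewrite mulrN opprK -!expr2 cos2Dsin2.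
Qed.

Lemma cexpD x1 y1 x2 y2 : cexp (x1 + x2) (y1 + y2) = cexp x1 y1 * cexp x2 y2.
Proof.
rewrite /cexp expRD cosD sinD realcM mulrACA; congr (_ * _).
by rewrite [RHS]/GRing.mul /= ; congr Complex; rewrite addrC.
Qed.

Lemma cexp_taylor x y :
  cabs (cexp x y - 1 - Complex x y) <= 4 * (x ^+ 2 + y ^+ 2) * expR `|x|.
Proof.
apply: (le_trans (cabs_le_Re_Im _)); rewrite /cexp /= !mul0r subr0 addr0 subr0.
have E1 := norm_expR_sub1_sub x; have E2 := norm_expR_sub1 x.
have C2 := norm_cos_sub1_sqr y; have S2 := norm_sin_sub y; have S1 := norm_sin_le y.
have e1 := expR_norm_ge1 x; have e2 := expR_norm_ge x.
have ex0 := expR_ge0 x; set e := expR `|x| in E1 E2 e1 e2 *.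
have r1 : `|expR x * cos y - 1 - x| <= x ^+ 2 * e + e * y ^+ 2.
  rewrite (_ : _ - x = (expR x - 1 - x) + expR x * (cos y - 1)); last by ring.
  apply: (le_trans (ler_normD _ _)); apply: lerD => //.
  by rewrite normrM (ger0_norm ex0); apply: ler_pM.
have r2 : `|expR x * sin y - y| <= `|x| * e * `|y| + y ^+ 2.
  rewrite (_ : _ - y = (expR x - 1) * sin y + (sin y - y)); last by ring.
  apply: (le_trans (ler_normD _ _)); apply: lerD => //.
  by rewrite normrM; apply: ler_pM.
have r3 : `|x| * e * `|y| <= (x ^+ 2 + y ^+ 2) * e.
  rewrite mulrAC; apply: ler_wpM2r; first by lra.
  rewrite -(real_normK (num_real x)) -(real_normK (num_real y)) !expr2.
  have := sqr_ge0 (`|x| - `|y|); rewrite expr2.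
  have := sqr_ge0 (`|x| + `|y|); rewrite expr2; lra.
have r4 : y ^+ 2 <= y ^+ 2 * e by rewrite -[leLHS]mulr1; apply: ler_wpM2l => //; exact: sqr_ge0.
have r5 : 0 <= x ^+ 2 * e by apply: mulr_ge0; [exact: sqr_ge0|lra].
have r6 := sqr_ge0 y.
have -> : 4 * (x ^+ 2 + y ^+ 2) * e = 4 * (x ^+ 2 * e) + 4 * (y ^+ 2 * e) by ring.
move: r3; rewrite mulrDl => r3; lra.
Qed.

Lemma npowcE k (a : R[i]) : npowc k a = cexp (complex.Re a * ln k%:R) (complex.Im a * ln k%:R).
Proof. by []. Qed.

Lemma npowcD k (a b : R[i]) : npowc k (a + b) = npowc k a * npowc k b.
Proof. by rewrite !npowcE -cexpD -!mulrDl; case: a; case: b. Qed.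

Lemma cabs_npowc k (a : R[i]) : cabs (npowc k a) = expR (complex.Re a * ln k%:R).
Proof. exact: cabs_cexp. Qed.

Definition lnc k : R[i] := (ln k%:R)%:C%C.

Lemma npowc_taylor k (h : R[i]) : 
  cabs (npowc k h - 1 - h * lnc k) <= 4 * (cabs h ^+ 2 * ln k%:R ^+ 2) * expR (cabs h * ln k%:R).
Proof.
have -> : h * lnc k = Complex (complex.Re h * ln k%:R) (complex.Im h * ln k%:R).
  by case: h => x y; rewrite /lnc /GRing.mul /= !mulr0 subr0 add0r.
apply: (le_trans (cexp_taylor _ _)).
rewrite !exprMn -mulrDl -cabs_sqrE; apply: ler_wpM2l.
  by apply: mulr_ge0 => //; apply: mulr_ge0; exact: sqr_ge0.
rewrite ler_expR normrM (ger0_norm (ln_nat_ge0 _ k)); apply: ler_wpM2r (cabs_Re h).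
exact: ln_nat_ge0.
Qed.

Lemma le_expR x : x <= expR x.
Proof. by have := expR_ge1Dx x; lra. Qed.

Lemma lnc_npowc_bound r k (z : R[i]) : 0 < r -> complex.Re z <= - (2 * r) ->
  cabs (lnc k * npowc k z) <= r^-1.
Proof.
move=> r0 zr; rewrite cabsM cabs_npowc cabs_real ger0_norm ?ln_nat_ge0 //.
have L0 := ln_nat_ge0 R k; set L := ln _ in L0 *.
rewrite -[leRHS]mul1r ler_pdivlMr //.
have H1 : L * r <= expR (L * r) by exact: le_expR.
have H2 : expR (complex.Re z * L) <= expR (- (L * r)).
  rewrite ler_expR; have : complex.Re z * L <= - (2 * r) * L by exact: ler_wpM2r.
  have := mulr_ge0 L0 (ltW r0); lra.
rewrite mulrAC -(expRxMexpNx_1 (L * r)); apply: ler_pM => //.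
by apply: mulr_ge0 => //; exact: ltW.
Qed.

(** The constant does not depend on [k]: half of the decay [k ^ (- 2 * r)]
    absorbs the logarithms, the other half the growth of [npowc k h]. *)
Lemma npowc_quadratic r k (z h : R[i]) : 0 < r -> complex.Re z <= - (2 * r) -> cabs h <= r ->
  cabs (npowc k (z + h) - npowc k z - h * (lnc k * npowc k z)) <= 16 / r ^+ 2 * cabs h ^+ 2.
Proof.
move=> r0 zr hr; have L0 := ln_nat_ge0 R k.
rewrite npowcD (_ : _ - _ = npowc k z * (npowc k h - 1 - h * lnc k)); last by ring.
rewrite cabsM cabs_npowc.
have := ler_wpM2l (expR_ge0 (complex.Re z * ln k%:R)) (npowc_taylor k h).
move/le_trans; apply; set L := ln _ in L0 *.
have H1 : expR (complex.Re z * L) * expR (cabs h * L) <= expR (- (r * L)).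
  rewrite -expRD ler_expR -mulrDl -mulNr; apply: ler_wpM2r => //; lra.
have H2 : L ^+ 2 * (r ^+ 2 / 4) <= expR (r * L).
  have -> : L ^+ 2 * (r ^+ 2 / 4) = (r * L / 2) ^+ 2 by field.
  have -> : expR (r * L) = expR (r * L / 2) ^+ 2.
    by rewrite expr2 -expRD; congr expR; field.
  apply: lerXn2r; rewrite ?nnegrE ?expR_ge0 //; last exact: le_expR.
  by rewrite divr_ge0 // mulr_ge0 // ltW.
have H3 : L ^+ 2 * (r ^+ 2 / 4) * expR (- (r * L)) <= 1.
  by rewrite -[leRHS](expRxMexpNx_1 (r * L)); apply: ler_wpM2r => //; exact: expR_ge0.
have H4 : L ^+ 2 * (expR (complex.Re z * L) * expR (cabs h * L)) <= 4 / r ^+ 2.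
  apply: (@le_trans _ _ (L ^+ 2 * expR (- (r * L)))).
    by apply: ler_wpM2l => //; exact: sqr_ge0.
  rewrite ler_pdivlMr ?exprn_gt0 //.
  by move: H3; rewrite mulrAC mulrA ler_pdivrMr // mul1r.
have -> : expR (complex.Re z * L) * (4 * (cabs h ^+ 2 * L ^+ 2) * expR (cabs h * L)) =
  4 * (L ^+ 2 * (expR (complex.Re z * L) * expR (cabs h * L))) * cabs h ^+ 2 by ring.
apply: ler_wpM2r; first exact: sqr_ge0.
lra.
Qed.

End elementary_bounds.

(** * Holomorphy of the moments *)

Lemma quotient_error (F : fieldType) (h x l : F) : h != 0 ->
  l - h^-1 * x = - (h^-1 * (x - h * l)).
Proof. by move=> h0; field. Qed.

Lemma derivable_quadratic (R : realType) (g : R[i]^o -> R[i]^o) (z l : R[i]^o) (C r : R) :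
  0 < r -> (forall h : R[i]^o, cabs h <= r -> cabs (g (z + h) - g z - h * l) <= C * cabs h ^+ 2) ->
  derivable g z 1.
Proof.
move=> r0 H; apply/cvg_ex; exists l; apply/cvgrPdist_le => e e0.
have e1 := Re_gt0 e0.
have C0 : 0 < `|C| + 1 by rewrite ltr_wpDl.
pose s : R := Num.min r (complex.Re e / (`|C| + 1)).
have s0 : 0 < s by rewrite lt_min r0 divr_gt0.
have sc0 : 0 < s%:C%C :> R[i] by rewrite ltcR.
have near0 : \forall h \near (0 : R[i]^o)^', `|h| <= s%:C%C := dnbhs0_le sc0.
apply: filterS2 near0 (nbhs_dnbhs_neq (0 : R[i]^o)) => h; rewrite lec_cabs // => hs h0.
have hs' : cabs h <= s := hs.
rewrite lec_cabs // /shift /= [h *: 1]mulr1 [h + z]addrC.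
have hc : 0 < cabs h.
  by rewrite lt_neqAle cabs_ge0 andbT eq_sym; apply: contra h0 => /eqP hh; rewrite -normr_eq0 -cabsE hh.
have -> : l - h^-1 *: (g (z + h) - g z) = - (h^-1 * (g (z + h) - g z - h * l)).
  exact: (@quotient_error R[i] h (g (z + h) - g z) l h0).
rewrite cabsN cabsM.
rewrite (cabsV (h : R[i])).
rewrite mulrC ler_pdivrMr //.
apply: (le_trans (H h (le_trans hs' _))); first by rewrite ge_min lexx.
rewrite expr2 mulrA; apply: ler_wpM2r; first exact: ltW.
have : cabs h <= complex.Re e / (`|C| + 1) by apply: (le_trans hs'); rewrite ge_min lexx orbT.
rewrite ler_pdivlMr // => hC; apply: le_trans hC; rewrite mulrC; apply: ler_wpM2l.
  exact: ltW.
by apply: (le_trans (ler_norm C)); rewrite lerDl.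
Qed.

Section complex_mean.
Context d (T : measurableType d) (R : realType) (P : probability T R).
Variable N : T -> nat.
Hypothesis mN : forall B : set nat, measurable (N @^-1` B).
Implicit Types (f g : nat -> R[i]).

Definition cmean f := cexpectation P (fun w => f (N w)).

Lemma Re_integrable f M : (forall k, cabs (f k) <= M) ->
  P.-integrable setT (EFin \o (fun w => complex.Re (f (N w)))).
Proof.
move=> fM; apply: (@bounded_integrable _ _ _ P _ M).
  exact: (measurable_comp_discrete mN (fun k => complex.Re (f k))).
by move=> w; apply: le_trans (cabs_Re _) (fM _).
Qed.

Lemma Im_integrable f M : (forall k, cabs (f k) <= M) ->
  P.-integrable setT (EFin \o (fun w => complex.Im (f (N w)))).
Proof.
move=> fM; apply: (@bounded_integrable _ _ _ P _ M).
  exact: (measurable_comp_discrete mN (fun k => complex.Im (f k))).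
by move=> w; apply: le_trans (cabs_Im _) (fM _).
Qed.

Lemma cmeanE f : cmean f = Complex (\int[P]_w complex.Re (f (N w))) (\int[P]_w complex.Im (f (N w))).
Proof. by rewrite /cmean /cexpectation !fine_expectation. Qed.

Lemma cmeanB f g M : (forall k, cabs (f k) <= M) -> (forall k, cabs (g k) <= M) ->
  cmean (fun k => f k - g k) = cmean f - cmean g.
Proof.
move=> fM gM; rewrite !cmeanE [RHS]/=; congr Complex.
  rewrite -RintegralB //; [|exact: Re_integrable fM|exact: Re_integrable gM].
  by apply: eq_Rintegral => w _; case: (f _) => ? ?; case: (g _).
rewrite -RintegralB //; [|exact: Im_integrable fM|exact: Im_integrable gM].
by apply: eq_Rintegral => w _; case: (f _) => ? ?; case: (g _).
Qed.

Lemma cmeanZ c f M : (forall k, cabs (f k) <= M) -> cmean (fun k => c * f k) = c * cmean f.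
Proof.
move=> fM; have iR := Re_integrable fM; have iI := Im_integrable fM.
have scale (a : R) (h : T -> R) : P.-integrable setT (EFin \o h) ->
    P.-integrable setT (EFin \o (fun w => a * h w)).
  move=> ih; rewrite (_ : _ \o _ = (fun w => a%:E * (h w)%:E)%E) //.
  exact: integrableZl.
case: c => a b; rewrite !cmeanE [RHS]/=; congr Complex.
  rewrite -!RintegralZl // -RintegralB //; try exact: scale.
  by apply: eq_Rintegral => w _; case: (f _).
rewrite -!RintegralZl // -RintegralD //; try exact: scale.
by apply: eq_Rintegral => w _; case: (f _).
Qed.

Lemma norm_mean_le (h : T -> R) M : measurable_fun setT h -> (forall w, `|h w| <= M) ->
  `|\int[P]_w h w| <= M.
Proof.
move=> mh hM; have ih := bounded_integrable P mh hM.
apply: (le_trans (le_normr_Rintegral _ ih)) => //.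
apply: (@le_trans _ _ (\int[P]_w M)).
  apply: le_Rintegral => //; first exact: integrable_norm.
  exact: finite_measure_integrable_cst.
rewrite Rintegral_cst // [X in fine X](_ : _ = 1%E) ?mulr1 //.
exact: probability_setT.
Qed.

Lemma cmean_le f M : (forall k, cabs (f k) <= M) -> cabs (cmean f) <= 2 * M.
Proof.
move=> fM; apply: (le_trans (cabs_le_Re_Im _)); rewrite cmeanE [_ + _]/=.
have H1 : `|\int[P]_w complex.Re (f (N w))| <= M.
  apply: norm_mean_le; first exact: (measurable_comp_discrete mN (fun k => complex.Re (f k))).
  by move=> w; apply: le_trans (cabs_Re _) (fM _).
have H2 : `|\int[P]_w complex.Im (f (N w))| <= M.
  apply: norm_mean_le; first exact: (measurable_comp_discrete mN (fun k => complex.Im (f k))).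
  by move=> w; apply: le_trans (cabs_Im _) (fM _).
by move: H1 H2 => /=; lra.
Qed.

Lemma cabs_npowc_le1 k (a : R[i]) : complex.Re a <= 0 -> cabs (npowc k a) <= 1.
Proof.
move=> a0; rewrite cabs_npowc -[leRHS]expR0 ler_expR.
by apply: mulr_le0_ge0 => //; exact: ln_nat_ge0.
Qed.

(** The quadratic remainder of the powers is uniform in [k], so it passes to the
    mean and differentiates it directly. *)
Theorem derivable_moment (z : R[i]^o) : complex.Re z < 0 ->
  derivable (fun a : R[i]^o => cmean (fun k => npowc k a) : R[i]^o) z 1.
Proof.
move=> z0; pose r := - complex.Re z / 2.
have r0 : 0 < r by rewrite /r; lra.
have zr : complex.Re z <= - (2 * r) by rewrite /r; lra.
pose l := cmean (fun k => lnc R k * npowc k z).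
apply: (@derivable_quadratic R _ z l (2 * (16 / r ^+ 2)) r) => // h hr.
have zh : complex.Re (z + h) <= 0.
  rewrite raddfD /=; have := cabs_Re h; rewrite ler_norml => /andP[_ H].
  by move: hr H; rewrite /r => ? ?; lra.
have b1 k := cabs_npowc_le1 k zh.
have b2 k := cabs_npowc_le1 k (ltW z0).
have b3 k : cabs (lnc R k * npowc k z) <= r^-1 by exact: lnc_npowc_bound.
rewrite -(cmeanB b1 b2) /l -(cmeanZ h b3) -mulrA.
pose M := 2 + cabs h * r^-1.
have M1 k : cabs (npowc k (z + h) - npowc k z) <= M.
  apply: (le_trans (cabsB _ _)); have := b1 k; have := b2 k.
  have : 0 <= cabs h * r^-1 by apply: mulr_ge0; [exact: cabs_ge0|rewrite invr_ge0 ltW].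
  by rewrite /M; lra.
have M2 k : cabs (h * (lnc R k * npowc k z)) <= M.
  rewrite cabsM; have : cabs h * cabs (lnc R k * npowc k z) <= cabs h * r^-1.
    by apply: ler_wpM2l => //; exact: cabs_ge0.
  by rewrite /M; lra.
rewrite -(cmeanB M1 M2); apply: cmean_le => k.
exact: npowc_quadratic.
Qed.

Lemma derivable_npowc k (z : R[i]^o) : complex.Re z < 0 ->
  derivable (fun a : R[i]^o => npowc k a : R[i]^o) z 1.
Proof.
move=> z0; pose r := - complex.Re z / 2.
have r0 : 0 < r by rewrite /r; lra.
have zr : complex.Re z <= - (2 * r) by rewrite /r; lra.
apply: (@derivable_quadratic R _ z (lnc R k * npowc k z) (16 / r ^+ 2) r) => // h hr.
exact: npowc_quadratic.
Qed.

End complex_mean.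

(** * The space of holomorphic functions and the theorem *)

Section holomorphic_functions.
Variables (R : realType) (D : set R[i]^o).
Implicit Types (f g x : hol D).

Lemma hol_cvg (I : Type) (G : set_system I) {FG : Filter G} (h : I -> hol D) x :
  (forall K : set D, compact K -> forall e, 0 < e -> \forall t \near G,
     forall z, K z -> cabs (hol_eval x z - hol_eval (h t) z) < e) ->
  h @ G --> x.
Proof.
move=> H U [_ [[W oW <-] Wx] WU].
have cv : {family compact, (fun t => set_val (h t) : D -> R[i]^o) @ G --> (set_val x : D -> R[i]^o)}.
  apply/fam_cvgP => K cK V /uniform_nbhs[E [entE EV]].
  move: entE; rewrite -entourage_ballE => -[e /= e0 eE].
  have := H K cK _ (Re_gt0 e0); apply: filterS => t Ht; apply: EV => z Kz.
  by apply: eE => /=; rewrite -ball_normE /= ltc_cabs //; exact: Ht.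
have GW : G [set t | W (set_val (h t))] := cv W (open_nbhs_nbhs (conj oW Wx)).
exact: filterS (fun t => @WU (h t)) GW.
Qed.

Lemma hol_near x (K : set D) e : compact K -> 0 < e ->
  \forall y \near x, forall z, K z -> cabs (hol_eval x z - hol_eval y z) < e.
Proof.
move=> cK e0.
have ec0 : 0 < e%:C%C :> R[i] by rewrite ltcR.
have entE : entourage [set uv : R[i]^o * R[i]^o | ball uv.1 e%:C%C uv.2].
  by rewrite -entourage_ballE; exists e%:C%C.
have := @fam_nbhs D R[i]^o compact K _ (set_val x) entE cK.
move/(@initial_continuous _ _ (set_val : hol D -> {family compact, D -> R[i]^o}) x).
move=> H; apply: (filterS _ (H : nbhs x [set y : hol D | forall z : D, K z -> ball (set_val x z) e%:C%C (set_val y z)])).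
move=> y Hy z Kz; have := Hy z Kz.
by rewrite /= -ball_normE /= ltc_cabs.
Qed.

Lemma hol_eval_continuous (z : D) : continuous (fun f : hol D => hol_eval f z).
Proof.
move=> x; apply/(@cvgrPdist_lt _ _ _ (nbhs x) (nbhs_filter x)) => e e0.
apply: (@filterS _ (nbhs x) (nbhs_filter x) _ _ _ (hol_near x (@compact_set1 _ z) (Re_gt0 e0))) => y H.
by rewrite ltc_cabs //; exact: H.
Qed.

Lemma hol_analytic f : exists2 g : R[i]^o -> R[i]^o,
  (forall z, D z -> derivable g z 1) & (forall z : D, hol_eval f z = g (set_val z)).
Proof. by have := set_valP f. Qed.

End holomorphic_functions.

Section hol_translation.
Variables (R : realType) (D : set R[i]^o).
Implicit Types (f g x c : hol D).

Lemma hol_of (g : R[i]^o -> R[i]^o) : (forall z, D z -> derivable g z 1) ->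
  exists f : hol D, forall z : D, hol_eval f z = g (set_val z).
Proof.
move=> dg; have ag : analytic_on D (fun z : D => g (set_val z)) by exists g.
by exists (exist (fun u => u \in analytic_on D) _ (mem_set ag) : hol D).
Qed.

Lemma analytic_add f c : analytic_on D (fun z : D => hol_eval f z + hol_eval c z).
Proof.
have [g1 d1 E1] := hol_analytic f; have [g2 d2 E2] := hol_analytic c.
exists (g1 + g2); first by move=> z Dz; apply: derivableD; [exact: d1|exact: d2].
by move=> z; rewrite E1 E2.
Qed.

Definition hol_add c f : hol D := exist (fun u => u \in analytic_on D) _ (mem_set (analytic_add f c)).

Lemma hol_addE c f z : hol_eval (hol_add c f) z = hol_eval f z + hol_eval c z.
Proof. by []. Qed.

Lemma hol_add_continuous c : continuous (hol_add c).
Proof.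
move=> x; apply: (@hol_cvg R D _ (nbhs x) (nbhs_filter x)) => K cK e e0.
apply: (@filterS _ (nbhs x) (nbhs_filter x) _ _ _ (hol_near x cK e0)) => y H z Kz.
by rewrite !hol_addE opprD addrACA subrr addr0; exact: H.
Qed.

Lemma hol_add_cvg (c : nat -> hol D) :
  (forall K : set D, compact K -> forall e, 0 < e ->
     exists N, forall m, (N <= m)%N -> forall z, K z -> cabs (hol_eval (c m) z) < e) ->
  forall x (U : set (hol D)), nbhs x U ->
    exists N, nbhs x [set y | forall m, (N <= m)%N -> U (hol_add (c m) y)].
Proof.
move=> c0 x U xU.
have Fx := nbhs_filter x.
have H : (fun ym : hol D * nat => hol_add (c ym.2) ym.1) @ filter_prod (nbhs x) \oo --> x.
  apply: hol_cvg => K cK e e0; have e20 : 0 < e / 2 by rewrite divr_gt0.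
  have [N HN] := c0 K cK _ e20.
  exists ([set y | forall z, K z -> cabs (hol_eval x z - hol_eval y z) < e / 2],
          [set m | (N <= m)%N]).
    by split; [exact: hol_near|exists N].
  move=> [y m] [/= Hy Nm] z Kz; rewrite hol_addE opprD addrA.
  apply: (le_lt_trans (cabsB _ _)).
  by have := Hy z Kz; have := HN m Nm z Kz; lra.
have [[A B] /= [xA [N _ NB]] AB] := H U xU.
exists N; apply: (@filterS _ (nbhs x) Fx _ _ _ xA) => y Ay m Nm.
by apply: (AB (y, m)); split => //; exact: NB.
Qed.

End hol_translation.

Lemma continuous_Re (R : realType) : continuous (fun z : R[i]^o => complex.Re z).
Proof.
move=> x; have Fx : Filter (nbhs (x : R[i]^o)) := nbhs_filter _.
apply/(@cvgrPdist_lt _ _ _ (nbhs (x : R[i]^o)) Fx) => e e0.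
have ec0 : 0 < e%:C%C :> R[i] by rewrite ltcR.
apply: (@filterS _ _ Fx _ _ _ (nbhsx_ballx (x : R[i]^o) _ ec0)) => y; rewrite -ball_normE /= ltc_cabs // => H.
by apply: le_lt_trans H; have := cabs_Re (x - y); case: (x) => ? ?; case: (y).
Qed.

(** This turns the uniformity of [centered_mean] over half planes into uniformity
    on compact sets. *)
Lemma compact_Hminus (R : realType) (K : set (Hminus R)) : compact K ->
  exists2 a0 : R, a0 < 0 & forall z, K z -> complex.Re (set_val z) <= a0.
Proof.
move=> cK; have [[z0 Kz0]|K0] := pselect (K !=set0); last first.
  exists (-1); first by rewrite ltrN10.
  by move=> z Kz; case: K0; exists z.
have cR : continuous (fun z : Hminus R => complex.Re (set_val z)).
  move=> z; apply: (@continuous_comp _ _ _ (set_val : Hminus R -> R[i]^o) (fun z => complex.Re z)).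
    exact: initial_continuous.
  exact: continuous_Re.
have [z Kz Hz] := compact_EVT_max (ex_intro _ z0 Kz0) cK (continuous_subspaceT cR).
exists (complex.Re (set_val z)); first exact: set_valP z.
by move=> y Ky; apply: Hz; rewrite inE.
Qed.

Section main.
Context d (T : measurableType d) (R : realType) (P : probability T R).
Variable xis : seq nat -> {mfun T >-> nat}.
Variables (p : nat -> R) (V : R).
Hypothesis crit : critical_law p V.
Hypothesis context_prob : forall s a, uniq s ->
  pr P (context xis s a) = \prod_(u <- s) p (a u).
Local Notation q n := (forest_wt p n 1).
Local Notation size_is n := (gw_size xis @^-1` [set n]).
Local Notation cmeanX n a := (cexpectation (gw_cond xis P n) (gw_X xis a)).

Lemma cmeanXE n (a : R[i]) : (0 < n)%N -> (0 < P (size_is n))%E ->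
  cmeanX n a = \sum_(k < n.+1)
    (q k * conv_pow p (n - k)%N (n - k)%N / q n)%:C%C * npowc k a.
Proof.
move=> n0 Pn; rewrite /cexpectation.
have -> : (fun w => complex.Re (gw_X xis a w)) =
    fun w => toll_sum (fun k => complex.Re (npowc k a)) (gw_tree xis w).
  by apply/funext => w; rewrite /gw_X /tree_sum raddf_sum.
have -> : (fun w => complex.Im (gw_X xis a w)) =
    fun w => toll_sum (fun k => complex.Im (npowc k a)) (gw_tree xis w).
  by apply/funext => w; rewrite /gw_X /tree_sum raddf_sum.
rewrite !(mean_toll_sum context_prob) // !mulr_suml.
rewrite [RHS](_ : _ = Complex (complex.Re (\sum_(k < n.+1)
    (q k * conv_pow p (n - k)%N (n - k)%N / q n)%:C%C * npowc k a))
  (complex.Im (\sum_(k < n.+1)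
    (q k * conv_pow p (n - k)%N (n - k)%N / q n)%:C%C * npowc k a))); last by case: (\sum_(k < _) _).
rewrite !raddf_sum; congr Complex; apply: eq_bigr => k _.
  by case: (npowc k a) => x y /=; ring.
by case: (npowc k a) => x y /=; ring.
Qed.

Lemma derivable_cmeanX n (z : R[i]^o) : (0 < n)%N -> (0 < P (size_is n))%E ->
  complex.Re z < 0 -> derivable (fun a : R[i]^o => cmeanX n a : R[i]^o) z 1.
Proof.
move=> n0 Pn z0.
rewrite (_ : (fun a => _) = \sum_(k < n.+1)
   ((q k * conv_pow p (n - k)%N (n - k)%N / q n)%:C%C \*: (fun a : R[i]^o => npowc k a : R[i]^o))); last first.
  by apply/funext => a; rewrite cmeanXE // fct_sumE.
by apply: derivable_sum => k; apply: derivableZ; exact: derivable_npowc.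
Qed.

(** The deterministic difference between the two centrings of the theorem. *)
Definition recentering n (a : R[i]) : R[i] :=
  (cmeanX n a - n%:R * gw_mu xis P a) / (Num.sqrt n%:R)%:C%C.

Lemma derivable_recentering n (z : R[i]^o) : (0 < n)%N -> (0 < P (size_is n))%E ->
  complex.Re z < 0 -> derivable (recentering n : R[i]^o -> R[i]^o) z 1.
Proof.
move=> n0 Pn z0.
have mS B : measurable (gw_size xis @^-1` B).
  exact: (measurable_gw_tree xis [set t | B #|` t|%fset]).
rewrite (_ : recentering n = ((Num.sqrt n%:R)%:C%C)^-1 \*:
   ((fun a : R[i]^o => cmeanX n a : R[i]^o) -
     (n%:R : R[i]) \*: (fun a : R[i]^o => gw_mu xis P a : R[i]^o))); last first.
  by apply/funext => a; rewrite /recentering mulrC.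
apply: derivableZ; apply: derivableB; first exact: derivable_cmeanX.
apply: derivableZ; exact: (@derivable_moment _ T R P (gw_size xis) mS z z0).
Qed.

(** Sizes of probability [0] get the zero function, so that the convergence holds
    along all integers. *)
Lemma recentering_hol : exists c : nat -> hol (Hminus R),
  (forall n, (0 < n)%N -> (0 < P (size_is n))%E ->
     forall z : Hminus R, hol_eval (c n) z = recentering n (set_val z)) /\
  (forall K : set (Hminus R), compact K -> forall e, 0 < e ->
     exists N, forall n, (N <= n)%N -> forall z, K z -> cabs (hol_eval (c n) z) < e).
Proof.
have H n : exists f : hol (Hminus R), forall z : Hminus R, hol_eval f z =
    if (0 < n)%N && (0 < P (size_is n))%E then recentering n (set_val z) else 0.
  case: (boolP ((0 < n)%N && (0 < P (size_is n))%E)) => [/andP[n0 Pn]|_].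
    by apply: (@hol_of R (Hminus R) (recentering n)) => z z0; exact: derivable_recentering.
  by apply: (@hol_of R (Hminus R) (fun=> 0)) => z z0; exact: derivable_cst.
have [c cE] := choice H; exists c; split.
  by move=> n n0 Pn z; rewrite cE n0 Pn.
move=> K cK e e0; have [a0 a00 Ka] := compact_Hminus cK.
have e20 : 0 < e / 2 by rewrite divr_gt0.
have [N HN] := centered_mean crit context_prob a00 e20.
exists N => n Nn z Kz; rewrite cE; case: ifP => [/andP[n0 Pn]|_]; last by rewrite cabs0.
have s0 : 0 < Num.sqrt n%:R :> R by rewrite sqrtr_gt0 ltr0n.
apply: (@le_lt_trans _ _ (e / 2)); last by lra.
rewrite /recentering cabsM cabsV cabs_real gtr0_norm // ler_pdivrMr //.
by apply: HN => //; exact: Ka.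
Qed.

End main.

Theorem theorem1p9 (R : realType)
  (d0 : measure_display) (Omega0 : measurableType d0)
  (P0 : probability Omega0 R) (xi : {RV P0 >-> nat})
  (d : measure_display) (Omega : measurableType d)
  (P : probability Omega R) (xis : seq nat -> {RV P >-> nat})
  (d' : measure_display) (Omega' : measurableType d')
  (Q : probability Omega' R) (Xhat : Omega' -> hol (Hminus R)) :
  'E_P0[(fun w => (xi w)%:R)%R]%E = 1%E ->
  (0 < 'V_P0[(fun w => (xi w)%:R)%R] < +oo)%E ->
  iid_copies xis P P0 xi ->
  is_Xhat xis P Q Xhat ->
  (forall alpha : Hminus R,
     cvg_in_dist (gw_infty xis P) (gw_cond xis P)
       (fun n w => (gw_X xis (set_val alpha) w
                      - n%:R * gw_mu xis P (set_val alpha))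
                   / (Num.sqrt n%:R)%:C%C : R[i]^o)
       Q (fun w => hol_eval (Xhat w) alpha)) /\
  cvg_in_hol (gw_infty xis P) (gw_cond xis P)
    (fun n alpha w => (gw_X xis alpha w - n%:R * gw_mu xis P alpha)
                      / (Num.sqrt n%:R)%:C%C) Q Xhat.
Proof.
move=> xi1 xiV iid [_ [Z ZX ZXhat]].
have crit := critical_law_of xi1 xiV.
have [c [cE c0]] := recentering_hol crit (iid_context_prob iid).
have FF : Filter (gw_infty xis P) by exact: within_filter.
have F_oo N : \forall n \near gw_infty xis P, (N <= n)%N by exists N.
have F_size : \forall n \near gw_infty xis P, (0 < P (gw_size xis @^-1` [set n]))%E.
  by exists 0%N => // n _ /=; apply.
pose Z' n := hol_add (c n) \o Z n.
have Z'Xhat : cvg_in_dist (gw_infty xis P) (gw_cond xis P) Z' Q Xhat.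
  by apply: (slutsky (fun m => @hol_add_continuous R (Hminus R) (c m)) (hol_add_cvg c0)).
have Z'X : \forall n \near gw_infty xis P, forall w (z : Hminus R),
    hol_eval (Z' n w) z = (gw_X xis (set_val z) w - n%:R * gw_mu xis P (set_val z))
                      / (Num.sqrt n%:R)%:C%C.
  apply: filterS3 ZX F_size (F_oo 1%N) => n Zn Pn n0 w z.
  by rewrite /Z' /= hol_addE Zn cE // /recentering -mulrDl addrA subrK.
split; last by exists Z'.
move=> alpha.
apply: (cvg_in_dist_near _ (cvg_in_dist_map (@hol_eval_continuous R (Hminus R) alpha) Z'Xhat)).
by apply: filterS Z'X => n H; apply/funext => w; exact: H.
Qed.
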